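(* Let $1<p_j,q_j<\infty$ and $\alpha_j\ge0$ for $j=0,1$, let $0<\theta<1$, and set $\alpha=\alpha_0(1-\theta)+\alpha_1\theta$, $\frac1p=\frac{1-\theta}{p_0}+\frac{\theta}{p_1}$, $\frac1q=\frac{1-\theta}{q_0}+\frac{\theta}{q_1}$. Then: (i) if $f\in B^{\alpha_j}_{p_j,q_j}(\gamma_d)$ for $j=0,1$, then $f\in B^{\alpha}_{p,q}(\gamma_d)$; (ii) if $f\in F^{\alpha_j}_{p_j,q_j}(\gamma_d)$ for $j=0,1$, then $f\in F^{\alpha}_{p,q}(\gamma_d)$.
   Context: $\gamma_d$ is the Gaussian probability measure on $\mathbb{R}^d$ with density $\pi^{-d/2}e^{-|x|^2}$, and $\|\cdot\|_{p,\gamma_d}$ is the norm of $L^p(\gamma_d)$. Ornstein-Uhlenbeck semigroup: $T_tf(x)=\pi^{-d/2}(1-e^{-2t})^{-d/2}\int_{\mathbb{R}^d}e^{-|y-e^{-t}x|^2/(1-e^{-2t})}f(y)\,dy$ for $t>0$, $T_0f=f$. Poisson-Hermite semigroup: $P_tf(x)=\int_0^\infty T_sf(x)\,\mu_t^{(1/2)}(ds)$ for $t>0$, where $\mu^{(1/2)}_t(ds)=\frac{t}{2\sqrt{\pi}}\frac{e^{-t^2/4s}}{s^{3/2}}ds$ on $(0,\infty)$; $P_0f=f$. Gaussian Besov-Lipschitz spaces: let $\alpha\ge0$, $k$ the smallest integer greater than $\alpha$, $1\le p\le\infty$, $1\le q<\infty$. $B^{\alpha}_{p,q}(\gamma_d)$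 is the set of $f\in L^p(\gamma_d)$ with $\left(\int_0^\infty\left(t^{k-\alpha}\left\|\frac{\partial^kP_tf}{\partial t^k}\right\|_{p,\gamma_d}\right)^q\frac{dt}{t}\right)^{1/q}<\infty$. Gaussian Triebel-Lizorkin spaces: let $\alpha\ge0$, $k$ the smallest integer greater than $\alpha$, $1\le p,q<\infty$. $F^{\alpha}_{p,q}(\gamma_d)$ is the set of $f\in L^p(\gamma_d)$ with $\left\|\left(\int_0^\infty\left(t^{k-\alpha}\left|\frac{\partial^kP_tf}{\partial t^k}\right|\right)^q\frac{dt}{t}\right)^{1/q}\right\|_{p,\gamma_d}<\infty$. *)

(* Defs.v *)
From HB Require Import structures.
From mathcomp Require Import all_boot all_order all_algebra.
From mathcomp Require Import all_classical all_reals all_analysis.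
From mathcomp Require Import measurable_realfun.

Set Implicit Arguments.
Unset Strict Implicit.
Unset Printing Implicit Defensive.

Import Order.TTheory GRing.Theory Num.Theory.
Import numFieldNormedType.Exports.

Local Open Scope classical_set_scope.
Local Open Scope ring_scope.

Section LebesgueMeasureRn.
Context {R : realType}.

(* The library's lebesgue_measure lives on measurableTypeR R, whose display
   differs from that of R; the product below needs this type. *)
Definition cons_pair n (x : measurableTypeR R * n.-tuple R) : n.+1.-tuple R :=
  [tuple of x.1 :: x.2].

Lemma measurable_cons_pair n : measurable_fun [set: measurableTypeR R * n.-tuple R] (@cons_pair n).
Proof. exact: measurable_cons. Qed.

Definition uncons_pair n (x : n.+1.-tuple R) :
    measurableTypeR R * n.-tuple R :=
  (thead x, [tuple of behead x]).

Lemma cons_pairK n : cancel (@cons_pair n) (@uncons_pair n).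
Proof.
by move=> [a x]; rewrite /uncons_pair theadE; congr pair; apply: val_inj.
Qed.

Lemma uncons_pairK n : cancel (@uncons_pair n) (@cons_pair n).
Proof. by move=> x; rewrite [RHS](tuple_eta x); apply: val_inj. Qed.

Lemma measurable_uncons_pair n :
  measurable_fun [set: n.+1.-tuple R] (@uncons_pair n).
Proof.
apply: measurable_fun_pair; first exact: measurable_tnth.
exact: measurable_behead.
Qed.

Section step.
Variables (n : nat) (m : {sigma_finite_measure set (n.-tuple R) -> \bar R}).

Definition lebesgue_cons : set (n.+1.-tuple R) -> \bar R :=
  pushforward (@lebesgue_measure R \x m)%E (@cons_pair n).

HB.instance Definition _ := Measure.copy lebesgue_cons
  (measure_function_pushforward__canonical__measure_function_Measure
    (@lebesgue_measure R \x m)%E (@measurable_cons_pair n)).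

Let lebesgue_cons_sigma_finite : sigma_finite setT lebesgue_cons.
Proof.
have /sigma_finiteP[F [TF ndF Foo]] := sigma_finiteT (@lebesgue_measure R).
have /sigma_finiteP[G [TG ndG Goo]] := sigma_finiteT m.
exists (fun k => @uncons_pair n @^-1` (F k `*` G k)).
  rewrite -preimage_bigcup (_ : \bigcup_i _ = setT) ?preimage_setT//.
  apply/seteqP; split=> // -[x y] _.
  have [i _ Fix] : (\bigcup_i F i) x by rewrite -TF.
  have [j _ Gjy] : (\bigcup_i G i) y by rewrite -TG.
  exists (maxn i j) => //; split => /=.
    by move: x Fix; exact/subsetPset/ndF/leq_maxl.
  by move: y Gjy; exact/subsetPset/ndG/leq_maxr.
move=> k; have [mF Fk] := Foo k; have [mG Gk] := Goo k; split.
  rewrite -[X in measurable X]setTI; apply: measurable_uncons_pair => //.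
  exact: measurableX.
rewrite /lebesgue_cons /pushforward -comp_preimage.
rewrite (_ : _ \o _ = id); last by apply/funext => x; exact: cons_pairK.
by rewrite preimage_id product_measure1E// lte_mul_pinfty// ge0_fin_numE.
Qed.

HB.instance Definition _ := Measure_isSigmaFinite.Build _ _ _ lebesgue_cons
  lebesgue_cons_sigma_finite.

End step.

(* Lebesgue measure on the Borel sets of R^d: iterated product, carried over to
   tuples by cons_pair; R^0 is a point of mass 1. *)
Fixpoint lebesgue_tuple (d : nat) :
    {sigma_finite_measure set (d.-tuple R) -> \bar R} :=
  match d with
  | 0 => [the {sigma_finite_measure set (0.-tuple R) -> \bar R} of
           \d_([tuple] : 0.-tuple R)]
  | d'.+1 => [the {sigma_finite_measure set (d'.+1.-tuple R) -> \bar R} of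
           lebesgue_cons (lebesgue_tuple d')]
  end.

End LebesgueMeasureRn.

Section GaussianMeasure.
Context {R : realType} (d : nat).

Definition sqnorm (x : d.-tuple R) : R := \sum_(i < d) tnth x i ^+ 2.

Lemma measurable_sqnorm : measurable_fun [set: d.-tuple R] sqnorm.
Proof.
apply: measurable_sum => i; apply: measurable_funX.
exact: measurable_tnth.
Qed.

Definition gauss_density (x : d.-tuple R) : R :=
  pi `^ (- (d%:R / 2)) * expR (- sqnorm x).

Lemma gauss_density_ge0 x : 0 <= gauss_density x.
Proof. by rewrite mulr_ge0 ?powR_ge0 ?expR_ge0. Qed.

Lemma measurable_gauss_density : measurable_fun [set: d.-tuple R] gauss_density.
Proof.
apply: measurable_funM => //; apply: measurableT_comp => //.
by apply: measurableT_comp => //; exact: measurable_sqnorm.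
Qed.

Definition gauss_measure (A : set (d.-tuple R)) : \bar R :=
  (\int[lebesgue_tuple d]_(x in A) (gauss_density x)%:E)%E.

Let gauss_measure0 : gauss_measure set0 = 0%E.
Proof. exact: integral_set0. Qed.

Let gauss_measure_ge0 A : (0 <= gauss_measure A)%E.
Proof. by apply: integral_ge0 => x _; rewrite lee_fin gauss_density_ge0. Qed.

Let gauss_measure_sigma_additive : semi_sigma_additive gauss_measure.
Proof.
apply: semi_sigma_additive_nng_induced.
  by apply/measurable_EFinP; exact: measurable_gauss_density.
by move=> x; rewrite lee_fin gauss_density_ge0.
Qed.

HB.instance Definition _ := isMeasure.Build _ _ _ gauss_measure
  gauss_measure0 gauss_measure_ge0 gauss_measure_sigma_additive.

End GaussianMeasure.

Lemma sqnorm_cons (R : realType) n (x : measurableTypeR R * n.-tuple R) :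
  sqnorm (cons_pair x) = x.1 ^+ 2 + sqnorm x.2.
Proof.
by rewrite /sqnorm big_ord_recl; congr +%R; apply: eq_bigr => i _; rewrite tnthS.
Qed.

Lemma gauss_density_cons (R : realType) n (x : measurableTypeR R * n.-tuple R) :
  gauss_density (cons_pair x) =
  pi `^ (- 2^-1) * gauss_fun x.1 * gauss_density x.2.
Proof.
rewrite /gauss_density /gauss_fun sqnorm_cons opprD expRD mulrACA.
congr (_ * _); rewrite -powRD ?(gt_eqF (pi_gt0 R))//; last first.
  by rewrite implybT.
by congr (_ `^ _); rewrite -natr1 mulrDl div1r opprD addrC.
Qed.

Lemma gauss_measure_setT (R : realType) (d : nat) :
  gauss_measure [set: d.-tuple R] = 1%E.
Proof.
elim: d => [|n IH].
  rewrite /gauss_measure/= integral_dirac//=; last first.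
    by apply/measurable_EFinP; exact: measurable_gauss_density.
  by rewrite diracT mul1e /gauss_density /sqnorm big_ord0 mul0r oppr0 powRr0
    expR0 mulr1.
rewrite /gauss_measure /= /lebesgue_cons.
rewrite (@ge0_integral_pushforward _ _ _ _ _ _ (@measurable_cons_pair R n)
  (@lebesgue_measure R \x lebesgue_tuple n)%E setT)//=; first last.
- by move=> x _; rewrite lee_fin gauss_density_ge0.
- by apply/measurable_EFinP; exact: measurable_gauss_density.
rewrite fubini_tonelli1//=; first last.
- by move=> x; rewrite lee_fin gauss_density_ge0.
- apply/measurable_EFinP; apply: measurableT_comp.
    exact: measurable_gauss_density.
  exact: measurable_cons_pair.
rewrite /fubini_F/=.
under eq_integral => a _.
  under eq_integral => x _ do rewrite gauss_density_cons EFinM/=.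
  rewrite ge0_integralZl//=; first last.
  - by rewrite lee_fin mulr_ge0 ?powR_ge0 ?gauss_fun_ge0.
  - by move=> x _; rewrite lee_fin gauss_density_ge0.
  - by apply/measurable_EFinP; exact: measurable_gauss_density.
  move: IH; rewrite /gauss_measure => ->; rewrite mule1 EFinM.
  over.
rewrite ge0_integralZl//=; first last.
- by rewrite lee_fin powR_ge0.
- by move=> x _; rewrite lee_fin gauss_fun_ge0.
- by apply/measurable_EFinP; exact: measurable_gauss_fun.
rewrite integralT_gauss -EFinM -powR12_sqrt ?pi_ge0// -powRD; last first.
  by rewrite (gt_eqF (pi_gt0 R)) implybT.
by rewrite addNr powRr0.
Qed.

HB.instance Definition _ (R : realType) (d : nat) :=
  @Measure_isProbability.Build _ _ R (@gauss_measure R d)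
    (gauss_measure_setT R d).

Section PoissonHermite.
Context {R : realType} (d : nat).
Implicit Types (f : d.-tuple R -> R) (x : d.-tuple R) (s t : R).

(* At t <= 0 the operators below are the identity; only t = 0 is meaningful. *)
Definition ornstein_uhlenbeck t f x : R :=
  if 0 < t then
    pi `^ (- (d%:R / 2)) * (1 - expR (- (2 * t))) `^ (- (d%:R / 2)) *
    \int[lebesgue_tuple d]_y
      (expR (- (sqnorm [tuple tnth y i - expR (- t) * tnth x i | i < d]
                / (1 - expR (- (2 * t))))) * f y)
  else f x.

(* Lebesgue density on ]0, +oo[ of the one-sided stable measure mu_t^(1/2)
   subordinating the Poisson semigroup to the Ornstein-Uhlenbeck one. *)
Definition stable_density t s : R :=
  t / (2 * Num.sqrt pi) * (expR (- (t ^+ 2 / (4 * s))) / s `^ (3 / 2)).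

Definition poisson_hermite t f x : R :=
  if 0 < t then
    \int[lebesgue_measure]_(s in `]0, +oo[)
      (ornstein_uhlenbeck s f x * stable_density t s)
  else f x.

Definition dt_poisson_hermite (k : nat) f t x : R :=
  derive1n k (fun u => poisson_hermite u f x) t.

End PoissonHermite.

Section FunctionSpaces.
Context {R : realType} (d : nat).
Local Open Scope ereal_scope.

Lemma ex_nat_gt (alpha : R) : exists n : nat, (alpha < n%:R)%R.
Proof. by exists (Num.truncn alpha).+1; exact: truncnS_gt. Qed.

(* For alpha >= 0 the smallest integer greater than alpha is a natural number. *)
Definition smallest_gt (alpha : R) : nat := ex_minn (ex_nat_gt alpha).

Definition besov_seminorm (alpha : R) (p : \bar R) (q : R)
    (f : d.-tuple R -> R) : \bar R :=
  let k := smallest_gt alpha in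
  (\int[lebesgue_measure]_(t in `]0%R, +oo[)
     (((t `^ (k%:R - alpha))%:E *
       'N[@gauss_measure R d]_p[EFin \o dt_poisson_hermite k f t]) `^ q
      * (t^-1)%:E)) `^ q^-1.

Definition gauss_besov (alpha : R) (p : \bar R) (q : R) :
    set (d.-tuple R -> R) :=
  [set f | (f \in Lfun (@gauss_measure R d) p) /\
           besov_seminorm alpha p q f < +oo].

Definition triebel_lizorkin_seminorm (alpha p q : R)
    (f : d.-tuple R -> R) : \bar R :=
  let k := smallest_gt alpha in
  'N[@gauss_measure R d]_p%:E[(fun x =>
    (\int[lebesgue_measure]_(t in `]0%R, +oo[)
       (((t `^ (k%:R - alpha) * `|dt_poisson_hermite k f t x|) `^ q) / t)%:E)
    `^ q^-1)].

Definition gauss_triebel_lizorkin (alpha p q : R) :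
    set (d.-tuple R -> R) :=
  [set f | (f \in Lfun (@gauss_measure R d) p%:E) /\
           triebel_lizorkin_seminorm alpha p q f < +oo].

End FunctionSpaces.

(* Main.v *)
Require Import Defs.
From HB Require Import structures.
From mathcomp Require Import all_boot all_order all_algebra.
From mathcomp Require Import all_classical all_reals all_analysis.
From mathcomp Require Import measurable_realfun ring lra.

Set Implicit Arguments.
Unset Strict Implicit.
Unset Printing Implicit Defensive.

Import Order.TTheory GRing.Theory Num.Theory.
Import numFieldNormedType.Exports.

Local Open Scope classical_set_scope.
Local Open Scope ring_scope.

(* Writing the Ornstein-Uhlenbeck semigroup with the Mehler kernel relative to
   gamma_d and subordinating, P_t is a symmetric Markov semigroup whose kernel K_t
   satisfies s K_t <= t K_s for s <= t, because the one-sided stable densities do.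
   This Harnack-type bound and the regularity of K_t in t control t^j d^j/dt^j P_t f
   by means of |f|, both in L^p and, through the ergodic and Doob maximal
   inequalities, pointwise by functions of L^p.

   When the two orders k_0, k_1 coincide, so does the order attached to alpha, and
   both inclusions are Hoelder's inequality in t and in x. When k_0 < k_1, every
   datum is first expressed at order k_1, and one comes back from order k_1 to the
   order k <= k_1 attached to alpha. For the Besov scale this is a Hardy-type
   inequality, obtained by absorption from a bound of the k-th derivative at t by
   the k-th at 2t and the (k+1)-st near t. For the Triebel-Lizorkin scale one
   dominates |d^(k_1) P_t f / dt^(k_1)| pointwise by M_j t^(alpha_j - k_1) with M_j in
   L^(p_j), interpolates at exponents on both sides of theta and integrates down to
   order k; since alpha_0 < alpha_1, the two bounds make the integral over t converge
   at both ends, with value at most a power of M_0^(1 - theta) M_1^theta. *)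

(** * Poisson kernels and their semigroups *)

(** Nothing spectral is used: all estimates rest on positivity, unit mass, symmetry and the two time
    comparisons [K_mono] and [K_lip], so the Gaussian setting enters only through
    [heat_kernel_spec]. The recurring device is to split the time: a derivative costs a factor C / t
    and half of the time it is given, and [K_mono] then brings different leftover times back to one
    operator. The sup over continuous time becomes an ergodic maximal function because [K_mono]
    gives (j / n) [op (n h)] <= [op (j h)] for j <= n; summing over j bounds one operator by twice a
    Cesaro mean. Raising the order of derivation is local in t, whereas lowering it needs decay at
    infinity. The two scales differ there. The inequality comparing t with 2t carries an operator on
    the derivative of order k+1: a norm absorbs it by contraction, but pointwise in x it remains.
    Hence absorption for the Besov scale, and for the Triebel-Lizorkin scale maximal functions first
    and scalar integration in t afterwards. *)

Definition kernel_op {d} {X : measurableType d} {R : realType}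
    (mu : probability X R) (K : R -> X -> X -> R) (t : R) (f : X -> R) (x : X) : R :=
  \int[mu]_y (K t x y * f y).

(** [K_bounded] makes [K t x y * f y] integrable in y for every x, not just for almost every x.
    [K_lip] gives up half of the time because the time derivative of the density carries a
    polynomial factor that only a smaller time can absorb. [K_derivable] is a separate demand, since
    a Lipschitz bound yields no derivative. *)
Record poisson_kernel_spec {d} {X : measurableType d} {R : realType}
    (mu : probability X R) (K : R -> X -> X -> R) : Prop := PoissonKernelSpec {
  K_ge0 : forall t x y, 0 < t -> 0 <= K t x y ;
  K_meas : forall t, 0 < t ->
    measurable_fun [set: X * X] (fun z : X * X => K t z.1 z.2) ;
  K_sym : forall t x y, 0 < t -> K t x y = K t y x ;
  K_mass : forall t x, 0 < t -> (\int[mu]_y (K t x y)%:E = 1)%E ;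
  K_comp : forall s t x y, 0 < s -> 0 < t ->
    (\int[mu]_z (K s x z * K t z y)%:E = (K (s + t) x y)%:E)%E ;
  K_bounded : forall t x, 0 < t -> exists C, forall y, K t x y <= C ;
  K_mono : forall s t x y, 0 < s -> s <= t -> s * K t x y <= t * K s x y ;
  K_lip : exists C, forall s t x y, 0 < s -> s <= t -> t <= 2 * s ->
    `|K t x y - K s x y| <= C * ((t - s) / s) * K (s / 2) x y ;
  K_derivable : forall (f : X -> R) x t, mu.-integrable setT (EFin \o f) ->
    0 < t -> derivable (fun u => kernel_op mu K u f x) t 1 }.

Section kernel_op_theory.
Context {d} {X : measurableType d} {R : realType}.
Variables (mu : probability X R) (K : R -> X -> X -> R).
Hypothesis HK : poisson_kernel_spec mu K.
Implicit Types (f g : X -> R) (s t : R) (x y : X).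

Local Notation op := (kernel_op mu K).
Local Notation L1 f := (mu.-integrable setT (EFin \o f)).

Lemma L1_measurable f : L1 f -> measurable_fun setT f.
Proof. by move/measurable_int/measurable_EFinP. Qed.

Lemma L1D f g : L1 f -> L1 g -> L1 (f \+ g).
Proof.
by move=> intf intg; rewrite /comp; under eq_fun do rewrite EFinD; exact: integrableD.
Qed.

Lemma L1B f g : L1 f -> L1 g -> L1 (f \- g).
Proof.
by move=> intf intg; rewrite /comp; under eq_fun do rewrite EFinB; exact: integrableB.
Qed.

Lemma L1Z c f : L1 f -> L1 (fun x => c * f x).
Proof.
by move=> intf; rewrite /comp; under eq_fun do rewrite EFinM; exact: integrableZl.
Qed.

Lemma L1_cst c : L1 (cst c).
Proof. exact: finite_measure_integrable_cst. Qed.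

Lemma L1_le f g : measurable_fun setT f -> (forall x, `|f x| <= g x) -> L1 g -> L1 f.
Proof.
move=> mf fg; apply: le_integrable => //; first exact/measurable_EFinP.
by move=> x _ /=; rewrite lee_fin (le_trans (fg x))// ler_norm.
Qed.

Lemma measurable_kernelr t x : 0 < t -> measurable_fun setT (K t x).
Proof.
move=> t0; apply: (measurableT_comp (K_meas HK t0) (g := pair x)).
exact: measurable_pair1.
Qed.

Lemma kernel_op_integrable t f x : 0 < t -> L1 f -> L1 (fun y => K t x y * f y).
Proof.
move=> t0 intf; have [C KC] := K_bounded HK x t0.
apply: (@L1_le _ (fun y => C * `|f y|)).
- by apply: measurable_funM; [exact: measurable_kernelr|exact: L1_measurable].
- by move=> y; rewrite normrM ler_wpM2r// ger0_norm// (K_ge0 HK).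
- by apply: L1Z; exact: integrable_norm.
Qed.

Lemma kernel_opE t f x : 0 < t -> L1 f ->
  (kernel_op mu K t f x)%:E = (\int[mu]_y (K t x y * f y)%:E)%E.
Proof.
move=> t0 intf; rewrite /kernel_op /Rintegral fineK//.
by apply: integrable_fin_num => //; exact: kernel_op_integrable.
Qed.

Let norm_int t f : 0 < t -> L1 f ->
  (\int[mu]_x \int[mu]_y `|(K t x y * f y)%:E| = \int[mu]_x `|f x|%:E)%E.
Proof.
move=> t0 intf.
have mf := L1_measurable intf.
have mKf : measurable_fun setT
    (fun z : X * X => `|(K t z.1 z.2 * f z.2)%:E|%E).
  apply: measurableT_comp => //; apply/measurable_EFinP.
  apply: measurable_funM; first exact: (K_meas HK).
  exact: measurableT_comp.
rewrite (fubini_tonelli (fun z : X * X => `|(K t z.1 z.2 * f z.2)%:E|)%E)//=.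
apply: eq_integral => y _.
under eq_integral => x _.
  rewrite normrM ger0_norm ?(K_ge0 HK)// (K_sym HK)// EFinM.
  over.
rewrite ge0_integralZr//.
- by rewrite (K_mass HK)// mul1e.
- by apply/measurable_EFinP; exact: measurable_kernelr.
- by move=> x _; rewrite lee_fin (K_ge0 HK).
Qed.

Let prod_integrable t f : 0 < t -> L1 f ->
  (mu \x mu)%E.-integrable setT (fun z : X * X => (K t z.1 z.2 * f z.2)%:E).
Proof.
move=> t0 intf; apply/integrable12ltyP => /=.
  apply/measurable_EFinP; apply: measurable_funM; first exact: (K_meas HK).
  by apply: measurableT_comp => //; exact: L1_measurable.
rewrite norm_int//; case/integrableP: intf => _.
by [].
Qed.

Lemma kernel_op_L1 t f : 0 < t -> L1 f -> L1 (op t f).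
Proof.
move=> t0 intf.
have := integrable_fubini_F (prod_integrable t0 intf).
apply: eq_integrable => // x _.
by rewrite /= kernel_opE.
Qed.

Lemma kernel_op_measurable t f : 0 < t -> L1 f -> measurable_fun setT (op t f).
Proof. by move=> t0 intf; apply: L1_measurable; exact: kernel_op_L1. Qed.

Lemma kernel_op_ge0 t f x : 0 < t -> (forall y, 0 <= f y) -> 0 <= op t f x.
Proof.
by move=> t0 f0; apply: Rintegral_ge0 => y _; rewrite mulr_ge0// (K_ge0 HK).
Qed.

Lemma kernel_op_le t f g x : 0 < t -> L1 f -> L1 g ->
  (forall y, f y <= g y) -> op t f x <= op t g x.
Proof.
move=> t0 intf intg fg; apply: le_Rintegral => //; try exact: kernel_op_integrable.
by move=> y _; rewrite ler_wpM2l// (K_ge0 HK).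
Qed.

Lemma kernel_op_norm_le t f x : 0 < t -> L1 f ->
  `|op t f x| <= op t (fun y => `|f y|) x.
Proof.
move=> t0 intf; apply: le_trans.
  by apply: le_normr_Rintegral => //; exact: kernel_op_integrable.
apply: le_Rintegral => //.
- by apply: integrable_norm; exact: kernel_op_integrable.
- by apply: kernel_op_integrable => //; exact: integrable_norm.
- by move=> y _ /=; rewrite normrM ger0_norm// (K_ge0 HK).
Qed.

Lemma kernel_opD t f g x : 0 < t -> L1 f -> L1 g ->
  op t (f \+ g) x = op t f x + op t g x.
Proof.
move=> t0 intf intg; rewrite /kernel_op -RintegralD//; try exact: kernel_op_integrable.
by apply: eq_Rintegral => y _; rewrite mulrDr.
Qed.

Lemma kernel_opB t f g x : 0 < t -> L1 f -> L1 g ->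
  op t (f \- g) x = op t f x - op t g x.
Proof.
move=> t0 intf intg; rewrite /kernel_op -RintegralB//; try exact: kernel_op_integrable.
by apply: eq_Rintegral => y _; rewrite mulrBr.
Qed.

Lemma kernel_opZ t c f x : 0 < t -> L1 f ->
  op t (fun y => c * f y) x = c * op t f x.
Proof.
move=> t0 intf; rewrite /kernel_op -RintegralZl//; try exact: kernel_op_integrable.
by apply: eq_Rintegral => y _; rewrite mulrCA.
Qed.

Lemma kernel_op_cst t c x : 0 < t -> op t (cst c) x = c.
Proof.
move=> t0; rewrite (_ : cst c = fun y => c * cst 1 y); last first.
  by apply/funext => y /=; rewrite mulr1.
rewrite kernel_opZ//; last exact: L1_cst.
rewrite /kernel_op /Rintegral.
under eq_integral do rewrite mulr1.
by rewrite (K_mass HK)// mulr1.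
Qed.

Lemma integral_kernel_op t f : 0 < t -> L1 f ->
  (\int[mu]_x (op t f x)%:E = \int[mu]_x (f x)%:E)%E.
Proof.
move=> t0 intf.
under eq_integral do rewrite kernel_opE//.
rewrite (Fubini (prod_integrable t0 intf))/=.
apply: eq_integral => y _.
under eq_integral => x _ do rewrite (K_sym HK)// EFinM.
rewrite integralZr//; last first.
  have := kernel_op_integrable y t0 (L1_cst 1).
  by apply: eq_integrable => // z _ /=; rewrite mulr1.
by rewrite (K_mass HK)// mul1e.
Qed.

Lemma kernel_op_semigroup s t f x : 0 < s -> 0 < t -> L1 f ->
  op s (op t f) x = op (s + t) f x.
Proof.
move=> s0 t0 intf; apply: EFin_inj.
have mf := L1_measurable intf.
rewrite kernel_opE//; last exact: kernel_op_L1.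
rewrite kernel_opE ?addr_gt0//.
have mF : measurable_fun setT (fun z : X * X => (K s x z.1 * (K t z.1 z.2 * f z.2))%:E).
  apply/measurable_EFinP; apply: measurable_funM.
    by apply: measurableT_comp => //; exact: measurable_kernelr.
  apply: measurable_funM; first exact: (K_meas HK).
  exact: measurableT_comp.
have intF : (mu \x mu)%E.-integrable setT
    (fun z : X * X => (K s x z.1 * (K t z.1 z.2 * f z.2))%:E).
  apply/integrable12ltyP => //=.
  (* The outer kernel being bounded, absolute integrability reduces to that of [op t] applied to
     |f|, which is in L^1. *)
  have [C KC] := K_bounded HK x s0.
  apply: (@le_lt_trans _ _ (\int[mu]_z (C * op t (fun y => `|f y|) z)%:E)%E).
    apply: ge0_le_integral => //.
    - by move=> z _; exact: integral_ge0.
    - apply: (@measurable_fun_fubini_tonelli_F _ _ _ _ _ _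
        (fun z : X * X => `|(K s x z.1 * (K t z.1 z.2 * f z.2))%:E|%E)) => //.
      exact: measurableT_comp.
    - apply/measurable_EFinP; apply: measurable_funM => //.
      by apply: kernel_op_measurable => //; exact: integrable_norm.
    - move=> z _; rewrite EFinM kernel_opE//; last exact: integrable_norm.
      under eq_integral.
        move=> y _; rewrite normrM EFinM ger0_norm ?(K_ge0 HK)// normrM.
        rewrite (ger0_norm (K_ge0 HK _ _ t0)).
        over.
      rewrite ge0_integralZl//=.
      + apply: lee_wpmul2r; last by rewrite lee_fin.
        by apply: integral_ge0 => y _; rewrite lee_fin mulr_ge0// (K_ge0 HK).
      + apply/measurable_EFinP; apply: measurable_funM.
          exact: measurable_kernelr.
        exact: measurableT_comp.
      + by move=> y _; rewrite lee_fin mulr_ge0// (K_ge0 HK).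
      + by rewrite lee_fin (K_ge0 HK).
  apply: integrable_lty => //; apply: L1Z.
  by apply: kernel_op_L1 => //; exact: integrable_norm.
transitivity (\int[mu]_z \int[mu]_y (K s x z * (K t z y * f y))%:E)%E.
  apply: eq_integral => z _; rewrite EFinM kernel_opE//.
  rewrite -integralZl//; last exact: kernel_op_integrable.
rewrite (Fubini intF)/=.
apply: eq_integral => y _.
under eq_integral => z _ do rewrite mulrA EFinM.
rewrite integralZr//.
  by rewrite (K_comp HK).
apply/integrableP; split.
  apply/measurable_EFinP; apply: measurable_funM; first exact: measurable_kernelr.
  rewrite (_ : (fun z => K t z y) = K t y); first exact: measurable_kernelr.
  by apply/funext => z; rewrite (K_sym HK).
under eq_integral.
  move=> z _; rewrite gee0_abs; last by rewrite lee_fin mulr_ge0// (K_ge0 HK).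
  over.
by rewrite (K_comp HK)// ltry.
Qed.

Lemma kernel_op_mono s t f x : 0 < s -> s <= t -> L1 f -> (forall y, 0 <= f y) ->
  op t f x <= (t / s) * op s f x.
Proof.
move=> s0 st intf f0; have t0 := lt_le_trans s0 st.
rewrite -kernel_opZ//.
apply: le_Rintegral => //; try exact: kernel_op_integrable.
  by apply: kernel_op_integrable => //; exact: L1Z.
move=> y _; rewrite mulrA ler_wpM2r//.
rewrite mulrA ler_pdivlMr// mulrC (le_trans (K_mono HK _ _ s0 st))//.
by rewrite mulrC.
Qed.

End kernel_op_theory.

(** Dominated convergence works along sequences, so derivatives are reached along the steps c /
    (n+1); the free constant c keeps these steps small compared with the current time. *)
Lemma derive1_cvgn (R : realType) (phi : R -> R) (t c : R) : 0 < c ->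
  derivable phi t 1 ->
  (c / n.+1%:R)^-1 * (phi (t + c / n.+1%:R) - phi t) @[n --> \oo] --> derive1 phi t.
Proof.
move=> c0 dphi.
have := dphi; rewrite /derivable => /cvg_ex[/= l hl].
have -> : derive1 phi t = l.
  rewrite derive1E; apply/cvg_lim => //.
have h0 : (forall n, c / n.+1%:R != 0 :> R) /\
    (fun n => c / n.+1%:R) @ \oo --> (0 : R).
  split=> [n|]; first by rewrite gt_eqF// divr_gt0.
  rewrite -(mulr0 c); apply: cvgM; first exact: cvg_cst.
  exact: cvg_harmonic.
move/cvgr_dnbhsP : hl => /(_ _ h0).
apply: cvg_trans; apply: near_eq_cvg; near=> n => /=.
by rewrite scaler1 /GRing.scale /= [t + _]addrC.
Unshelve. all: by end_near. Qed.

Lemma cvgn_norm_le (R : realType) (q : nat -> R) (l B : R) :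
  q n @[n --> \oo] --> l -> (forall n, `|q n| <= B) -> `|l| <= B.
Proof.
move=> ql qB; have h : `|q n| @[n --> \oo] --> `|l| by exact: cvg_norm.
by apply: (ler_cvg_to h (cvg_cst B)); exact: nearW.
Qed.

(** * Time derivatives of the semigroup *)

Section derivatives.
Context {d} {X : measurableType d} {R : realType}.
Variables (mu : probability X R) (K : R -> X -> X -> R).
Hypothesis HK : poisson_kernel_spec mu K.
Implicit Types (f g : X -> R) (s t : R) (x y : X).

Local Notation op := (kernel_op mu K).
Local Notation L1 f := (mu.-integrable setT (EFin \o f)).

Lemma kernel_op_cvgn t (g_ : nat -> X -> R) g G x : 0 < t ->
  (forall n, L1 (g_ n)) -> L1 G -> (forall n y, `|g_ n y| <= G y) ->
  (forall y, g_ n y @[n --> \oo] --> g y) ->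
  L1 g /\ op t (g_ n) x @[n --> \oo] --> op t g x.
Proof.
move=> t0 intg_ intG gG g_g.
have mg : measurable_fun setT g.
  by apply: (measurable_fun_cvg (h := g_)) => // n; exact: (L1_measurable (intg_ n)).
have gG' y : `|g y| <= G y.
  exact: (cvgn_norm_le (g_g y) (gG ^~ y)).
have intg : L1 g by exact: (L1_le mg gG' intG).
split => //.
rewrite /kernel_op /Rintegral; apply: fine_cvg.
have -> : (fine (\int[mu]_y (K t x y * g y)%:E))%:E = (\int[mu]_y (K t x y * g y)%:E)%E.
  rewrite fineK//; apply: integrable_fin_num => //.
  exact: (kernel_op_integrable HK).
apply: (@dominated_cvg _ _ _ mu _ _ (fun n y => (K t x y * g_ n y)%:E) _
  (fun y => (K t x y * G y)%:E)) => //=.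
- move=> n; apply: (measurable_int mu).
  exact: (kernel_op_integrable HK).
- move=> y _; apply: cvg_EFin; first exact: nearW.
  by apply: cvgM; [exact: cvg_cst|exact: g_g].
- exact: (kernel_op_integrable HK).
- move=> n y _; rewrite lee_fin normrM ger0_norm ?(K_ge0 HK)//.
  by rewrite ler_wpM2l// (K_ge0 HK).
Qed.

Lemma kernel_op_lip : exists2 C, 0 <= C & forall f t h x, 0 < t -> 0 <= h -> h <= t -> L1 f ->
  `|op (t + h) f x - op t f x| <= C * (h / t) * op (t / 2) (fun y => `|f y|) x.
Proof.
have [C KC] := K_lip HK; exists `|C| => // f t h x t0 h0 ht intf.
have th0 : 0 < t + h by rewrite ltr_pwDl.
have t20 : 0 < t / 2 by rewrite divr_gt0.
have intK2 := kernel_op_integrable HK x t20 (integrable_norm intf).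
rewrite /kernel_op -RintegralB//; try exact: (kernel_op_integrable HK).
rewrite -RintegralZl//.
have intd : L1 (fun y => K (t + h) x y * f y - K t x y * f y).
  by apply: L1B; exact: (kernel_op_integrable HK).
apply: (le_trans (le_normr_Rintegral _ intd)) => //.
apply: le_Rintegral => //.
- exact: integrable_norm.
- exact: L1Z.
move=> y _ /=; rewrite -mulrBl normrM mulrA ler_wpM2r//.
apply: (le_trans (KC _ _ _ _ t0 _ _)).
- by rewrite lerDl.
- by rewrite mulrDl mul1r lerD2l.
rewrite [t + h]addrC addrK ler_wpM2r ?(K_ge0 HK)// ler_wpM2r ?ler_norm//.
by rewrite divr_ge0// ltW.
Qed.

Variable f : X -> R.
Hypothesis intf : L1 f.

Definition kernel_deriv (k : nat) t x := derive1n k (fun u => op u f x) t.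
Local Notation u := kernel_deriv.

Lemma kernel_deriv0 t x : u 0 t x = op t f x.
Proof. by []. Qed.

Lemma kernel_derivS k t x : u k.+1 t x = derive1 (fun s => u k s x) t.
Proof. by rewrite /kernel_deriv derive1nS. Qed.

(** The step never exceeds s / 2, so the quotient stays in the range of [kernel_op_lip] based at
    time s / 2. *)
Let quot k s n y := (s / 2 / n.+1%:R)^-1 * (u k (s + s / 2 / n.+1%:R) y - u k s y).

(** The three claims must be proved together. The semigroup law at order k dominates the difference
    quotients by one L^1 function; dominated convergence then gives integrability and the semigroup
    law at order k+1, and this law reduces derivability at order k+1 to that of [op] in time. *)
Lemma kernel_deriv_spec k :
  [/\ forall t, 0 < t -> L1 (u k t),
      forall s r x, 0 < s -> 0 < r -> u k (s + r) x = op r (u k s) x &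
      forall t x, 0 < t -> derivable (fun s => u k s x) t 1].
Proof.
have [C C0 lipC] := kernel_op_lip.
elim: k => [|k [L1u semiu deru]].
  split => [t t0|s r x s0 r0|t x t0].
  - exact: (kernel_op_L1 HK).
  - by rewrite /kernel_deriv /= (kernel_op_semigroup HK)// addrC.
  - exact: (K_derivable HK).
have qbound s n y : 0 < s -> `|quot k s n y| <=
    C / (s / 2) * op (s / 2 / 2) (fun z => `|u k (s / 2) z|) y.
  move=> s0; have s20 : 0 < s / 2 by rewrite divr_gt0.
  have h0 : 0 < s / 2 / n.+1%:R by rewrite divr_gt0.
  have hs : s / 2 / n.+1%:R <= s / 2.
    by rewrite ler_pdivrMr// ler_peMr ?ler1n// ltW.
  rewrite /quot normrM gtr0_norm ?invr_gt0// mulrC ler_pdivrMr//.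
  (* With s / 2 split off on both sides, the quotient becomes a difference of two operators applied
     to the same function [u k (s / 2)]. *)
  have -> : s + s / 2 / n.+1%:R = s / 2 + (s / 2 + s / 2 / n.+1%:R).
    by rewrite addrA -splitr.
  rewrite semiu//; last by rewrite addr_gt0.
  rewrite [in X in _ - X](splitr s) semiu//.
  apply: (le_trans (lipC _ _ _ _ s20 (ltW h0) hs (L1u _ s20))).
  rewrite le_eqVlt; apply/orP; left; apply/eqP.
  by rewrite [RHS]mulrAC; congr (_ * _); rewrite mulrA mulrAC.
have L1bound s : 0 < s ->
    L1 (fun y => C / (s / 2) * op (s / 2 / 2) (fun z => `|u k (s / 2) z|) y).
  move=> s0; apply: L1Z; apply: (kernel_op_L1 HK); first by rewrite !divr_gt0.
  by apply: integrable_norm; apply: L1u; rewrite divr_gt0.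
have L1q s n : 0 < s -> L1 (quot k s n).
  move=> s0; apply: L1Z; apply: L1B; apply: L1u => //.
  by rewrite addr_gt0// !divr_gt0.
have qcvg s y : 0 < s -> quot k s n y @[n --> \oo] --> u k.+1 s y.
  move=> s0; rewrite kernel_derivS.
  apply: (@derive1_cvgn _ (fun r => u k r y)); first by rewrite divr_gt0.
  exact: deru.
have L1u' t : 0 < t -> L1 (u k.+1 t).
  move=> t0; have x : X by exact: point.
  by have [] := kernel_op_cvgn x t0 (fun n => L1q t n t0) (L1bound _ t0)
    (fun n y => qbound t n y t0) (fun y => qcvg t y t0).
have semiu' s r x : 0 < s -> 0 < r -> u k.+1 (s + r) x = op r (u k.+1 s) x.
  move=> s0 r0.
  have [_ cvg1] := kernel_op_cvgn x r0 (fun n => L1q s n s0) (L1bound _ s0)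
    (fun n y => qbound s n y s0) (fun y => qcvg s y s0).
  have cvg2 : op r (quot k s n) x @[n --> \oo] --> u k.+1 (s + r) x.
    rewrite kernel_derivS.
    have s20 : 0 < s / 2 by rewrite divr_gt0.
    have := @derive1_cvgn _ (fun a => u k a x) (s + r) (s / 2) s20 (deru _ _ (addr_gt0 s0 r0)).
    apply: cvg_trans; apply: near_eq_cvg; near=> n => /=.
    have sn0 : 0 < s + s / 2 / n.+1%:R by rewrite addr_gt0// divr_gt0.
    rewrite /quot (kernel_opZ HK)//; last by apply: L1B; apply: L1u.
    rewrite (kernel_opB HK)//; [|exact: L1u|exact: L1u].
    by rewrite -!semiu// addrAC.
  exact: (cvg_unique _ cvg2 cvg1).
split; [exact: L1u'|exact: semiu'|move=> t x t0].
have t20 : 0 < t / 2 by rewrite divr_gt0.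
(* Near t one has u_(k+1)(a) = [op (a - t / 2)] u_(k+1)(t / 2), so [K_derivable] applied to the
   fixed function u_(k+1)(t / 2) gives the next derivative. *)
have dop : derivable (fun r => op r (u k.+1 (t / 2)) x) (t / 2) 1.
  by apply: (K_derivable HK) => //; exact: L1u'.
apply: (@near_eq_derivable _ _ _ ((fun r => op r (u k.+1 (t / 2)) x) \o (fun a => a - t / 2))).
  near=> a; rewrite /= -semiu'//; last first.
    by rewrite subr_gt0; near: a; apply: lt_nbhsr; rewrite gtr_pMr ?invf_lt1 ?ltr1n.
  by rewrite addrC subrK.
apply/derivable1_diffP; apply: differentiable_comp.
  by apply/derivable1_diffP; apply: derivableB; [exact: derivable_id|exact: derivable_cst].
by apply/derivable1_diffP; rewrite (_ : t - t / 2 = t / 2)//; lra.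
Unshelve. all: by end_near. Qed.

Lemma kernel_deriv_L1 k t : 0 < t -> L1 (u k t).
Proof. by have [+ _ _] := kernel_deriv_spec k; apply. Qed.

Lemma kernel_deriv_measurable k t : 0 < t -> measurable_fun setT (u k t).
Proof. by move=> t0; apply: L1_measurable; exact: kernel_deriv_L1. Qed.

Lemma kernel_deriv_semigroup k s r x : 0 < s -> 0 < r ->
  u k (s + r) x = op r (u k s) x.
Proof. by have [_ + _] := kernel_deriv_spec k; apply. Qed.

Lemma kernel_deriv_derivable k t x : 0 < t -> derivable (fun s => u k s x) t 1.
Proof. by have [_ _ +] := kernel_deriv_spec k; apply. Qed.

(** The bound of [kernel_op_lip] on the difference quotients of step r / (n+1) is uniform in n, with
    the one operator [op (r / 2)], and so survives the limit. *)
Lemma kernel_deriv_succ_le : exists2 C, 0 <= C & forall k s r x, 0 < s -> 0 < r ->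
  `|u k.+1 (s + r) x| <= C / r * op (r / 2) (fun y => `|u k s y|) x.
Proof.
have [C C0 lipC] := kernel_op_lip; exists C => // k s r x s0 r0.
have sr0 := addr_gt0 s0 r0.
rewrite kernel_derivS.
have := derive1_cvgn r0 (@kernel_deriv_derivable k _ x sr0).
move/cvgn_norm_le; apply => n.
have h0 : 0 < r / n.+1%:R by rewrite divr_gt0.
have hr : r / n.+1%:R <= r by rewrite ler_pdivrMr// ler_peMr ?ler1n// ltW.
rewrite normrM gtr0_norm ?invr_gt0// mulrC ler_pdivrMr//.
rewrite -addrA !kernel_deriv_semigroup//; last by rewrite addr_gt0.
apply: (le_trans (lipC _ _ _ _ r0 (ltW h0) hr (kernel_deriv_L1 k s0))).
rewrite le_eqVlt; apply/orP; left; apply/eqP.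
by rewrite [RHS]mulrAC; congr (_ * _); rewrite mulrA mulrAC.
Qed.

(** Half of r pays for the new derivative, half for the induction hypothesis; each leaves an [op] of
    time r / 4, and the two compose to [op (r / 2)]. The power of 2 in the constant comes from r / 2
    raised to m+1. *)
Lemma kernel_deriv_add_le m : exists2 C, 0 <= C & forall k s r x, 0 < s -> 0 < r ->
  `|u (k + m) (s + r) x| <= C / r ^+ m * op (r / 2) (fun y => `|u k s y|) x.
Proof.
elim: m => [|m [C C0 IH]].
  (* For m = 0 the only loss is [kernel_op_mono] from time r / 2 to r, of ratio 2. *)
  exists 2 => // k s r x s0 r0; rewrite addn0 expr0 divr1.
  have r20 : 0 < r / 2 by rewrite divr_gt0.
  have L := kernel_deriv_L1 k s0.
  rewrite kernel_deriv_semigroup//.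
  apply: (le_trans (kernel_op_norm_le HK x r0 L)).
  have rr : r / 2 <= r by rewrite ler_pdivrMr// mulr2n mulrDr mulr1 lerDl ltW.
  apply: (le_trans (kernel_op_mono HK x r20 rr (integrable_norm L) _)).
    by move=> y /=.
  by rewrite invf_div mulrCA divff ?mulr1// gt_eqF.
have [C1 C10 H1] := kernel_deriv_succ_le.
exists (C1 * C * 2 ^+ m.+1); first by rewrite !mulr_ge0 ?exprn_ge0.
move=> k s r x s0 r0; have r20 : 0 < r / 2 by rewrite divr_gt0.
have r40 : 0 < r / 2 / 2 by rewrite divr_gt0.
rewrite addnS {1}(splitr r) addrA.
have s20 : 0 < s + r / 2 by rewrite addr_gt0.
apply: (le_trans (H1 _ _ _ _ s20 r20)).
have L := kernel_deriv_L1 k s0.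
have Lo : L1 (op (r / 2 / 2) (fun y => `|u k s y|)).
  by apply: (kernel_op_L1 HK) => //; exact: integrable_norm.
apply: (@le_trans _ _ (C1 / (r / 2) *
    op (r / 2 / 2) (fun z => C / (r / 2) ^+ m * op (r / 2 / 2) (fun y => `|u k s y|) z) x)).
  apply: ler_wpM2l; first by rewrite divr_ge0// ltW.
  apply: (kernel_op_le HK) => //.
  - by apply: integrable_norm; exact: kernel_deriv_L1.
  - exact: L1Z.
  - by move=> y; exact: IH.
rewrite (kernel_opZ HK)// (kernel_op_semigroup HK)//; last exact: integrable_norm.
rewrite -splitr mulrA le_eqVlt; apply/orP; left; apply/eqP; congr (_ * _).
have rn0 : r != 0 by rewrite gt_eqF.
by rewrite !exprS expr_div_n; field; rewrite ?expf_neq0 ?pnatr_eq0 ?rn0.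
Qed.

(* Every scale [s] in [t/4, t/2] controls the value at [t], with one and the same operator [op (t / 4)]; averaging over [s] is therefore possible. *)
Lemma kernel_deriv_le_window m : exists2 C, 0 <= C & forall k s t x,
  0 < t -> t / 4 <= s -> s <= t / 2 ->
  `|u (k + m) t x| <= C / t ^+ m * op (t / 4) (fun y => `|u k s y|) x.
Proof.
have [C C0 H] := kernel_deriv_add_le m.
(* Since t - s >= t / 2, the power of t - s costs 2^m; since (t - s) / 2 lies between t / 4 and 3t /
   8, [kernel_op_mono] back to t / 4 costs at most 2. *)
exists (C * 2 ^+ m * 2); first by rewrite !mulr_ge0 ?exprn_ge0.
move=> k s t x t0 s1 s2.
have t40 : 0 < t / 4 by rewrite divr_gt0.
have s0 : 0 < s by exact: lt_le_trans s1.
have ts0 : 0 < t - s by lra.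
rewrite -{1}(subrK s t) [t - s + s]addrC.
apply: (le_trans (H k _ _ _ s0 ts0)).
have L := integrable_norm (kernel_deriv_L1 k s0).
have A0 : 0 <= op (t / 4) (fun y => `|u k s y|) x by apply: (kernel_op_ge0 HK).
have le1 : op ((t - s) / 2) (fun y => `|u k s y|) x <= 2 * op (t / 4) (fun y => `|u k s y|) x.
  apply: (le_trans (kernel_op_mono HK x t40 _ L _)); [by lra|by move=> y /=|].
  apply: ler_wpM2r => //.
  by rewrite ler_pdivrMr//; lra.
have le2 : C / (t - s) ^+ m <= C * 2 ^+ m / t ^+ m.
  rewrite -mulrA ler_wpM2l// -expr_div_n -exprVn lerXn2r ?nnegrE ?invr_ge0 ?divr_ge0 ?(ltW ts0) ?(ltW t0)//.
  by rewrite -[X in _ <= X]invf_div lef_pV2 ?posrE ?divr_gt0//; lra.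
apply: (le_trans (ler_pM _ _ le2 le1)).
- by rewrite divr_ge0// exprn_ge0// ltW.
- by apply: (kernel_op_ge0 HK); rewrite ?divr_gt0.
- by rewrite le_eqVlt; apply/orP; left; apply/eqP; rewrite !mulrA; congr (_ * _); rewrite mulrAC.
Qed.

Lemma kernel_deriv_le k : exists2 C, 0 <= C & forall t x, 0 < t ->
  `|u k t x| <= C / t ^+ k * op (t / 2) (fun y => `|f y|) x.
Proof.
have [C C0 H] := kernel_deriv_le_window k.
exists C => // t x t0.
have t40 : 0 < t / 4 by rewrite divr_gt0.
have t2 : t / 4 <= t / 2 by lra.
apply: (le_trans (H 0%N _ _ _ t0 (lexx _) t2)).
apply: ler_wpM2l; first by rewrite divr_ge0// exprn_ge0// ltW.
have -> : t / 2 = t / 4 + t / 4 by lra.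
rewrite -(kernel_op_semigroup HK)//; last exact: integrable_norm.
apply: (kernel_op_le HK) => //.
- by apply: integrable_norm; exact: kernel_deriv_L1.
- by apply: (kernel_op_L1 HK) => //; exact: integrable_norm.
- by move=> y; rewrite kernel_deriv0; exact: (kernel_op_norm_le HK).
Qed.

End derivatives.

(** * Dyadic layers *)

Lemma geometric_sum_le (R : realFieldType) (b : R) n : 1 < b ->
  \sum_(i < n.+1) b ^+ i <= b / (b - 1) * b ^+ n.
Proof.
move=> b1; have b10 : 0 < b - 1 by rewrite subr_gt0.
rewrite mulrAC -exprS ler_pdivlMr//.
elim: n => [|n IH]; first by rewrite big_ord_recl big_ord0 addr0 expr0 mul1r expr1 lerBlDl lerDr.
rewrite big_ord_recr/= mulrDl (le_trans (lerD IH (lexx _)))//.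
by rewrite mulrBr mulr1 -exprSr addrC subrK.
Qed.

(* Pointwise form of Doob's maximal estimate: integrating it against a measure for which every [(v - 2^i) 1_{2^i < w}] has nonnegative integral bounds the [p]-th moment of [w] by that of [v]. *)
Definition dyadic_layer_bound (R : realType) (p C : R) :=
  forall n (v w : R), 0 <= v -> 0 <= w -> w <= 2 ^+ n ->
  2^-1 `^ (p + 1) * w `^ p <=
  1 + C * v `^ p - \sum_(i < n) (2 `^ (p - 1)) ^+ i * ((v - 2 ^+ i) * (2 ^+ i < w)%R%:R).

(** Let b = 2^(p-1), and let n be the last level with 2^n < w; every indicator up to it is 1, and
    the sum is v times the sum of b^i minus the sum of (2b)^i. The last term of the latter, 2^(np),
    is at least (w/2)^p = 2 a w^p because w <= 2^(n+1). The former is at most c0 v w^(p-1): if c0 v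
    <= a w it is absorbed by half of 2 a w^p, otherwise w < c0 v / a bounds it by C v^p. The summand
    1 covers w <= 1, where no layer is available. *)
Lemma dyadic_layer_boundP (R : realType) (p : R) : 1 < p ->
  exists2 C, 0 <= C & dyadic_layer_bound p C.
Proof.
move=> p1; set b := 2 `^ (p - 1); have p0 : 0 < p by rewrite (lt_trans _ p1).
have b1 : 1 < b.
  by rewrite /b /powR gt_eqF// expR_gt1 mulr_gt0 ?subr_gt0 ?ln_gt0 ?ltr1n.
have [c0 c0E c00] : exists2 c0, c0 = b / (b - 1) & 0 <= c0.
  by exists (b / (b - 1)) => //; rewrite divr_ge0 ?powR_ge0 ?subr_ge0// ltW.
set a := 2^-1 `^ (p + 1); have a0 : 0 < a by rewrite powR_gt0.
pose C := c0 * (c0 / a) `^ (p - 1).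
have C0 : 0 <= C by rewrite mulr_ge0// powR_ge0.
exists C => // n v w v0 w0.
elim: n => [|n IH] wn.
  rewrite big_ord0 subr0 expr0 in wn *.
  have aw : a * w `^ p <= 1.
    have a1 : a <= 1.
      rewrite -[leRHS](powRr0 2^-1); apply: ger_powR; last by rewrite addr_ge0// ltW.
      by rewrite invr_gt0 ltr0n/= invf_le1 ?ler1n.
    have w1 : w `^ p <= 1 by rewrite -[leRHS](congr1 (@^~ p) (powR1 R)) ge0_ler_powR ?nnegrE// ltW.
    by rewrite mulr_ile1 ?powR_ge0.
  by rewrite (le_trans aw)// lerDl mulr_ge0 ?powR_ge0.
have [wn'|wn'] := leP w (2 ^+ n).
  rewrite big_ord_recr/= (ltNge (2 ^+ n)) wn'/= !mulr0 addr0.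
  exact: IH.
have -> : \sum_(i < n.+1) b ^+ i * ((v - 2 ^+ i) * (2 ^+ i < w)%R%:R) =
    v * (\sum_(i < n.+1) b ^+ i) - \sum_(i < n.+1) (b * 2) ^+ i.
  rewrite mulr_sumr -sumrB; apply: eq_bigr => i _.
  have -> : 2 ^+ i < w.
    by rewrite (le_lt_trans _ wn')// ler_weXn2l ?ler1n// -ltnS.
  by rewrite mulr1 mulrBr exprMn mulrC.
have h1 : v * \sum_(i < n.+1) b ^+ i <= c0 * v * w `^ (p - 1).
  rewrite (mulrC c0) -mulrA ler_wpM2l// (le_trans (geometric_sum_le n b1))// -c0E.
  rewrite ler_wpM2l// /b -powR_mulrn ?powR_ge0// -powRrM (mulrC (p - 1)) powRrM.
  by rewrite powR_mulrn// ge0_ler_powR ?nnegrE ?exprn_ge0 ?subr_ge0// ltW.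
have h2 : 2 * a * w `^ p <= \sum_(i < n.+1) (b * 2) ^+ i.
  rewrite big_ord_recr/=.
  have -> : 2 * a * w `^ p = (w / 2) `^ p.
    rewrite powRM ?invr_ge0// /a powRD ?invr_eq0 ?pnatr_eq0 ?implybT//.
    by rewrite powRr1 ?invr_ge0//; field.
  have : (w / 2) `^ p <= (b * 2) ^+ n.
    have -> : b * 2 = 2 `^ p by rewrite mulrC mulr_powRB1.
    rewrite -powR_mulrn ?powR_ge0// -powRrM (mulrC p) powRrM powR_mulrn//.
    rewrite ge0_ler_powR ?nnegrE ?divr_ge0 ?exprn_ge0// ?(ltW p0)//.
    by rewrite ler_pdivrMr// -exprSr.
  move=> /le_trans; apply; rewrite lerDr sumr_ge0// => i _.
  by rewrite exprn_ge0// mulr_ge0// powR_ge0.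
have h3 : c0 * v * w `^ (p - 1) <= a * w `^ p + C * v `^ p.
  have wE : w `^ p = w * w `^ (p - 1).
    by rewrite mulr_powRB1.
  have vE : v `^ p = v * v `^ (p - 1).
    by rewrite mulr_powRB1.
  have [cv|cv] := leP (c0 * v) (a * w).
    rewrite (@le_trans _ _ (a * w `^ p))//.
      by rewrite wE mulrA ler_wpM2r ?powR_ge0.
    by rewrite lerDl mulr_ge0// powR_ge0.
  rewrite (@le_trans _ _ (C * v `^ p))//; last first.
    by rewrite lerDr mulr_ge0// ?powR_ge0// ltW.
  rewrite /C vE mulrACA -powRM ?divr_ge0 ?(ltW a0)//.
  apply: ler_wpM2l; first exact: mulr_ge0.
  apply: ge0_ler_powR; rewrite ?nnegrE ?subr_ge0 ?(ltW p1)//.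
    by apply: mulr_ge0 => //; apply: divr_ge0 => //; exact: ltW.
  by rewrite mulrAC ler_pdivlMr// mulrC ltW.
rewrite -/a; lra.
Qed.

Lemma measurable_bool_natr d (X : measurableType d) (R : realType) (b : X -> bool) :
  measurable_fun setT b -> measurable_fun setT (fun x => (b x)%:R : R).
Proof.
move=> mb; rewrite (_ : (fun x => _) = fun x => if b x then 1 else 0); last first.
  by apply/funext => x; case: (b x).
exact: measurable_fun_ifT.
Qed.

(** * Maximal inequalities *)

Section ergodic.
Context {d} {X : measurableType d} {R : realType}.
Variables (mu : probability X R) (T : (X -> R) -> X -> R).
Implicit Types (f g : X -> R) (x : X).

Local Notation L1 f := (mu.-integrable setT (EFin \o f)).

Hypothesis T_L1 : forall f, L1 f -> L1 (T f).
Hypothesis T_add : forall f g x, L1 f -> L1 g -> T (f \+ g) x = T f x + T g x.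
Hypothesis T_cst : forall c x, T (cst c) x = c.
Hypothesis T_le : forall f g x, L1 f -> L1 g -> (forall y, f y <= g y) -> T f x <= T g x.
Hypothesis T_int : forall f, L1 f -> \int[mu]_x T f x = \int[mu]_x f x.

(** This is f + T f + ... + T^(n-1) f, unfolded from the front because Garsia's argument compares a
    sum with f plus T of the preceding sum. *)
Fixpoint partial_sum n f : X -> R :=
  if n is m.+1 then f \+ T (partial_sum m f) else cst 0.

(** The maximum includes the empty sum 0, which makes it nonnegative; Garsia's argument uses this
    off the set where it is positive. *)
Fixpoint max_sum n f : X -> R :=
  if n is m.+1 then (fun x => Num.max (max_sum m f x) (partial_sum m.+1 f x)) else cst 0.

Fixpoint max_mean n f : X -> R :=
  if n is m.+1 then
    (fun x => Num.max (max_mean m f x) (partial_sum m.+1 f x / m.+1%:R)) else cst 0.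

Lemma partial_sum_L1 n f : L1 f -> L1 (partial_sum n f).
Proof.
move=> intf; elim: n => [|n IH]; first exact: L1_cst.
by apply: L1D => //; exact: T_L1.
Qed.

Lemma L1_max f g : L1 f -> L1 g -> L1 (fun x => Num.max (f x) (g x)).
Proof.
move=> intf intg.
apply: (@L1_le _ _ _ _ _ ((fun x => `|f x|) \+ (fun x => `|g x|))).
- by apply: measurable_maxr; [exact: L1_measurable intf|exact: L1_measurable intg].
- by move=> x /=; have [_|_] := leP (f x) (g x); rewrite ?lerDl ?lerDr.
- by apply: L1D; exact: integrable_norm.
Qed.

Lemma max_sum_L1 n f : L1 f -> L1 (max_sum n f).
Proof.
move=> intf; elim: n => [|n IH]; first exact: L1_cst.
by apply: L1_max => //; exact: partial_sum_L1.
Qed.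

Lemma max_mean_L1 n f : L1 f -> L1 (max_mean n f).
Proof.
move=> intf; elim: n => [|n IH]; first exact: L1_cst.
apply: L1_max => //.
have := L1Z (n.+1%:R^-1) (partial_sum_L1 n.+1 intf).
by apply: eq_integrable => // x _; rewrite /= mulrC.
Qed.

Lemma max_sum_ge0 n f x : 0 <= max_sum n f x.
Proof. by elim: n => [|n IH] //=; rewrite le_max IH. Qed.

Lemma max_mean_ge0 n f x : 0 <= max_mean n f x.
Proof. by elim: n => [|n IH] //=; rewrite le_max IH. Qed.

Lemma partial_sum_le_max n m f x : (m <= n)%N -> partial_sum m f x <= max_sum n f x.
Proof.
elim: n => [|n IH]; first by rewrite leqn0 => /eqP ->.
rewrite leq_eqVlt => /predU1P[->|/IH h]; first by rewrite /= le_max lexx orbT.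
by rewrite /= le_max h.
Qed.

Lemma partial_sum_le_mean n m f x : (m < n)%N ->
  partial_sum m.+1 f x / m.+1%:R <= max_mean n f x.
Proof.
elim: n => [//|n IH]; rewrite ltnS leq_eqVlt => /predU1P[->|/IH h].
  by rewrite /= le_max lexx orbT.
by rewrite /= le_max h.
Qed.

Lemma max_sum_attained n f x : 0 < max_sum n f x ->
  exists2 m, (m < n)%N & max_sum n f x = partial_sum m.+1 f x.
Proof.
elim: n => [|n IH]; first by rewrite ltxx.
rewrite [max_sum _ _ _]/=; have [h|h] := leP (max_sum n f x) (f x + T (partial_sum n f) x).
  by move=> _; exists n.
by move=> /IH[m mn ->]; exists m => //; rewrite ltnS ltnW.
Qed.

(* Garsia's argument: where [max_sum n f] is positive, it is at most [f + T (max_sum n f)]. *)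
Lemma maximal_ergodic n f : L1 f ->
  0 <= \int[mu]_x (f x * (0 < max_sum n f x)%R%:R).
Proof.
move=> intf; set M := max_sum n f.
have intM : L1 M by exact: max_sum_L1.
have mM : measurable_fun setT M by exact: L1_measurable intM.
have mf := L1_measurable intf.
have intfM : L1 (fun x => f x * (0 < M x)%R%:R).
  apply: (@L1_le _ _ _ _ _ (fun x => `|f x|)); last exact: integrable_norm.
    apply: measurable_funM => //.
    by apply: measurable_bool_natr; exact: measurable_fun_ltr.
  by move=> x; rewrite normrM; case: (0 < M x); rewrite /= ?normr1 ?normr0 ?mulr1 ?mulr0.
have IM : \int[mu]_x (M x - T M x) = 0.
  by rewrite RintegralB// ?T_int ?subrr//; exact: T_L1.
rewrite -[leLHS]IM; apply: le_Rintegral => //; first by apply: L1B => //; exact: T_L1.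
move=> x _; have [M0|M0] := ltP 0 (M x).
  rewrite mulr1 lerBlDr.
  have [m mn Mm] := max_sum_attained M0.
  rewrite [leLHS]Mm.
  rewrite /= lerD2l; apply: T_le => //; first exact: partial_sum_L1.
  by move=> y; apply: partial_sum_le_max; exact: ltnW.
have -> : M x = 0 by apply/eqP; rewrite eq_le M0 max_sum_ge0.
rewrite mulr0 sub0r oppr_le0 -(T_cst 0 x); apply: T_le => //; first exact: L1_cst.
by move=> y; exact: max_sum_ge0.
Qed.

Lemma partial_sumB n f c x : L1 f ->
  partial_sum n (fun y => f y - c) x = partial_sum n f x - n%:R * c.
Proof.
move=> intf; elim: n x => [|n IH] x; first by rewrite /= mul0r subrr.
have -> : partial_sum n.+1 (fun y => f y - c) x =
    f x - c + T (partial_sum n (fun y => f y - c)) x by [].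
have -> : partial_sum n (fun y => f y - c) = partial_sum n f \+ cst (- (n%:R * c)).
  by apply/funext => y; rewrite IH.
rewrite T_add//; [|exact: partial_sum_L1|exact: L1_cst].
by rewrite T_cst /= -natr1; ring.
Qed.

(** T fixes constants, so the m-th sum of f - c is that of f minus m c. Thus Garsia's inequality for
    f - c speaks of the level set of the maximal mean of f. The sign of c matters because [max_mean]
    starts from 0. *)
Lemma max_sumB_gt0 n f c x : L1 f -> 0 <= c ->
  (0 < max_sum n (fun y => f y - c) x) = (c < max_mean n f x).
Proof.
move=> intf c0; elim: n => [|n IH]; first by rewrite /= ltxx ltNge c0.
rewrite [max_sum _ _ _]/= [max_mean _ _ _]/= !lt_max IH; congr (_ || _).
have := partial_sumB n.+1 c x intf; rewrite /= => ->.
by rewrite subr_gt0 ltr_pdivlMr// mulrC.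
Qed.

Lemma partial_sum_le n f c x : L1 f -> (forall y, f y <= c) ->
  partial_sum n f x <= n%:R * c.
Proof.
move=> intf fc; elim: n x => [|n IH] x; first by rewrite /= mul0r.
rewrite /= -natr1 mulrDl mul1r addrC lerD// -(T_cst (n%:R * c) x).
by apply: T_le => //; [exact: partial_sum_L1|exact: L1_cst].
Qed.

Lemma max_mean_le n f c x : L1 f -> 0 <= c -> (forall y, f y <= c) ->
  max_mean n f x <= c.
Proof.
move=> intf c0 fc; elim: n => [//|n IH]; rewrite [max_mean _ _ _]/= ge_max IH/=.
by rewrite ler_pdivrMr// mulrC; exact: (@partial_sum_le n.+1).
Qed.

Lemma L1_bounded f c : measurable_fun setT f -> (forall y, `|f y| <= c) -> L1 f.
Proof. by move=> mf fc; apply: (L1_le mf fc); exact: L1_cst. Qed.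

(** Garsia's inequality for f - 2^i says that each layer (f - 2^i) 1_(2^i < W) has nonnegative
    integral, which is what [dyadic_layer_bound] asks for. The bound B limits the number of layers
    and makes all powers integrable, but enters neither constant; n does not either, so the
    truncation can be removed afterwards. *)
Lemma max_mean_Lp p C n f B : 1 < p -> 0 <= C -> dyadic_layer_bound p C -> L1 f ->
  (forall y, 0 <= f y) -> (forall y, f y <= B) ->
  \int[mu]_x (max_mean n f x `^ p) <=
    (1 + C) / 2^-1 `^ (p + 1) * (1 + \int[mu]_x (f x `^ p)).
Proof.
move=> p1 C0 HC intf f0 fB; have p0 : 0 < p by rewrite (lt_trans _ p1).
set a := 2^-1 `^ (p + 1); have a0 : 0 < a by rewrite powR_gt0.
have B0 : 0 <= B by rewrite (le_trans (f0 point)).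
set W := max_mean n f.
have intW : L1 W by exact: max_mean_L1.
have mW := L1_measurable intW; have mf := L1_measurable intf.
have W0 x : 0 <= W x by exact: max_mean_ge0.
have WB x : W x <= B by exact: max_mean_le.
have L1p g : measurable_fun setT g -> (forall y, 0 <= g y) -> (forall y, g y <= B) ->
    L1 (fun x => g x `^ p).
  move=> mg g0 gB; apply: (@L1_bounded _ (B `^ p)).
    exact: (measurableT_comp (measurable_powR p)).
  by move=> y; rewrite ger0_norm ?powR_ge0// ge0_ler_powR ?nnegrE// ltW.
have [N BN] : exists N, B <= 2 ^+ N.
  exists (Num.truncn B).+1; rewrite (le_trans (ltW (truncnS_gt B)))//.
  by rewrite -natrX ler_nat ltnW// ltn_expl.
have intI i : L1 (fun x => (f x - 2 ^+ i) * (2 ^+ i < W x)%R%:R).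
  apply: (@L1_le _ _ _ _ _ (fun x => `|f x - 2 ^+ i|)).
  - apply: measurable_funM; first exact: measurable_funB.
    by apply: measurable_bool_natr; exact: measurable_fun_ltr.
  - by move=> x; rewrite normrM; case: (_ < W x); rewrite /= ?normr1 ?normr0 ?mulr1 ?mulr0.
  - by apply: integrable_norm; apply: L1B => //; exact: L1_cst.
have I0 i : 0 <= \int[mu]_x ((f x - 2 ^+ i) * (2 ^+ i < W x)%R%:R).
  have := @maximal_ergodic n (fun x => f x - 2 ^+ i) (L1B intf (L1_cst mu (2 ^+ i))).
  congr (_ <= _); apply: eq_Rintegral => x _.
  by rewrite max_sumB_gt0// exprn_ge0.
pose s x := \sum_(i < N) (2 `^ (p - 1)) ^+ i * ((f x - 2 ^+ i) * (2 ^+ i < W x)%R%:R).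
have [ints s0] : L1 s /\ 0 <= \int[mu]_x s x.
  rewrite /s; elim: N {BN s} => [|N [IH1 IH2]].
    split; first by under eq_fun do rewrite big_ord0; exact: L1_cst.
    by under eq_Rintegral do rewrite big_ord0; rewrite Rintegral_cst// mul0r.
  have -> : (fun x => \sum_(i < N.+1) (2 `^ (p - 1)) ^+ i * ((f x - 2 ^+ i) * (2 ^+ i < W x)%R%:R)) =
    (fun x => \sum_(i < N) (2 `^ (p - 1)) ^+ i * ((f x - 2 ^+ i) * (2 ^+ i < W x)%R%:R)) \+
    (fun x => (2 `^ (p - 1)) ^+ N * ((f x - 2 ^+ N) * (2 ^+ N < W x)%R%:R)).
    by apply/funext => x; rewrite big_ord_recr.
  have L := L1Z ((2 `^ (p - 1)) ^+ N) (intI N).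
  split; first exact: L1D.
  by rewrite RintegralD// addr_ge0// RintegralZl// mulr_ge0// exprn_ge0// powR_ge0.
have intWp := L1p W mW W0 WB; have intfp := L1p f mf f0 fB.
have If0 : 0 <= \int[mu]_x (f x `^ p) by apply: Rintegral_ge0 => x _; exact: powR_ge0.
have : \int[mu]_x (a * W x `^ p) <= \int[mu]_x ((1 + C * f x `^ p) - s x).
  apply: le_Rintegral => //.
  - exact: L1Z.
  - by apply: L1B => //; apply: L1D; [exact: L1_cst|exact: L1Z].
  - by move=> x _; apply: HC => //; rewrite (le_trans (WB x)).
rewrite RintegralB//; last by apply: L1D; [exact: L1_cst|exact: L1Z].
rewrite RintegralD//; [|exact: L1_cst|exact: L1Z].
have I1 : \int[mu]_x (cst 1 x : R) = 1.
  by rewrite Rintegral_cst// mul1r [X in fine X](@probability_setT _ _ _ mu).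
rewrite (RintegralZl _ measurableT intWp) (RintegralZl _ measurableT intfp) I1 => h.
rewrite mulrAC ler_pdivlMr// mulrC.
apply: (le_trans h).
rewrite mulrDl mul1r mulrDr mulr1 addrAC addrA.
by rewrite lerD2r lerBlDr -!addrA lerDl !addr_ge0.
Qed.

End ergodic.

Section maximal_function.
Context {d} {X : measurableType d} {R : realType}.
Variables (mu : probability X R) (K : R -> X -> X -> R).
Hypothesis HK : poisson_kernel_spec mu K.
Implicit Types (f g : X -> R) (s t h : R) (x y : X).

Local Notation op := (kernel_op mu K).
Local Notation L1 f := (mu.-integrable setT (EFin \o f)).

Lemma L1_powR p g : 1 <= p -> measurable_fun setT g -> (forall x, 0 <= g x) ->
  (\int[mu]_x (g x `^ p)%:E < +oo)%E -> L1 (fun x => g x `^ p) /\ L1 g.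
Proof.
move=> p1 mg g0 gp.
have Lp : L1 (fun x => g x `^ p).
  apply/integrableP; split.
    by apply/measurable_EFinP; exact: (measurableT_comp (measurable_powR p)).
  by under eq_integral do rewrite gee0_abs ?lee_fin ?powR_ge0//.
split => //; apply: (@L1_le _ _ _ _ _ (cst 1 \+ (fun x => g x `^ p))) => //.
  move=> x; rewrite ger0_norm//=; have [g1|g1] := leP (g x) 1.
    by rewrite (le_trans g1)// lerDl powR_ge0.
  by rewrite (@le_trans _ _ (g x `^ p)) ?le1r_powR ?lerDr// ltW.
by apply: L1D => //; exact: L1_cst.
Qed.

Lemma partial_sum_succ h n f x : 0 < h -> L1 f ->
  partial_sum (op h) n.+2 f x = partial_sum (op h) n.+1 f x + op (n.+1%:R * h) f x.
Proof.
move=> h0 intf; elim: n x => [|n IH] x.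
  by rewrite /= mul1r (kernel_op_cst HK)// addr0 (_ : f \+ op h (cst 0) = f)//;
    apply/funext => y /=; rewrite (kernel_op_cst HK)// addr0.
have L := partial_sum_L1 (T := op h) (fun g => kernel_op_L1 HK h0) n.+1 intf.
have nh0 : 0 < n.+1%:R * h by rewrite mulr_gt0.
have Lo := kernel_op_L1 HK nh0 intf.
have psE : partial_sum (op h) n.+2 f = partial_sum (op h) n.+1 f \+ op (n.+1%:R * h) f.
  by apply/funext.
have -> : partial_sum (op h) n.+3 f x =
    f x + op h (partial_sum (op h) n.+1 f \+ op (n.+1%:R * h) f) x by rewrite -psE.
rewrite (kernel_opD HK)// addrA; congr (_ + _).
by rewrite (kernel_op_semigroup HK)// -[n.+2%:R]natr1 mulrDl mul1r addrC.
Qed.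

(* [K_mono] makes the single operator [op (n h)] comparable to the mean of the [op (j h)], [j <= n]. *)
Lemma kernel_op_le_max_mean h n N f x : 0 < h -> (0 < n < N)%N -> L1 f ->
  (forall y, 0 <= f y) -> op (n%:R * h) f x <= 2 * max_mean (op h) N f x.
Proof.
move=> h0 /andP[n0 nN] intf f0.
have nh0 : 0 < n%:R * h by rewrite mulr_gt0// ltr0n.
have A0 : 0 <= op (n%:R * h) f x by apply: (kernel_op_ge0 HK).
(* The coefficient k (k+1) / (2n) is the sum of j / n for j <= k, each j contributing (j / n)
   [op (n h)] <= [op (j h)]. At k = n it equals (n+1) / 2, half the number of terms in the mean. *)
have key k : (k <= n)%N ->
    (k%:R * k.+1%:R / (2 * n%:R)) * op (n%:R * h) f x <= partial_sum (op h) k.+1 f x.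
  elim: k => [_|k IH kn]; first by rewrite !mul0r /= (kernel_op_cst HK)// addr0.
  rewrite partial_sum_succ//.
  have kh0 : 0 < k.+1%:R * h by rewrite mulr_gt0// ltr0n.
  have le1 : k.+1%:R * h <= n%:R * h by rewrite ler_pM2r// ler_nat.
  have := kernel_op_mono HK x kh0 le1 intf f0.
  rewrite -mulf_div divff ?gt_eqF// mulr1 -ler_pdivrMl ?divr_gt0 ?ltr0n// invf_div => h1.
  apply: le_trans (lerD (IH (ltnW kn)) h1).
  rewrite -mulrDl le_eqVlt; apply/orP; left; apply/eqP; congr (_ * _).
  have nn0 : n%:R != 0 :> R by rewrite pnatr_eq0 -lt0n.
  by rewrite -!natr1; field.
have := key n (leqnn n).
have -> : n%:R * n.+1%:R / (2 * n%:R) = n.+1%:R / 2 :> R.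
  have nn0 : n%:R != 0 :> R by rewrite pnatr_eq0 -lt0n.
  by field.
rewrite mulrAC -ler_pdivlMr ?invr_gt0// invrK mulrC -ler_pdivlMr ?ltr0n//.
move=> /le_trans; apply; rewrite mulrAC mulrC ler_wpM2l//.
exact: partial_sum_le_mean.
Qed.

(** At stage N, time is discretised with step 1 / (N+1) and g is cut at N, so that [max_mean_Lp]
    applies with a constant free of N. The resulting M_N dominates all times between 1 / (N+1) and
    N+1. By Fatou the lower limit of M_N^p is integrable, and it dominates every time at once. The
    exceptional set is where this lower limit is infinite; it depends on no t. *)
Lemma kernel_op_maximal p g : 1 < p -> measurable_fun setT g -> (forall x, 0 <= g x) ->
  (\int[mu]_x (g x `^ p)%:E < +oo)%E ->
  exists M : X -> R, [/\ measurable_fun setT M, (forall x, 0 <= M x),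
    (\int[mu]_x (M x `^ p)%:E < +oo)%E &
    {ae mu, forall x, forall t, 0 < t -> op t g x <= M x}].
Proof.
move=> p1 mg g0 gp; have p0 : 0 < p by rewrite (lt_trans _ p1).
have [Lgp Lg] := L1_powR (ltW p1) mg g0 gp.
pose h N : R := N.+1%:R^-1.
have h0 N : 0 < h N by rewrite invr_gt0.
pose V N x := Num.min (g x) N%:R.
have V0 N x : 0 <= V N x by rewrite le_min g0/=.
have VN N x : V N x <= N%:R by rewrite ge_min lexx orbT.
have Vg N x : V N x <= g x by rewrite ge_min lexx.
have LV N : L1 (V N).
  apply: (@L1_le _ _ _ _ _ g) => //.
    exact: measurable_minr.
  by move=> x; rewrite ger0_norm.
(* One factor 2 comes from [kernel_op_le_max_mean], the other from rounding t down to n h with n >=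
   1, where t / (n h) <= (n+1) / n. Since t <= N+1, at most (N+1)^2 multiples of h occur. *)
pose M N x := 4 * max_mean (op (h N)) (N.+1 ^ 2).+1 (V N) x.
have T_L1 N f : L1 f -> L1 (op (h N) f) by exact: (kernel_op_L1 HK).
have T_int N f : L1 f -> \int[mu]_x op (h N) f x = \int[mu]_x f x.
  by move=> intf; rewrite /Rintegral (integral_kernel_op HK).
have LM N : L1 (M N) by apply: L1Z; exact: (max_mean_L1 (T_L1 N)).
have M0 N x : 0 <= M N x by rewrite mulr_ge0// max_mean_ge0.
have opM N t x : (h N) <= t -> t <= N.+1%:R -> op t (V N) x <= M N x.
  move=> ht tN; have t0 := lt_le_trans (h0 N) ht.
  pose n := Num.truncn (t * N.+1%:R).
  have tN0 : 0 <= t * N.+1%:R by rewrite mulr_ge0// ltW.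
  have n0 : (0 < n)%N.
    by rewrite truncn_gt0// -ler_pdivrMr// div1r.
  have nle : n%:R <= t * N.+1%:R by rewrite truncn_le.
  have ngt : t * N.+1%:R < n.+1%:R by exact: truncnS_gt.
  have nN : (n <= N.+1 ^ 2)%N.
    rewrite -(ler_nat R) (le_trans nle)// natrX expr2 ler_wpM2r//.
  have nh0 : 0 < n%:R * h N by rewrite mulr_gt0// ltr0n.
  have nht : n%:R * h N <= t by rewrite ler_pdivrMr.
  have := kernel_op_mono HK x nh0 nht (LV N) (V0 N).
  move=> /le_trans; apply.
  have B := kernel_op_le_max_mean x (h0 N) (N := (N.+1 ^ 2).+1) (n := n) _ (LV N) (V0 N).
  rewrite /M (_ : 4 = 2 * 2 :> R); last by rewrite -natrM.
  rewrite -[leRHS]mulrA; apply: ler_pM; last by apply: B; rewrite n0 ltnS.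
  - by rewrite divr_ge0// ltW.
  - by apply: (kernel_op_ge0 HK).
  rewrite ler_pdivrMr// mulrA ler_pdivlMr//.
  rewrite (le_trans (ltW ngt))// -natrM ler_nat mul2n -addnn -addn1 leq_add2l.
  exact: n0.
have [c c0 Hc] := dyadic_layer_boundP p1.
have a0 : 0 < 2^-1 `^ (p + 1) :> R by rewrite powR_gt0.
pose C := 4 `^ p * ((1 + c) / 2^-1 `^ (p + 1) * (1 + \int[mu]_x (g x `^ p))).
have intMp N : (\int[mu]_x (M N x `^ p)%:E <= C%:E)%E.
  have mW := max_mean_L1 (T_L1 N) (N.+1 ^ 2).+1 (LV N).
  have W0 x := max_mean_ge0 (op (h N)) (N.+1 ^ 2).+1 (V N) x.
  have WN x : max_mean (op (h N)) (N.+1 ^ 2).+1 (V N) x <= N%:R.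
    apply: (max_mean_le (T_L1 N) _ _ _ _ (LV N)) => //.
    - by move=> e y; exact: (kernel_op_cst HK).
    - by move=> f1 f2 y L2 L3 f12; exact: (kernel_op_le HK).
  have LW : L1 (fun x => max_mean (op (h N)) (N.+1 ^ 2).+1 (V N) x `^ p).
    apply: (@L1_bounded _ _ _ _ _ (N%:R `^ p)).
      by apply: (measurableT_comp (measurable_powR p)); exact: (L1_measurable mW).
    by move=> y; rewrite ger0_norm ?powR_ge0// ge0_ler_powR ?nnegrE// ltW.
  have LVp : L1 (fun x => V N x `^ p).
    apply: (@L1_le _ _ _ _ _ (fun x => g x `^ p)) => //.
      by apply: (measurableT_comp (measurable_powR p)); exact: (L1_measurable (LV N)).
    by move=> y; rewrite ger0_norm ?powR_ge0// ge0_ler_powR ?nnegrE// ltW.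
  have -> : (\int[mu]_x (M N x `^ p)%:E =
      (4 `^ p * \int[mu]_x (max_mean (op (h N)) (N.+1 ^ 2).+1 (V N) x `^ p))%:E)%E.
    rewrite -RintegralZl// /Rintegral fineK.
      by apply: eq_integral => x _; rewrite /M powRM.
    by apply: integrable_fin_num => //; exact: L1Z.
  rewrite lee_fin ler_wpM2l ?powR_ge0//.
  have Tadd f1 f2 x : L1 f1 -> L1 f2 -> op (h N) (f1 \+ f2) x = op (h N) f1 x + op (h N) f2 x.
    by move=> ? ?; exact: (kernel_opD HK).
  have Tcst e x : op (h N) (cst e) x = e by exact: (kernel_op_cst HK).
  have Tle f1 f2 x : L1 f1 -> L1 f2 -> (forall y, f1 y <= f2 y) -> op (h N) f1 x <= op (h N) f2 x.
    by move=> ? ? ?; exact: (kernel_op_le HK).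
  apply: (le_trans (max_mean_Lp (T_L1 N) Tadd Tcst Tle (T_int N) _ p1 c0 Hc (LV N) (V0 N) (VN N))).
  rewrite ler_wpM2l ?divr_ge0 ?addr_ge0 ?(ltW a0)// lerD2l.
  apply: le_Rintegral => // x _.
  by rewrite ge0_ler_powR ?nnegrE// ltW.
(* Step and truncation both change with N, so no monotonicity in N is at hand; the lower limit is
   the object that Fatou controls. *)
pose Z x := limn_einf (fun N => (M N x `^ p)%:E).
have mMp N : measurable_fun setT (fun x => (M N x `^ p)%:E).
  apply/measurable_EFinP; apply: (measurableT_comp (measurable_powR p)).
  exact: (L1_measurable (LM N)).
have mZ : measurable_fun setT Z.
  rewrite (_ : Z = fun x => limn (einfs (fun N => (M N x `^ p)%:E))); last first.
    by apply/funext => x; rewrite /Z limn_einf_lim.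
  apply: (emeasurable_fun_cvg (fun n x => einfs (fun N => (M N x `^ p)%:E) n)).
    by move=> n; apply: (measurable_fun_einfs (f := fun N x => (M N x `^ p)%:E)).
  by move=> x _; exact: is_cvg_einfs.
have lee_limn_einf (w v : (\bar R)^nat) l : w n @[n --> \oo] --> l ->
    (\forall n \near \oo, (w n <= v n)%E) -> (l <= limn_einf v)%E.
  move=> wl [n0 _ wv]; have [<- _] := cvg_limn_einf_sup wl.
  rewrite !limn_einf_lim; apply: lee_lim; [exact: is_cvg_einfs|exact: is_cvg_einfs|].
  exists n0 => // n /= n0n; apply: le_ereal_inf_tmp => _ [m /= nm <-].
  apply: (@le_trans _ _ (w m)); last by apply: wv => /=; exact: leq_trans nm.
  by apply: ereal_inf_lbound; exists m.
have Z0 x : (0 <= Z x)%E.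
  apply: (@lee_limn_einf (cst 0%E)); first exact: cvg_cst.
  by apply: nearW => N; rewrite lee_fin powR_ge0.
have intZ : (\int[mu]_x Z x <= C%:E)%E.
  apply: (le_trans (@fatou _ _ _ mu _ measurableT (fun N x => (M N x `^ p)%:E) _ _)).
  - exact: mMp.
  - by move=> N x _; rewrite lee_fin powR_ge0.
  rewrite limn_einf_lim; apply: lime_le; first exact: is_cvg_einfs.
  apply: nearW => n; apply: le_trans (intMp n).
  by apply: ereal_inf_lbound; exists n => /=.
have opZ t x : 0 < t -> ((op t g x `^ p)%:E <= Z x)%E.
  move=> t0.
  have cvgV : op t (V N) x @[N --> \oo] --> op t g x.
    apply: (proj2 (@kernel_op_cvgn _ _ _ mu K HK t V g g x t0 LV Lg _ _)).
      by move=> N y; rewrite ger0_norm.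
    move=> y; apply: cvg_near_cst; near=> N.
    by apply/min_idPl/ltW; near: N; exact: nbhs_infty_gtr.
  have opg0 : 0 <= op t g x by apply: (kernel_op_ge0 HK).
  (* Continuity of y^p is obtained below from derivability, hence at positive y only. *)
  have [op0|opn0] := eqVneq (op t g x) 0.
    by rewrite op0 powR0 ?gt_eqF.
  apply: (@lee_limn_einf (fun N => (op t (V N) x `^ p)%:E)).
    apply: cvg_EFin; first exact: nearW.
    suff cont : {for op t g x, continuous (fun y : R => y `^ p)} by
      exact: (@cvg_comp _ _ _ (fun N => op t (V N) x) (fun y : R => y `^ p) _ _ _ cvgV cont).
    apply/differentiable_continuous/derivable1_diffP/derivable_powR.
    by rewrite in_itv/= andbT lt_def opn0.
  near=> N; rewrite lee_fin; apply: ge0_ler_powR.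
  - exact: ltW.
  - by rewrite nnegrE; apply: (kernel_op_ge0 HK).
  - by rewrite nnegrE.
  - apply: opM.
      rewrite /h invf_ple ?posrE// (le_trans (_ : _ <= N%:R)) ?ler_nat//.
      by near: N; exact: nbhs_infty_ger.
    rewrite (le_trans (_ : _ <= N%:R)) ?ler_nat//.
    by near: N; exact: nbhs_infty_ger.
exists (fun x => fine (Z x) `^ p^-1); split.
- apply: (measurableT_comp (measurable_powR _)).
  exact: (measurableT_comp (@fine_measurable R _ measurableT)).
- by move=> x; exact: powR_ge0.
- apply: (@le_lt_trans _ _ (\int[mu]_x Z x)%E); last by rewrite (le_lt_trans intZ) ?ltry.
  apply: ge0_le_integral => //.
  + by move=> x _; rewrite lee_fin powR_ge0.
  + apply/measurable_EFinP; do 2 apply: (measurableT_comp (measurable_powR _)).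
    exact: (measurableT_comp (@fine_measurable R _ measurableT)).
  + move=> x _; rewrite -powRrM mulVf ?gt_eqF// powRr1 ?fine_ge0//.
    have [Zfin|] := boolP (Z x \is a fin_num); first by rewrite fineK.
    by rewrite ge0_fin_numE// -leNgt leye_eq => /eqP ->; rewrite leey.
have LZ : mu.-integrable setT Z.
  apply/integrableP; split => //.
  by under eq_integral do rewrite gee0_abs//; rewrite (le_lt_trans intZ) ?ltry.
have := integrable_ae measurableT LZ.
apply: filterS => x /(_ I) Zfin t t0.
have := opZ t x t0; rewrite -{1}(fineK Zfin) lee_fin => h1.
have op0 : 0 <= op t g x by apply: (kernel_op_ge0 HK).
rewrite -[leLHS](powRr1 op0) -(divff (x := p)) ?gt_eqF// powRrM.
by rewrite ge0_ler_powR ?nnegrE ?invr_ge0 ?powR_ge0 ?fine_ge0// ltW.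
Unshelve. all: by end_near. Qed.

End maximal_function.

(** * Joint measurability in time and space *)

Lemma measurable_truncn_mul (R : realType) (c : R) :
  measurable_fun [set: measurableTypeR R] (fun t : measurableTypeR R => Num.truncn (t * c)).
Proof.
move=> _ Y _; rewrite setTI.
have le_meas n : measurable [set t : measurableTypeR R | (Num.truncn (t * c)%R <= n)%N].
  rewrite (_ : [set _ | _] = (fun t : measurableTypeR R => t * c) @^-1` `]-oo, n.+1%:R[).
    rewrite -[X in measurable X]setTI; apply: (measurable_funM (@measurable_id _ _ _) (measurable_cst c)) => //.
  by apply/seteqP; split=> t; rewrite /= truncn_le_nat in_itv.
have eq_meas n : measurable [set t : measurableTypeR R | Num.truncn (t * c)%R = n].
  case: n => [|n].
    by have := le_meas 0%N; congr measurable; apply/seteqP; split=> t /=; [rewrite leqn0 => /eqP|move=> ->].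
  rewrite (_ : [set _ | _] = [set t : measurableTypeR R | (Num.truncn (t * c)%R <= n.+1)%N] `\`
     [set t : measurableTypeR R | (Num.truncn (t * c)%R <= n)%N]); first exact: measurableD.
  apply/seteqP; split=> t /=; first by move=> ->; rewrite ltnn leqnn.
  by move=> [h1 /negP h2]; apply/eqP; rewrite eqn_leq h1 ltnNge.
rewrite (_ : _ @^-1` Y = \bigcup_(n in Y) [set t | Num.truncn (t * c)%R = n]).
  by apply: bigcup_measurable => n _.
by apply/seteqP; split=> [t Yt|t [n Yn /= tn]]; [exists (Num.truncn (t * c))|rewrite /= tn].
Qed.

Lemma measurable_fun_nat_prod d1 d2 (T : measurableType d1) (X : measurableType d2) (R : realType)
  (N : T -> nat) (g : nat -> X -> R) : measurable_fun setT N ->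
  (forall n, measurable_fun setT (g n)) ->
  measurable_fun setT (fun z : T * X => g (N z.1) z.2).
Proof.
move=> mN mg _ B mB; rewrite setTI.
rewrite (_ : _ @^-1` B = \bigcup_n ((N @^-1` [set n]) `*` (g n @^-1` B))).
  apply: bigcup_measurable => n _; apply: measurableX.
    by rewrite -[X in measurable X]setTI; exact: mN.
  by rewrite -[X in measurable X]setTI; exact: mg.
apply/seteqP; split=> [[t x] /= h|[t x] [n _ [/= Nn h]]]; first by exists (N t).
by rewrite /= Nn.
Qed.

Lemma measurable_caratheodory d (X : measurableType d) (R : realType) (v : R -> X -> R) :
  (forall t, 0 < t -> measurable_fun setT (v t)) ->
  (forall t x, 0 < t -> {for t, continuous (fun s => v s x)}) ->
  measurable_fun setT (fun z : measurableTypeR R * X => v z.1 z.2 * (0 < z.1)%R%:R).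
Proof.
move=> mv cv.
(* Rounding up keeps the sampled time positive even when t < 1 / (n+1), where v would otherwise be
   evaluated at 0. The approximant takes countably many values in time, which gives joint
   measurability. *)
pose step n (t : R) : R := (Num.truncn (t * n.+1%:R)).+1%:R / n.+1%:R.
apply: (measurable_fun_cvg (h := fun n (z : measurableTypeR R * X) => v (step n z.1) z.2 * (0 < z.1)%R%:R)).
  move=> n; apply: measurable_funM.
    apply: (@measurable_fun_nat_prod _ _ _ _ _ (fun t : measurableTypeR R => Num.truncn (t * n.+1%:R))
      (fun m => v (m.+1%:R / n.+1%:R))).
      exact: measurable_truncn_mul.
    by move=> m; apply: mv; rewrite divr_gt0.
  by apply: measurable_bool_natr; apply: measurable_fun_ltr => //; exact: measurable_fst.
move=> [t x] _ /=; have [t0|t0] := ltP 0 t; last first.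
  by under eq_fun do rewrite mulr0; rewrite mulr0; exact: cvg_cst.
under eq_fun do rewrite mulr1; rewrite mulr1.
suff stept : step n t @[n --> \oo] --> t.
  exact: (@cvg_comp _ _ _ (fun n => step n t) (fun s => v s x) _ _ _ stept (cv t x t0)).
apply: (@squeeze_cvgr _ _ _ _ (cst t) (fun n => t + 1 / n.+1%:R)).
- near=> n; rewrite /cst /step; apply/andP; split.
    by rewrite ler_pdivlMr// ltW// truncnS_gt.
  rewrite -[t in leRHS](mulfK (_ : n.+1%:R != 0)) ?pnatr_eq0// -mulrDl.
  by rewrite ler_pM2r ?invr_gt0// -natr1 lerD2r truncn_le mulr_ge0// ltW.
- exact: cvg_cst.
- rewrite -[X in _ --> X]addr0; apply: cvgD; first exact: cvg_cst.
  by under eq_fun do rewrite div1r; exact: cvg_harmonic.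
Unshelve. all: by end_near. Qed.

(* The integrated form of the tangent inequality [y <= b + b^(1-q) y^q]. *)
Lemma le_tangent_powR (R : realType) (q b y : R) : 1 <= q -> 0 < b -> 0 <= y ->
  y <= b + b `^ (1 - q) * y `^ q.
Proof.
move=> q1 b0 y0; have [yb|yb] := leP y b.
  by rewrite (le_trans yb)// lerDl mulr_ge0 ?powR_ge0.
have y0' : 0 < y := lt_trans b0 yb.
rewrite (@le_trans _ _ (b `^ (1 - q) * y `^ q))//; last by rewrite lerDr ltW.
rewrite -(mulr_powRB1 y0) ?(lt_le_trans ltr01)// mulrCA ler_peMr//.
rewrite -[1 - q]opprB powRN mulrC ler_pdivlMr ?powR_gt0// mul1r.
by rewrite ge0_ler_powR ?nnegrE ?subr_ge0// ltW.
Qed.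

(** * Contraction in L^p and averages over a window of scales *)

Section Lp_contraction.
Context {d} {X : measurableType d} {R : realType}.
Variables (mu : probability X R) (K : R -> X -> X -> R).
Hypothesis HK : poisson_kernel_spec mu K.
Implicit Types (f g : X -> R) (s t h : R) (x y : X).

Local Notation op := (kernel_op mu K).
Local Notation L1 f := (mu.-integrable setT (EFin \o f)).

(** Jensen's inequality, obtained from Young's: with b = [op t g x], b^(p-1) g <= g^p / p + b^p /
    p'. Applying [op t] at x, which fixes constants, gives b^p <= [op t] (g^p) / p + b^p / p', and
    the last term is subtracted. *)
Lemma kernel_op_powR_le t p g x : 0 < t -> 1 < p -> L1 g -> (forall y, 0 <= g y) ->
  L1 (fun y => g y `^ p) -> op t g x `^ p <= op t (fun y => g y `^ p) x.
Proof.
move=> t0 p1 Lg g0 Lgp; have p0 : 0 < p by rewrite (lt_trans _ p1).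
set b := op t g x; have b0 : 0 <= b by exact: (kernel_op_ge0 HK).
pose p' := p / (p - 1); have p10 : 0 < p - 1 by rewrite subr_gt0.
have p'0 : 0 < p' by rewrite divr_gt0.
have pp' : p^-1 + p'^-1 = 1 by rewrite /p' invf_div; field; rewrite !gt_eqF.
have bE : (b `^ (p - 1)) `^ p' = b `^ p.
  by rewrite -powRrM /p' mulrCA divff ?mulr1// gt_eqF.
have key y : b `^ (p - 1) * g y <= p^-1 * g y `^ p + b `^ p / p'.
  by rewrite mulrC [p^-1 * _]mulrC -bE; apply: conjugate_powR => //; exact: powR_ge0.
have : op t (fun y => b `^ (p - 1) * g y) x <=
    op t ((fun y => p^-1 * g y `^ p) \+ cst (b `^ p / p')) x.
  apply: (kernel_op_le HK) => //; first exact: L1Z.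
  by apply: L1D; [exact: L1Z|exact: L1_cst].
rewrite (kernel_opD HK)//; [|exact: L1Z|exact: L1_cst].
rewrite (kernel_op_cst HK)// !(kernel_opZ HK)// -/b mulrC mulr_powRB1//.
have -> : p'^-1 = 1 - p^-1 by rewrite -pp' addrAC subrr add0r.
rewrite mulrBr mulr1 addrCA lerDl subr_ge0 mulrC.
by rewrite ler_pM2l// invr_gt0.
Qed.

Lemma integral_kernel_op_powR_le t p g : 0 < t -> 1 < p -> measurable_fun setT g ->
  (forall y, 0 <= g y) ->
  (\int[mu]_x (op t g x `^ p)%:E <= \int[mu]_x (g x `^ p)%:E)%E.
Proof.
move=> t0 p1 mg g0.
have [->|] := eqVneq (\int[mu]_x (g x `^ p)%:E)%E +oo%E; first by rewrite leey.
rewrite -ltey => gp; have [Lgp Lg] := L1_powR (ltW p1) mg g0 gp.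
rewrite -[leRHS](integral_kernel_op HK t0 Lgp).
apply: ge0_le_integral => //.
- by move=> x _; rewrite lee_fin powR_ge0.
- apply/measurable_EFinP; apply: (measurableT_comp (measurable_powR p)).
  exact: (kernel_op_measurable HK).
- by apply/measurable_EFinP; exact: (kernel_op_measurable HK).
- by move=> x _; rewrite lee_fin; exact: kernel_op_powR_le.
Qed.

Variable f : X -> R.
Hypothesis intf : L1 f.
Local Notation u := (kernel_deriv mu K f).

Lemma measurable_kernel_deriv k :
  measurable_fun setT (fun z : measurableTypeR R * X => u k z.1 z.2 * (0 < z.1)%R%:R).
Proof.
apply: measurable_caratheodory.
  by move=> t t0; exact: (kernel_deriv_measurable HK).
move=> t x t0; apply/differentiable_continuous/derivable1_diffP.
exact: (kernel_deriv_derivable HK).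
Qed.

(* The [q]-th power of the inner norm in the Triebel-Lizorkin seminorm. *)
Definition scale_integral (k : nat) (a q : R) x : \bar R :=
  (\int[lebesgue_measure]_(t in `]0%R, +oo[) (((t `^ (k%:R - a) * `|u k t x|) `^ q) / t)%:E)%E.

Lemma measurable_kernel_deriv_time k x :
  measurable_fun (`]0%R, +oo[%classic : set (measurableTypeR R)) (fun s => u k s x).
Proof.
have H := measurableT_comp (measurable_kernel_deriv k) (pair2_measurable (x : X)).
have := @measurable_funTS _ _ _ _ (`]0%R, +oo[%classic : set (measurableTypeR R)) _ H.
apply: eq_measurable_fun => s; rewrite inE/= in_itv/= andbT => s0.
by rewrite s0 mulr1.
Qed.

Lemma measurable_scale_integrand k (a q : R) x :
  measurable_fun (`]0%R, +oo[%classic : set (measurableTypeR R))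
    (fun t => (((t `^ (k%:R - a) * `|u k t x|) `^ q) / t)%:E).
Proof.
apply/measurable_EFinP; apply: measurable_funM; last first.
  apply: open_continuous_measurable_fun; first exact: interval_open.
  move=> s; rewrite inE/= in_itv/= andbT => s0.
  by apply: inv_continuous; rewrite gt_eqF.
apply: (measurableT_comp (measurable_powR q)); apply: measurable_funM.
  exact: measurable_funTS.
by apply: (measurableT_comp (@normr_measurable R setT)); exact: measurable_kernel_deriv_time.
Qed.

(** The tangent inequality at level b = t^(a-k) V makes |u| at most b plus a multiple of the scale
    integrand. The outcome is linear in V, so that it can later be integrated against the kernel in
    y. *)
Lemma window_le k (a q t V : R) x : 0 < t -> 1 <= q -> a <= k%:R -> 1 <= V ->
  (scale_integral k a q x <= (V `^ q)%:E)%E ->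
  (\int[lebesgue_measure]_(s in `[(t / 4)%R, (t / 2)%R]) `|u k s x|%:E <=
   ((1 + 4 `^ ((k%:R - a) * q)) * (t * t `^ (- (k%:R - a)) * V))%:E)%E.
Proof.
move=> t0 q1 ak V1 HV; set e := k%:R - a; have e0 : 0 <= e by rewrite subr_ge0.
have q0 : 0 < q by rewrite (lt_le_trans _ q1).
have V0 : 0 < V by rewrite (lt_le_trans _ V1).
pose D := `[(t / 4)%R, (t / 2)%R]%classic : set (measurableTypeR R).
have t40 : 0 < t / 4 by rewrite divr_gt0.
have D0 : D `<=` `]0%R, +oo[%classic.
  by move=> s; rewrite /D /= !in_itv/= andbT => /andP[+ _]; exact: lt_le_trans.
have mD : measurable D by exact: measurable_itv.
pose b := t `^ (- e) * V; have b0 : 0 < b by rewrite mulr_gt0// powR_gt0.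
pose I s := ((s `^ e * `|u k s x|) `^ q) / s.
(* This is b^(1-q) = t^(-e) t^(eq) V^(1-q) times t (t / 4)^(-eq), a bound on the window for the
   weight s s^(-eq) that converts |u|^q into the scale integrand. *)
pose c := t `^ (- e) * V `^ (1 - q) * t * 4 `^ (e * q).
have c0 : 0 <= c by rewrite !mulr_ge0 ?powR_ge0// ltW.
have mI : measurable_fun D (fun s => (I s)%:E).
  by apply: (@measurable_funS _ _ _ _ _ _ _ _ D0) => //; exact: measurable_scale_integrand.
have I0 s : D s -> 0 <= I s.
  by move=> Ds; rewrite divr_ge0 ?powR_ge0//; move: (D0 _ Ds); rewrite /= in_itv/= andbT => /ltW.
have key s : D s -> `|u k s x| <= b + c * I s.
  move=> Ds; have s0 : 0 < s by move: (D0 _ Ds); rewrite /= in_itv/= andbT.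
  move: Ds; rewrite /D /= in_itv/= => /andP[s1 s2].
  apply: (le_trans (le_tangent_powR q1 b0 (normr_ge0 _))); rewrite lerD2l.
  have -> : `|u k s x| `^ q = I s * s * s `^ (- (e * q)).
    rewrite /I divfK ?gt_eqF// powRM ?powR_ge0// -powRrM mulrAC -powRD.
      by rewrite subrr powRr0 mul1r.
    by rewrite subrr eqxx gt_eqF.
  have bE : b `^ (1 - q) = t `^ (- e) * t `^ (e * q) * V `^ (1 - q).
    rewrite /b powRM ?powR_ge0 ?(ltW V0)// -powRrM -powRD ?(gt_eqF t0) ?implybT//.
    by congr (_ `^ _ * _); ring.
  have h : s * s `^ (- (e * q)) <= t * (4 `^ (e * q) * t `^ (- (e * q))).
    apply: ler_pM; rewrite ?powR_ge0 ?(ltW s0)//; first by rewrite (le_trans s2)// ler_pdivrMr// ler_pMr// ler1n.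
    have tE : t `^ (e * q) = (t / 4) `^ (e * q) * 4 `^ (e * q).
      by rewrite -powRM ?divfK ?(ltW t40).
    rewrite !powRN tE invfM mulrCA divff ?mulr1 ?gt_eqF ?powR_gt0//.
    rewrite lef_pV2 ?posrE ?powR_gt0// ge0_ler_powR ?nnegrE ?(ltW s0) ?(ltW t40)//.
    by rewrite mulr_ge0// ltW.
  have tt : t `^ (e * q) * t `^ (- (e * q)) = 1 by rewrite -powRD ?subrr ?powRr0// (gt_eqF t0) implybT.
  have -> : c * I s = t `^ (- e) * V `^ (1 - q) * I s * t `^ (e * q) *
      (t * (4 `^ (e * q) * t `^ (- (e * q)))).
    by rewrite /c -[LHS]mulr1 -tt; ring.
  have -> : b `^ (1 - q) * (I s * s * s `^ (- (e * q))) =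
      t `^ (- e) * V `^ (1 - q) * I s * t `^ (e * q) * (s * s `^ (- (e * q))).
    by rewrite bE; ring.
  by rewrite ler_wpM2l// !mulr_ge0 ?powR_ge0// invr_ge0 ltW.
apply: (@le_trans _ _ (\int[lebesgue_measure]_(s in D) (b + c * I s)%:E)%E).
  apply: ge0_le_integral => //.
  - apply/measurable_EFinP; apply: (measurableT_comp (@normr_measurable R setT)).
    by apply: (@measurable_funS _ _ _ _ _ _ _ _ D0) => //; exact: measurable_kernel_deriv_time.
  - apply/measurable_EFinP; apply: measurable_funD => //; apply: measurable_funM => //.
    exact/measurable_EFinP.
have -> : (\int[lebesgue_measure]_(s in D) (b + c * I s)%:E =
    \int[lebesgue_measure]_(s in D) cst b%:E s +
    \int[lebesgue_measure]_(s in D) (c%:E * (I s)%:E))%E.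
  rewrite -ge0_integralD//.
  - by move=> s _; rewrite lee_fin ltW.
  - by move=> s Ds; rewrite mule_ge0 ?lee_fin// I0.
  - exact: measurable_funeM.
have t42 : t / 4 < t / 2 by lra.
have lD : lebesgue_measure D = (t / 4)%:E.
  by rewrite /D lebesgue_measure_itv/= lte_fin t42 -EFinB; congr EFin; lra.
rewrite (integral_cst lebesgue_measure mD) ge0_integralZl// [X in (_ * X + _)%E]lD.
have SI : (\int[lebesgue_measure]_(s in D) (I s)%:E <= (V `^ q)%:E)%E.
  apply: le_trans HV; apply: ge0_subset_integral => //.
    exact: measurable_scale_integrand.
  by move=> s; rewrite /= in_itv/= andbT => s0; rewrite lee_fin divr_ge0 ?powR_ge0// ltW.
apply: (@le_trans _ _ (b * (t / 4) + c * V `^ q)%:E).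
  by rewrite EFinD (EFinM b) (EFinM c (V `^ q)) leeD2l// lee_wpmul2l// lee_fin.
rewrite lee_fin /b /c.
have -> : t `^ (- e) * V `^ (1 - q) * t * 4 `^ (e * q) * V `^ q =
   4 `^ (e * q) * (t * t `^ (- e) * V).
  have -> : t `^ (- e) * V `^ (1 - q) * t * 4 `^ (e * q) * V `^ q =
    4 `^ (e * q) * (t * t `^ (- e) * (V `^ (1 - q) * V `^ q)) by ring.
  by rewrite -powRD ?subrK ?powRr1 ?(ltW V0)// oner_eq0.
rewrite [leRHS]mulrDl mul1r lerD2r.
have -> : t * t `^ (- e) * V = t `^ (- e) * V * t by ring.
by rewrite ler_pM2l//; lra.
Qed.

(** With the window written as an indicator on the whole line, the integrals over s and y form one
    product integral to which Tonelli applies. *)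
Lemma window_integralE k t (c : R) x : 0 < t -> 0 <= c ->
  (c%:E * \int[lebesgue_measure]_(s in `[(t / 4)%R, (t / 2)%R]) `|u k s x|%:E =
  \int[lebesgue_measure]_s (c * (`|u k s x * (0 < s)%R%:R| * (t / 4 <= s <= t / 2)%R%:R))%:E)%E.
Proof.
move=> t0 c0.
have t40 : 0 < t / 4 by rewrite divr_gt0.
have mF : measurable_fun [set: measurableTypeR R] (fun s : measurableTypeR R => (`|u k s x * (0 < s)%R%:R| * (t / 4 <= s <= t / 2)%R%:R)%:E).
  apply/measurable_EFinP; apply: measurable_funM.
    apply: (measurableT_comp (@normr_measurable R setT)).
    exact: (measurableT_comp (measurable_kernel_deriv k) (pair2_measurable (x : X))).
  by apply: measurable_bool_natr; apply: measurable_and; apply: measurable_fun_ler.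
under [RHS]eq_integral do rewrite EFinM.
rewrite ge0_integralZl//=; congr (_ * _)%E.
rewrite integral_mkcond; apply: eq_integral => s _; rewrite patchE.
case: ifPn; rewrite ?inE ?notin_setE/= in_itv/=.
  move=> ss; rewrite ss mulr1; have -> : 0 < s by case/andP: ss => + _; exact: lt_le_trans.
  by rewrite mulr1.
by move/negP/negbTE => ->; rewrite mulr0.
Qed.

Let measurable_window_prod k t : measurable_fun setT
  (fun z : measurableTypeR R * X => `|u k z.1 z.2 * (0 < z.1)%R%:R| * (t / 4 <= z.1 <= t / 2)%R%:R).
Proof.
apply: measurable_funM.
  by apply: (measurableT_comp (@normr_measurable R setT)); exact: measurable_kernel_deriv.
by apply: measurable_bool_natr; apply: measurable_and; apply: measurable_fun_ler.
Qed.

(** [kernel_deriv_le_window] is averaged over the scales s between t / 4 and t / 2. Its operator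
    does not depend on s, so Tonelli moves the average under the kernel, where [window_le] replaces
    it by V for almost every y. The factor 4 is t divided by the length of the window. *)
Lemma kernel_deriv_le_op k m : exists2 C, 0 <= C & forall (a q : R) (V : X -> R) t x,
  0 < t -> 1 <= q -> a <= k%:R -> L1 V -> (forall y, 1 <= V y) ->
  {ae mu, forall y, (scale_integral k a q y <= (V y `^ q)%:E)%E} ->
  t `^ ((k + m)%:R - a) * `|u (k + m) t x| <= C * (1 + 4 `^ ((k%:R - a) * q)) * op (t / 4) V x.
Proof.
have [C C0 HC] := kernel_deriv_le_window HK intf m.
exists (4 * C) => //; first by rewrite mulr_ge0.
move=> a q V t x t0 q1 ak LV V1 Vae.
have t40 : 0 < t / 4 by rewrite divr_gt0.
pose D := `[(t / 4)%R, (t / 2)%R]%classic : set (measurableTypeR R).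
have mD : measurable D by exact: measurable_itv.
have t42 : t / 4 < t / 2 by lra.
have Dpos s : D s -> 0 < s.
  by rewrite /D /= in_itv/= => /andP[+ _]; exact: lt_le_trans.
have lD : lebesgue_measure D = (t / 4)%:E.
  by rewrite /D lebesgue_measure_itv/= lte_fin t42 -EFinB; congr EFin; lra.
set e := k%:R - a; set A := 1 + _; have A0 : 0 <= A by rewrite addr_ge0// powR_ge0.
have Ctm0 : 0 <= C / t ^+ m by rewrite divr_ge0// exprn_ge0// ltW.
pose Kx y := K (t / 4) x y; have Kx0 y : 0 <= Kx y by exact: (K_ge0 HK).
have mKx : measurable_fun setT Kx by exact: (measurable_kernelr HK).
pose F (z : measurableTypeR R * X) :=
  (Kx z.2 * (`|u k z.1 z.2 * (0 < z.1)%R%:R| * (t / 4 <= z.1 <= t / 2)%R%:R))%:E.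
have mF : measurable_fun setT F.
  apply/measurable_EFinP; apply: measurable_funM; last exact: measurable_window_prod.
  exact: (measurableT_comp mKx).
have F0 z : (0 <= F z)%E by rewrite lee_fin !mulr_ge0.
have step1 : ((t / 4 * `|u (k + m) t x|)%:E <= (C / t ^+ m)%:E * \int[lebesgue_measure]_s \int[mu]_y F (s, y))%E.
  have -> : (t / 4 * `|u (k + m) t x|)%:E = (\int[lebesgue_measure]_(s in D) cst `|u (k + m) t x|%:E s)%E.
    by rewrite (integral_cst lebesgue_measure mD) [X in (_ * X)%E]lD EFinM muleC.
  rewrite -ge0_integralZl//; last 2 first.
  - exact: measurable_fun_fubini_tonelli_F.
  - by move=> s _; apply: integral_ge0.
  apply: (@le_trans _ _ (\int[lebesgue_measure]_(s in D) ((C / t ^+ m)%:E * \int[mu]_y F (s, y)))%E); last first.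
    apply: ge0_subset_integral => //.
      by apply: measurable_funeM; exact: measurable_fun_fubini_tonelli_F.
    by move=> s _; rewrite mule_ge0//; exact: integral_ge0.
  apply: ge0_le_integral => //.
    by move=> s _; rewrite lee_fin.
    apply: measurable_funTS.
    by apply: measurable_funeM; exact: measurable_fun_fubini_tonelli_F.
  move=> s Ds; have s0 := Dpos _ Ds.
  have := Ds; rewrite /D /= in_itv/= => ss; have /andP[s1 s2] := ss.
  have -> : (\int[mu]_y F (s, y) = (op (t / 4) (fun y => `|u k s y|) x)%:E)%E.
    rewrite (kernel_opE HK)//; last by apply: integrable_norm; exact: (kernel_deriv_L1 HK).
    by apply: eq_integral => y _; rewrite /F /= s0 ss !mulr1.
  by rewrite lee_fin; exact: HC.
have step2 : (\int[lebesgue_measure]_s \int[mu]_y F (s, y) <=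
    (A * (t * t `^ (- e)) * op (t / 4) V x)%:E)%E.
  rewrite fubini_tonelli//=.
  rewrite EFinM (kernel_opE HK)// -integralZl//; last exact: (kernel_op_integrable HK).
  apply: ae_ge0_le_integral => //.
  - by move=> y _; apply: integral_ge0.
  - exact: measurable_fun_fubini_tonelli_G.
  - by move=> y _; rewrite lee_fin !mulr_ge0 ?powR_ge0 ?(ltW t0)// (le_trans ler01).
  - apply/measurable_EFinP; apply: measurable_funM => //; apply: measurable_funM => //.
    exact: (L1_measurable LV).
  - apply: filterS Vae => y Vy _.
    rewrite /F /= -window_integralE//.
    apply: (@le_trans _ _ ((Kx y)%:E * (A * (t * t `^ (- e) * V y))%:E)%E).
      apply: lee_wpmul2l; first by rewrite lee_fin.
      exact: window_le.
    by rewrite -EFinM lee_fin le_eqVlt; apply/orP; left; apply/eqP; rewrite /Kx; ring.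
have : t / 4 * `|u (k + m) t x| <= C / t ^+ m * (A * (t * t `^ (- e)) * op (t / 4) V x).
  rewrite -lee_fin; apply: (le_trans step1); rewrite [leRHS](EFinM (C / t ^+ m)).
  by apply: lee_wpmul2l => //; rewrite lee_fin.
set o := op _ _ _; set w := `|_|.
have tm0 : 0 < t ^+ m by rewrite exprn_gt0.
have te0 : 0 < t `^ e by rewrite powR_gt0.
have -> : t `^ ((k + m)%:R - a) = t ^+ m * t `^ e.
  rewrite natrD addrAC -/e addrC powRD ?(gt_eqF t0) ?implybT// powR_mulrn//.
  exact: ltW.
move=> h.
have -> : t ^+ m * t `^ e * w = (4 * t ^+ m * t `^ e / t) * (t / 4 * w).
  by field; rewrite gt_eqF.
have -> : 4 * C * A * o = (4 * t ^+ m * t `^ e / t) * (C / t ^+ m * (A * (t * t `^ (- e)) * o)).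
  by rewrite powRN; field; rewrite !gt_eqF.
by rewrite ler_wpM2l// divr_ge0 ?mulr_ge0// ltW.
Qed.

End Lp_contraction.

(** * Change of variables and integration over the half-line *)

Section affine_change_of_variables.
Context {R : realType}.
Variables (c e : R).
Hypothesis c0 : 0 < c.

Definition affine_map (t : measurableTypeR R) : measurableTypeR R := c * t + e.

Lemma measurable_affine_map : measurable_fun setT affine_map.
Proof. by apply: measurable_funD => //; exact: measurable_funM. Qed.

Let cnn : {nonneg R} := NngNum (ltW c0).

Let nu : set (measurableTypeR R) -> \bar R :=
  mscale cnn (measure_function_pushforward__canonical__measure_function_Measure
    (@lebesgue_measure R) measurable_affine_map).

HB.instance Definition _ := Measure.on nu.

Lemma lebesgue_measure_affine (A : set (measurableTypeR R)) : measurable A ->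
  lebesgue_measure A = nu A.
Proof.
apply: lebesgue_measure_unique => _ [[a b]] _ <-.
rewrite -[RHS]/(c%:E * lebesgue_measure (affine_map @^-1` `]a, b]))%E.
rewrite (_ : affine_map @^-1` _ = `](a - e) / c, (b - e) / c]%classic); last first.
  apply/seteqP; split => t /=; rewrite /affine_map !in_itv/=;
  by rewrite ltr_pdivrMr// ler_pdivlMr// ltrBlDr lerBrDr [t * c]mulrC.
rewrite !lebesgue_measure_itv/= !lte_fin ltr_pM2r ?invr_gt0// ltrD2r.
case: ifPn => _; last by rewrite mule0.
by rewrite -!EFinB -EFinM; congr EFin; field; rewrite gt_eqF.
Qed.

Lemma ge0_integral_affine (D : set (measurableTypeR R)) (f : measurableTypeR R -> \bar R) :
  measurable D -> measurable_fun D f -> (forall t, D t -> (0 <= f t)%E) ->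
  (\int[lebesgue_measure]_(t in D) f t =
   c%:E * \int[lebesgue_measure]_(t in affine_map @^-1` D) f (affine_map t))%E.
Proof.
move=> mD mf f0.
rewrite (eq_measure_integral nu); last by move=> A mA _; exact: lebesgue_measure_affine.
rewrite ge0_integral_mscale//; congr (_ * _)%E.
rewrite (ge0_integral_pushforward measurable_affine_map)// => y.
by rewrite inE; exact: f0.
Qed.

End affine_change_of_variables.

Lemma ge0_integral_dilation (R : realType) (c : R) (f : measurableTypeR R -> \bar R) : 0 < c ->
  measurable_fun (`]0%R, +oo[%classic : set (measurableTypeR R)) f -> (forall t, 0 < t -> (0 <= f t)%E) ->
  (\int[lebesgue_measure]_(t in `]0%R, +oo[) (f (c * t)%R * (t^-1)%:E) =
   \int[lebesgue_measure]_(t in `]0%R, +oo[) (f t * (t^-1)%:E))%E.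
Proof.
move=> c0 mf f0; pose D := `]0%R, +oo[%classic : set (measurableTypeR R).
have mD : measurable D by exact: measurable_itv.
have D0 t : D t -> 0 < t by rewrite /D /= in_itv/= andbT.
have mV : measurable_fun D (fun t : R => (t^-1)%:E).
  apply/measurable_EFinP; apply: open_continuous_measurable_fun; first exact: interval_open.
  by move=> s; rewrite inE => /D0 s0; apply: inv_continuous; rewrite gt_eqF.
have maff : measurable_fun D (affine_map c 0) by apply: measurable_funTS; exact: measurable_affine_map.
have Dc t : D t -> D (affine_map c 0 t).
  by rewrite /affine_map addr0 /D /= !in_itv/= !andbT; exact: mulr_gt0.
have mfc : measurable_fun D (fun t => f (c * t)).
  have := @measurable_comp _ _ _ _ _ _ D f D (affine_map c 0) mD _ mf maff.
  move=> /(_ _)/wrap[]; first by move=> _ [t Dt <-]; exact: Dc.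
  by apply: eq_measurable_fun => t _ /=; rewrite /affine_map addr0.
have V0 t : D t -> (0 <= (t^-1)%:E)%E by move=> /D0 t0; rewrite lee_fin invr_ge0 ltW.
rewrite [RHS](ge0_integral_affine 0 c0 mD); last 2 first.
- exact: emeasurable_funM.
- by move=> t Dt; rewrite mule_ge0 ?V0// f0// D0.
have -> : affine_map c 0 @^-1` D = D.
  apply/seteqP; split => t; last exact: Dc.
  by rewrite /affine_map /D /= addr0 !in_itv/= !andbT pmulr_rgt0.
rewrite -ge0_integralZl//.
- apply: eq_integral => t; rewrite inE => /D0 t0.
  have -> : affine_map c 0 t = c * t by rewrite /affine_map addr0.
  rewrite muleCA (_ : c%:E * _ = (t^-1)%:E)%E//.
  by rewrite -EFinM invfM mulrA divff ?gt_eqF// mul1r.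
- apply: emeasurable_funM.
    by apply: eq_measurable_fun mfc => t _; rewrite /affine_map addr0.
  have := @measurable_comp _ _ _ _ _ _ D (fun t : R => (t^-1)%:E) D (affine_map c 0) mD _ mV maff.
  by move=> /(_ _)/wrap[] // _ [t Dt <-]; exact: Dc.
- by move=> t Dt; rewrite mule_ge0 ?V0 ?f0//; [exact/D0/Dc|exact: Dc].
- by rewrite lee_fin ltW.
Qed.

Section open_interval_FTC.
Context {R : realType}.

(** The primitive is only required to converge along the chosen end points; for the convolution of
    stable densities these are picked so that the primitive is explicit there. *)
Lemma ge0_FTC_bigcup (f F : R -> R) (x_ y_ : nat -> R) (l m : R) (D : set R) :
  D = \bigcup_n `[x_ n, y_ n]%classic ->
  (forall n, x_ n.+1 <= x_ n) -> (forall n, y_ n <= y_ n.+1) -> (forall n, x_ n < y_ n) ->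
  (forall t, D t -> 0 <= f t) -> (forall t, D t -> {for t, continuous f}) ->
  (forall t, D t -> is_derive t 1 F (f t)) ->
  F (y_ n) @[n --> \oo] --> l -> F (x_ n) @[n --> \oo] --> m ->
  (\int[lebesgue_measure]_(t in D) (f t)%:E = (l - m)%:E)%E.
Proof.
move=> DE xn yn xy f0 cf dF Fl Fm.
have Dn n t : `[x_ n, y_ n]%classic t -> D t by move=> ?; rewrite DE; exists n.
have Dx n : D (x_ n) by apply: (Dn n); rewrite /= in_itv/= lexx ltW.
have Dy n : D (y_ n) by apply: (Dn n); rewrite /= in_itv/= lexx andbT ltW.
have I n : (\int[lebesgue_measure]_(t in `[x_ n, y_ n]) (f t)%:E = (F (y_ n) - F (x_ n))%:E)%E.
  rewrite EFinB; apply: continuous_FTC2 => //.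
  - apply: continuous_in_subspaceT => t /set_mem tn; exact: cf (Dn n t tn).
  - split.
    + move=> t tn; have [] := dF t _ => //; apply: (Dn n); exact: subset_itv_oo_cc tn.
    + apply: cvg_at_right_filter; apply/differentiable_continuous/derivable1_diffP.
      by have [] := dF (x_ n) (Dx n).
    + apply: cvg_at_left_filter; apply/differentiable_continuous/derivable1_diffP.
      by have [] := dF (y_ n) (Dy n).
  - move=> t tn; have := dF t _; rewrite derive1E => h; apply: derive_val; apply: h.
    apply: (Dn n); exact: subset_itv_oo_cc tn.
have nd : nondecreasing_seq (fun n => `[x_ n, y_ n]%classic : set (measurableTypeR R)).
  apply/nondecreasing_seqP => n; rewrite subsetEset => t /=.
  by rewrite !in_itv/= => /andP[h1 h2]; rewrite (le_trans (xn n))// (le_trans h2).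
have mf n : measurable_fun (`[x_ n, y_ n]%classic : set (measurableTypeR R)) (fun t => (f t)%:E).
  apply/measurable_EFinP; apply: subspace_continuous_measurable_fun => //.
  by apply: continuous_in_subspaceT => t /set_mem tn; exact: cf (Dn n t tn).
have := @ge0_nondecreasing_set_cvg_integral _ (measurableTypeR R) R
  (fun n => `[x_ n, y_ n]%classic) (fun t => (f t)%:E) lebesgue_measure nd (fun n => measurable_itv _) mf.
move=> /(_ (fun n t tn => f0 t (Dn n t tn))).
rewrite -DE => cvg1.
have cvg2 : (\int[lebesgue_measure]_(t in `[x_ n, y_ n]) (f t)%:E)%E @[n --> \oo] --> (l - m)%:E.
  under eq_fun do rewrite I.
  by apply: cvg_EFin; [exact: nearW|exact: cvgB].
exact: (cvg_unique _ cvg1 cvg2).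
Qed.

End open_interval_FTC.

Lemma integral_powR_interpolate d (T : measurableType d) (R : realType)
    (mu : {measure set T -> \bar R}) (D : set T) (F G : T -> R) (lam : R) :
  measurable D -> measurable_fun D F -> measurable_fun D G ->
  (forall x, D x -> 0 <= F x) -> (forall x, D x -> 0 <= G x) -> 0 < lam -> lam < 1 ->
  (\int[mu]_(x in D) (F x `^ lam * G x `^ (1 - lam))%:E <=
   (\int[mu]_(x in D) (F x)%:E) `^ lam * (\int[mu]_(x in D) (G x)%:E) `^ (1 - lam))%E.
Proof.
move=> mD mF mG F0 G0 l0 l1.
have l10 : 0 < 1 - lam by rewrite subr_gt0.
pose f := (fun x => F x `^ lam) \_ D; pose g := (fun x => G x `^ (1 - lam)) \_ D.
have mf : measurable_fun setT f.
  by apply/(measurable_restrictT _ mD); exact: (measurableT_comp (measurable_powR _)).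
have mg : measurable_fun setT g.
  by apply/(measurable_restrictT _ mD); exact: (measurableT_comp (measurable_powR _)).
have := @hoelder _ _ _ mu f g lam^-1 (1 - lam)^-1 mf mg.
have lE : lam + (1 - lam) = 1 by rewrite addrC subrK.
rewrite !invr_gt0 !invrK => /(_ l0 l10 lE).
rewrite Lnorm1 unlock !invrK.
rewrite [X in (X <= _)%E -> _](_ : _ = \int[mu]_(x in D) (F x `^ lam * G x `^ (1 - lam))%:E)%E; last first.
  rewrite [RHS]integral_mkcond; apply: eq_integral => x _.
  rewrite /f /g /= !patchE; case: ifPn => xD; last by rewrite mul0r normr0.
  by rewrite ger0_norm ?mulr_ge0 ?powR_ge0.
rewrite [X in (_ <= X `^ _ * _)%E -> _](_ : _ = \int[mu]_(x in D) (F x)%:E)%E; last first.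
  rewrite [RHS]integral_mkcond; apply: eq_integral => x _.
  rewrite /f /= !patchE; case: ifPn => xD; last by rewrite normr0 powR0// invr_eq0 gt_eqF.
  by rewrite ger0_norm ?powR_ge0// -powRrM divff ?gt_eqF// powRr1// F0// -inE.
rewrite [X in (_ <= _ * X `^ _)%E -> _](_ : _ = \int[mu]_(x in D) (G x)%:E)%E//.
rewrite [RHS]integral_mkcond; apply: eq_integral => x _.
rewrite /g /= !patchE; case: ifPn => xD; last by rewrite normr0 powR0// invr_eq0 gt_eqF.
by rewrite ger0_norm ?powR_ge0// -powRrM divff ?gt_eqF// powRr1// G0// -inE.
Qed.

(* A function vanishing at infinity is recovered from a power bound on its derivative: both [w - c t^-b] and [-w - c t^-b] are nondecreasing. *)
Lemma is_derive_powR (R : realType) (a t : R) : 0 < t ->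
  is_derive t (1 : R) (fun s : R => s `^ a) (a * t `^ (a - 1)).
Proof.
move=> t0; have tI : t \in `]0, +oo[ by rewrite in_itv/= andbT.
apply: DeriveDef; first exact: derivable_powR.
by rewrite -derive1E (powR_derive1 a tI).
Qed.

Lemma cvg_powR_pinfty (R : realType) (b : R) : 0 < b -> t `^ (- b) @[t --> +oo%R] --> (0 : R).
Proof.
move=> b0; apply/cvgrPdist_lt => e e0; near=> t.
have t0 : 0 < t by near: t; exact: nbhs_pinfty_gt.
rewrite sub0r normrN ger0_norm ?powR_ge0// powRN invf_plt ?posrE ?powR_gt0//.
have te : e^-1 `^ b^-1 < t by near: t; exact: nbhs_pinfty_gt.
have := @gt0_ltr_powR _ _ b0 (e^-1 `^ b^-1) t.
rewrite !nnegrE powR_ge0 (ltW t0) -powRrM mulVf ?gt_eqF// powRr1 ?invr_ge0 ?ltW//.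
by move=> /(_ erefl erefl te).
Unshelve. all: by end_near. Qed.

Lemma le_powR_of_derivative (R : realType) (w dw : R -> R) (A b B c : R) : 0 < b -> 0 <= A ->
  (forall t : R, 0 < t -> is_derive t (1 : R) w (dw t)) ->
  (forall t, 0 < t -> `|dw t| <= A * t `^ (- b - 1)) ->
  0 < c -> (forall t, 0 < t -> `|w t| <= B * t `^ (- c)) ->
  forall t, 0 < t -> `|w t| <= A / b * t `^ (- b).
Proof.
move=> b0 A0 Dw dwA c0 wB.
suff key (v dv : R -> R) : (forall t : R, 0 < t -> is_derive t (1 : R) v (dv t)) ->
    (forall t, 0 < t -> `|dv t| <= A * t `^ (- b - 1)) ->
    (forall t, 0 < t -> v t <= B * t `^ (- c)) ->
    forall t, 0 < t -> v t <= A / b * t `^ (- b).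
  move=> t t0; rewrite ler_norml lerNl; apply/andP; split.
    apply: (key (\- w) (\- dw)) => // s s0.
    - by have ds := Dw _ s0; exact: is_deriveN.
    - by rewrite normrN; exact: dwA.
    - by rewrite (le_trans _ (wB _ s0))//= -normrN ler_norm.
  by apply: (key w dw) => // s s0; rewrite (le_trans _ (wB _ s0))// ler_norm.
move=> Dv dvA vB t t0.
pose W s := v s - A / b * s `^ (- b).
have DW (s : R) : 0 < s -> is_derive s (1 : R) W (dv s + A * s `^ (- b - 1)).
  move=> s0; have d1 := Dv _ s0; have d2 := is_derive_powR (- b) s0.
  have -> : dv s + A * s `^ (- b - 1) = dv s - (A / b) *: (- b * s `^ (- b - 1)).
    by rewrite /GRing.scale /=; field; rewrite gt_eqF.
  by apply: is_deriveB.
have Wmono T : t <= T -> W t <= W T.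
  have half0 : 0 < t / 2 by rewrite divr_gt0.
  move=> tT; apply: (@ger0_derive1_ndecry _ W (t / 2)) => //; last first.
  - by rewrite ler_pdivrMr// ler_pMr// ler1n.
  - apply: derivable_within_continuous => s; rewrite in_itv/= andbT => hs.
    by have [] := DW s (lt_le_trans half0 hs).
  - move=> s; rewrite in_itv/= andbT => hs; have s0 := lt_trans half0 hs.
    have d1 := DW s s0; rewrite derive1E derive_val.
    by rewrite -lerBlDr sub0r; have := dvA _ s0; rewrite ler_norml => /andP[].
  - move=> s; rewrite in_itv/= andbT => hs.
    by have [] := DW s (lt_trans half0 hs).
rewrite -subr_le0 -/(W t).
(* The decay of exponent c is used only here: W(T) is at most B T^(-c), which tends to 0, so B
   leaves no trace in the bound. *)
have B0 : B * s `^ (- c) @[s --> +oo%R] --> (0 : R).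
  by rewrite -(mulr0 B); apply: cvgM; [exact: cvg_cst|exact: cvg_powR_pinfty].
apply: (@ler_cvg_to _ _ _ _ (cst (W t)) (fun s => B * s `^ (- c)) _ _ (cvg_cst _) B0).
near=> s; have ts : t <= s by near: s; apply: nbhs_pinfty_ge; exact: num_real.
rewrite (le_trans (Wmono _ ts))// lerBlDr (le_trans (vB _ (lt_le_trans t0 ts)))// lerDl.
by rewrite mulr_ge0 ?powR_ge0// divr_ge0// ltW.
Unshelve. all: by end_near. Qed.

Lemma itv0y_bigcup (R : realType) :
  `]0%R, +oo[%classic = \bigcup_n `[(n.+2%:R^-1 : R), n.+2%:R]%classic.
Proof.
apply/seteqP; split => t; rewrite /= in_itv/= ?andbT.
  move=> t0; exists (maxn (Num.truncn t) (Num.truncn t^-1)) => //=; rewrite in_itv/=.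
  apply/andP; split.
    rewrite invf_ple ?posrE// ltW// (lt_le_trans (truncnS_gt _))// ler_nat ltnS.
    by rewrite leqW// leq_maxr.
  by rewrite ltW// (lt_le_trans (truncnS_gt _))// ler_nat ltnS leqW// leq_maxl.
by move=> [n _] /=; rewrite in_itv/= => /andP[+ _]; apply: lt_le_trans; rewrite invr_gt0.
Qed.

Lemma ge0_FTC_itv0y (R : realType) (f F : R -> R) (l m : R) :
  (forall t, 0 < t -> 0 <= f t) -> (forall t : R, 0 < t -> {for t, continuous f}) ->
  (forall t : R, 0 < t -> is_derive t (1 : R) F (f t)) ->
  F t @[t --> +oo%R] --> l -> F t @[t --> 0^'+] --> m ->
  (\int[lebesgue_measure]_(t in `]0%R, +oo[) (f t)%:E = (l - m)%:E)%E.
Proof.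
move=> f0 cf dF Fl Fm.
have n2 n : n.+2%:R^-1 < n.+2%:R :> R.
  by rewrite (@lt_trans _ _ 1)// ?ltr1n// invf_lt1// ltr1n.
have cvg_n2 : n.+2%:R @[n --> \oo] --> (+oo%R : set_system R).
  apply/cvgryPge => A; near=> n.
  have An : A <= n%:R by near: n; exact: nbhs_infty_ger.
  by rewrite (le_trans An)// ler_nat leqW// leqW.
apply: (@ge0_FTC_bigcup _ f F (fun n => n.+2%:R^-1) (fun n => n.+2%:R)) => //.
- exact: itv0y_bigcup.
- by move=> n; rewrite lef_pV2 ?posrE// ler_nat.
- by move=> n; rewrite ler_nat.
- by move=> t; rewrite /= in_itv/= andbT; exact: f0.
- by move=> t; rewrite /= in_itv/= andbT; exact: cf.
- by move=> t; rewrite /= in_itv/= andbT; exact: dF.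
- exact: (@cvg_comp _ _ _ (fun n : nat => n.+2%:R) F _ _ _ cvg_n2 Fl).
- apply: (cvg_at_rightP F 0 m).1 Fm _ _; split; first by move=> n; rewrite invr_gt0.
  by have := @cvg_harmonic R; rewrite -(cvg_shiftS (@harmonic R)).
Unshelve. all: by end_near. Qed.

(* The two power bounds cross at [tau = (B/A)^(1/(2 eps))], where both equal [sqrt (A B)]. *)
Lemma le_min_quotient (R : realFieldType) (y : R) : 0 < y ->
  (y <= 1 -> y <= 4 * y / (1 + y) ^+ 2) /\ (1 < y -> y^-1 <= 4 * y / (1 + y) ^+ 2).
Proof.
move=> y0; have y2 : 0 < (1 + y) ^+ 2 by rewrite exprn_gt0// addr_gt0.
split=> y1; rewrite ler_pdivlMr//.
  by rewrite mulrC ler_pM2r// expr2; nra.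
by rewrite mulrC ler_pdivrMr// expr2; nra.
Qed.

Lemma ge0_integral_min_powR (R : realType) (eps q : R) : 0 < eps -> 0 < q ->
  exists2 C : R, 0 <= C & forall (A B : R) (phi : measurableTypeR R -> R), 0 < A -> 0 < B ->
  measurable_fun (`]0%R, +oo[%classic : set (measurableTypeR R)) phi ->
  (forall t : R, 0 < t -> 0 <= phi t) ->
  (forall t : R, 0 < t -> phi t <= A * t `^ eps) ->
  (forall t : R, 0 < t -> phi t <= B * t `^ (- eps)) ->
  (\int[lebesgue_measure]_(t in `]0%R, +oo[) (phi t `^ q / t)%:E <=
     (C * (A * B) `^ (q / 2))%:E)%E.
Proof.
move=> e0 q0; pose a := eps * q; have a0 : 0 < a by rewrite mulr_gt0.
pose D := `]0%R, +oo[%classic : set (measurableTypeR R).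
have mD : measurable D by exact: measurable_itv.
have D0 t : D t -> 0 < t by rewrite /D /= in_itv/= andbT.
(* With y = t^a, min(y, 1/y) <= 4y / (1+y)^2, and y / (t (1+y)^2) is f / a. Since f is the
   derivative of -1 / (1 + t^a), its integral is 1, whence the constant 4 / a. *)
pose f (t : R) := a * t `^ (a - 1) / (1 + t `^ a) ^+ 2.
have p1 (t : R) : 0 < 1 + t `^ a by rewrite ltr_pwDl// powR_ge0.
have f0 (t : R) : 0 < t -> 0 <= f t.
  by move=> t0; rewrite divr_ge0 ?exprn_ge0 ?mulr_ge0 ?powR_ge0 ?ltW.
have cpow (b t : R) : 0 < t -> {for t, continuous (fun s : R => s `^ b)}.
  move=> t0; apply/differentiable_continuous/derivable1_diffP.
  by have [] := is_derive_powR b t0.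
have cf (t : R) : 0 < t -> {for t, continuous f}.
  move=> t0; apply: cvgM; first by apply: cvgM; [exact: cvg_cst|exact: cpow].
  apply: cvgV; first by rewrite expf_neq0// gt_eqF.
  apply: (@cvg_comp _ _ _ (fun s : R => 1 + s `^ a) (fun y => y ^+ 2) _ (nbhs (1 + t `^ a))).
    by apply: cvgD; [exact: cvg_cst|exact: cpow].
  exact: exprn_continuous.
have If : (\int[lebesgue_measure]_(t in D) (f t)%:E = (0 - (- 1))%:E)%E.
  apply: (@ge0_FTC_itv0y _ f (fun t => - (1 + t `^ a)^-1)) => //.
  - move=> t t0; have d1 := is_derive_powR a t0.
    have d2 : is_derive t (1 : R) (fun s : R => 1 + s `^ a) (0 + a * t `^ (a - 1)).
      exact: is_deriveD.
    have p0 : 1 + t `^ a != 0 by rewrite gt_eqF.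
    have d3 := @is_deriveV R (fun s : R => 1 + s `^ a) t _ (1 : R) p0 d2.
    have -> : f t = - (- (1 + t `^ a) ^- 2 *: (0 + a * t `^ (a - 1))).
      by rewrite /f /GRing.scale /= add0r mulNr opprK mulrC.
    exact: is_deriveN.
  - apply: (@squeeze_cvgr _ _ _ _ (fun t => - t `^ (- a)) (cst 0)).
    + near=> t; have t0 : 0 < t by near: t; exact: nbhs_pinfty_gt.
      rewrite lerN2 /= oppr_le0 invr_ge0 (ltW (p1 t)) andbT powRN.
      by rewrite lef_pV2 ?posrE ?powR_gt0// lerDr.
    + by rewrite -[X in _ --> X]oppr0; apply: cvgN; exact: cvg_powR_pinfty.
    + exact: cvg_cst.
  - have -> : -1 = - (1 + 0)^-1 :> R by rewrite addr0 invr1.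
    apply: cvgN; apply: cvgV; first by rewrite addr0 oner_neq0.
    by apply: cvgD; [exact: cvg_cst|exact: powR_cvg0].
exists (4 / a); first by rewrite divr_ge0// ltW.
move=> A B phi A0 B0 mphi phi0 phiA phiB.
pose tau := (B / A) `^ (2 * eps)^-1.
have tau0 : 0 < tau by rewrite powR_gt0// divr_gt0.
pose S := (A * B) `^ 2^-1.
have taue : tau `^ eps = (B / A) `^ 2^-1.
  by rewrite /tau -powRrM; congr (_ `^ _); field; rewrite gt_eqF.
have AS : A * tau `^ eps = S.
  rewrite taue /S (_ : A * B = A ^+ 2 * (B / A)); last by field; rewrite gt_eqF.
  rewrite [RHS]powRM ?exprn_ge0 ?divr_ge0 ?(ltW A0) ?(ltW B0)//; congr (_ * _).
  by rewrite -powR_mulrn ?(ltW A0)// -powRrM mulfV// powRr1// ltW.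
have BS : B * tau `^ (- eps) = S.
  rewrite -AS powRN; have te0 : tau `^ eps != 0 by rewrite gt_eqF// powR_gt0.
  apply: (mulIf te0); rewrite divfK// -mulrA -expr2 taue -powR_mulrn ?powR_ge0// -powRrM.
  by rewrite mulVf// powRr1 ?divr_ge0 ?ltW// mulrC divfK// gt_eqF.
have mphiq : measurable_fun D (fun t => (phi t `^ q)%:E).
  by apply/measurable_EFinP; exact: (measurableT_comp (measurable_powR q)).
(* The measure dt / t is invariant under dilation, so the crossing point tau may be moved to 1;
   there both bounds read S t^(eps) and S t^(-eps). *)
have -> : (\int[lebesgue_measure]_(t in D) (phi t `^ q / t)%:E =
   \int[lebesgue_measure]_(t in D) (phi (tau * t) `^ q / t)%:E)%E.
  under eq_integral do rewrite EFinM.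
  rewrite -(ge0_integral_dilation tau0 mphiq)//.
  by move=> t t0; rewrite lee_fin powR_ge0.
have mpt : measurable_fun D (fun t => (phi (tau * t) `^ q / t)%:E).
  have maff : measurable_fun D (affine_map tau 0).
    by apply: measurable_funTS; exact: measurable_affine_map.
  have := @measurable_comp _ _ _ _ _ _ D phi D (affine_map tau 0) mD _ mphi maff.
  move=> /(_ _)/wrap[].
    by move=> _ [t /D0 t0 <-]; rewrite /affine_map addr0 /D /= in_itv/= andbT mulr_gt0.
  move=> mpaff; apply/measurable_EFinP; apply: measurable_funM.
    apply: (measurableT_comp (measurable_powR q)).
    by apply: eq_measurable_fun mpaff => t _; rewrite /= /affine_map addr0.
  apply: open_continuous_measurable_fun; first exact: interval_open.
  by move=> s; rewrite inE => /D0 s0; apply: inv_continuous; rewrite gt_eqF.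
have mf : measurable_fun D (fun t => (f t)%:E).
  apply/measurable_EFinP; apply: open_continuous_measurable_fun; first exact: interval_open.
  by move=> s; rewrite inE => /D0; exact: cf.
apply: (@le_trans _ _ (\int[lebesgue_measure]_(t in D) ((4 / a * (A * B) `^ (q / 2))%:E * (f t)%:E))%E).
  apply: ge0_le_integral => //.
  - by move=> t /D0 t0; rewrite lee_fin divr_ge0 ?powR_ge0// ltW.
  - exact: measurable_funeM.
  move=> t /D0 t0; rewrite lee_fin.
  have tt0 : 0 < tau * t by rewrite mulr_gt0.
  have h1 : phi (tau * t) <= S * t `^ eps.
    by rewrite (le_trans (phiA _ tt0))// powRM ?(ltW tau0) ?(ltW t0)// mulrA AS.
  have h2 : phi (tau * t) <= S * t `^ (- eps).
    by rewrite (le_trans (phiB _ tt0))// powRM ?(ltW tau0) ?(ltW t0)// mulrA BS.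
  have S0 : 0 <= S by exact: powR_ge0.
  have Sq : S `^ q = (A * B) `^ (q / 2) by rewrite /S -powRrM [q / 2]mulrC.
  have k1 : phi (tau * t) `^ q <= S `^ q * t `^ a.
    apply: (le_trans (ge0_ler_powR (ltW q0) _ _ h1)); rewrite ?nnegrE ?mulr_ge0 ?powR_ge0 ?phi0//.
    by rewrite powRM ?powR_ge0// -powRrM.
  have k2 : phi (tau * t) `^ q <= S `^ q * (t `^ a)^-1.
    apply: (le_trans (ge0_ler_powR (ltW q0) _ _ h2)); rewrite ?nnegrE ?mulr_ge0 ?powR_ge0 ?phi0//.
    by rewrite powRM ?powR_ge0// -powRrM mulNr powRN.
  have y0 : 0 < t `^ a by rewrite powR_gt0.
  have fE : 4 / a * (A * B) `^ (q / 2) * f t = S `^ q * (4 * t `^ a / (1 + t `^ a) ^+ 2) / t.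
    rewrite -Sq /f -(mulr_powRB1 (ltW t0) a0); field.
    by rewrite (mulr_powRB1 (ltW t0) a0) !gt_eqF.
  rewrite fE ler_pM2r ?invr_gt0//.
  have Sq0 : 0 <= S `^ q by exact: powR_ge0.
  have [y1|y1] := leP (t `^ a) 1.
    by apply: (le_trans k1); rewrite ler_wpM2l// (le_min_quotient y0).1.
  by apply: (le_trans k2); rewrite ler_wpM2l// (le_min_quotient y0).2.
rewrite ge0_integralZl//.
- by rewrite If -EFinM lee_fin sub0r opprK mulr1.
- by move=> t /D0 t0; rewrite lee_fin f0.
- by rewrite lee_fin mulr_ge0 ?powR_ge0// divr_ge0// ltW.
Unshelve. all: by end_near. Qed.

(** A weighted geometric mean is at most the larger of its terms. The weights are dropped because
    only finiteness is wanted in the applications. *)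
Lemma le_powR_mulD (R : realType) (x y k : R) : 0 <= x -> 0 <= y -> 0 < k -> k < 1 ->
  x `^ k * y `^ (1 - k) <= x + y.
Proof.
move=> x0 y0 k0 k1; wlog xy : x y k x0 y0 k0 k1 / x <= y.
  move=> W; have [xy|yx] := leP x y; first exact: W.
  rewrite [leLHS]mulrC [leRHS]addrC; have := W y x (1 - k); rewrite subKr; apply; rewrite ?subr_gt0 ?(ltW yx)//.
  by rewrite ltrBlDr ltrDl.
have yk : y = y `^ k * y `^ (1 - k).
  have [->|yn0] := eqVneq y 0; first by rewrite !powR0 ?mul0r// gt_eqF ?subr_gt0.
  by rewrite -powRD ?yn0 ?implybT// addrC subrK powRr1.
apply: (@le_trans _ _ y); last by rewrite lerDr.
by rewrite [leRHS]yk ler_wpM2r ?powR_ge0// ge0_ler_powR ?nnegrE// ltW.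
Qed.

Lemma lee_poweR_mulD (R : realType) (x y : \bar R) (k : R) : (0 <= x)%E -> (0 <= y)%E -> 0 < k -> k < 1 ->
  (x `^ k * y `^ (1 - k) <= x + y)%E.
Proof.
move: x y => [x||] [y||]// x0 y0 k0 k1.
- by rewrite !poweR_EFin -EFinM -EFinD lee_fin le_powR_mulD// -lee_fin.
- by rewrite addey// leey.
- by rewrite addye// leey.
- by rewrite addye// leey.
Qed.

Lemma lee_poweR_weighted (R : realType) (x y : \bar R) (r s k : R) :
  (0 <= x)%E -> (0 <= y)%E -> 0 < k -> k < 1 ->
  (x `^ (r * k) * y `^ (s * (1 - k)) <= x `^ r + y `^ s)%E.
Proof. by move=> x0 y0 k0 k1; rewrite !poweRrM; apply: lee_poweR_mulD k0 k1; exact: poweR_ge0. Qed.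

(** * Pointwise control of derivatives by functions of L^p *)

Section maximal_bounds.
Context {d} {X : measurableType d} {R : realType}.
Variables (mu : probability X R) (K : R -> X -> X -> R).
Hypothesis HK : poisson_kernel_spec mu K.
Implicit Types (s t : R) (x y : X).
Local Notation op := (kernel_op mu K).
Local Notation L1 f := (mu.-integrable setT (EFin \o f)).

Lemma integral_powR_affine_lty p c (g : X -> R) : 0 <= p -> 0 <= c ->
  measurable_fun setT g -> (forall x, 0 <= g x) ->
  (\int[mu]_x (g x `^ p)%:E < +oo)%E -> (\int[mu]_x ((1 + c * g x) `^ p)%:E < +oo)%E.
Proof.
move=> p0 c0 mg g0 gp.
have mgp : measurable_fun setT (fun x => g x `^ p) by exact: (measurableT_comp (measurable_powR p)).
apply: (@le_lt_trans _ _ (\int[mu]_x ((2 `^ p)%:E * (1 + (c `^ p)%:E * (g x `^ p)%:E)))%E).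
  apply: ge0_le_integral => //.
  - by move=> x _; rewrite lee_fin powR_ge0.
  - apply/measurable_EFinP; apply: (measurableT_comp (measurable_powR p)).
    by apply: measurable_funD => //; exact: measurable_funM.
  - apply/measurable_EFinP.
    apply: measurable_funM => //; apply: measurable_funD => //; exact: measurable_funM.
  move=> x _; rewrite lee_fin -powRM//.
  have gx : 0 <= c * g x by rewrite mulr_ge0.
  have [h|h] := leP (c * g x) 1.
    apply: (@le_trans _ _ (2 `^ p)).
      by rewrite ge0_ler_powR ?nnegrE ?addr_ge0// -lerBrDl (le_trans h)// lerBrDl -natr1 lerD2l.
    by rewrite ler_peMr ?powR_ge0// lerDl powR_ge0.
  apply: (@le_trans _ _ ((2 * (c * g x)) `^ p)).
    by rewrite ge0_ler_powR ?nnegrE ?mulr_ge0 ?addr_ge0//; lra.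
  by rewrite [leLHS]powRM// ler_wpM2l ?powR_ge0// lerDr.
rewrite ge0_integralZl//; first last.
- by move=> x _; rewrite lee_fin addr_ge0// mulr_ge0 ?powR_ge0.
- apply/measurable_EFinP; apply: measurable_funD => //; exact: measurable_funM.
rewrite lte_mul_pinfty ?lee_fin ?powR_ge0// ge0_integralD//; first last.
- by apply/measurable_EFinP; exact: measurable_funM.
- by move=> x _; rewrite lee_fin mulr_ge0 ?powR_ge0.
rewrite lte_add_pinfty//.
  by have := integral_cst mu (@measurableT _ X) 1 => /= ->; rewrite probability_setT mule1 ltry.
rewrite ge0_integralZl//; last by rewrite lee_fin powR_ge0.
- by rewrite lte_mul_pinfty ?lee_fin ?powR_ge0.
- exact/measurable_EFinP.
- by move=> x _; rewrite lee_fin powR_ge0.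
Qed.

Variable f : X -> R.
Hypothesis intf : L1 f.
Local Notation u := (kernel_deriv mu K f).
Local Notation SI := (scale_integral mu K f).

Lemma scale_integral_ge0 k a q x : (0 <= SI k a q x)%E.
Proof.
apply: integral_ge0 => t; rewrite /= in_itv/= andbT => t0.
by rewrite lee_fin divr_ge0 ?powR_ge0// ltW.
Qed.

Lemma measurable_scale_integral k a q : measurable_fun setT (SI k a q).
Proof.
(* The power of exponent -1, measurable on the whole line, stands for the inverse; the indicator of
   positive times makes w nonnegative everywhere. *)
pose w (z : measurableTypeR R * X) : R :=
  ((z.1 `^ (k%:R - a) * `|u k z.1 z.2 * (0 < z.1)%R%:R|) `^ q * z.1 `^ (- 1)) * (0 < z.1)%R%:R.
have mw : measurable_fun setT w.
  apply: measurable_funM; last by apply: measurable_bool_natr; exact: measurable_fun_ltr.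
  apply: measurable_funM; last first.
    by apply: (measurableT_comp (measurable_powR _)).
  apply: (measurableT_comp (measurable_powR q)); apply: measurable_funM.
    by apply: (measurableT_comp (measurable_powR _)).
  by apply: (measurableT_comp (@normr_measurable R setT)); exact: measurable_kernel_deriv.
have w0 z : 0 <= w z.
  rewrite /w; have [z0|z0] := boolP (0 < z.1); last by rewrite mulr0.
  by rewrite mulr1 mulr_ge0 ?powR_ge0.
have := @measurable_fun_fubini_tonelli_G _ _ (measurableTypeR R) X R lebesgue_measure
  (EFin \o w) ((measurable_EFinP _ _).2 mw).
move=> /(_ _)/wrap[]; first by move=> z; rewrite lee_fin w0.
apply: eq_measurable_fun => x _.
rewrite /fubini_G /scale_integral [RHS]integral_mkcond; apply: eq_integral => t _.
rewrite patchE /w /=; case: ifPn; rewrite ?inE ?notin_setE/= in_itv/= andbT.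
  by move=> t0; rewrite t0 !mulr1 powR_inv1// ltW.
by move=> /negP/negbTE ->; rewrite mulr0.
Qed.

(** The hypothesis says that V = 1 + SI^(1/q) is in L^p. [kernel_deriv_le_op] bounds the weighted
    derivative at every scale by [op (t / 4) V], and the maximal function of V bounds all these at
    once. The summand 1 keeps V and M away from 0, as the tangent inequality and the later real
    powers require. *)
Lemma scale_integral_maximal k m (a p q : R) : a <= k%:R -> 1 < p -> 1 <= q ->
  (\int[mu]_x (SI k a q x `^ (p / q)) < +oo)%E ->
  exists M : X -> R, [/\ measurable_fun setT M, (forall x, 1 <= M x),
    (\int[mu]_x (M x `^ p)%:E < +oo)%E &
    {ae mu, forall x, forall t, 0 < t -> t `^ ((k + m)%:R - a) * `|u (k + m) t x| <= M x}].
Proof.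
move=> ak p1 q1 Sfin.
have p0 : 0 < p by exact: lt_trans p1.
have q0 : 0 < q by exact: lt_le_trans q1.
have mS := measurable_scale_integral k a q.
have mSp : measurable_fun setT (fun x => SI k a q x `^ (p / q))%E.
  exact: (measurableT_comp (measurable_poweR _)).
have Soo : {ae mu, forall x, (SI k a q x < +oo)%E}.
  have : mu.-integrable setT (fun x => SI k a q x `^ (p / q))%E.
    apply/integrableP; split => //.
    by under eq_integral do rewrite gee0_abs ?poweR_ge0//.
  move=> /(integrable_ae measurableT); apply: filterS => x /(_ I).
  rewrite -ge0_fin_numE ?scale_integral_ge0//.
  have := scale_integral_ge0 k a q x; case: (SI k a q x) => //= _.
  by rewrite gt_eqF ?divr_gt0.
pose g x := fine (SI k a q x) `^ q^-1.
have mg : measurable_fun setT g.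
  apply: (measurableT_comp (measurable_powR _)).
  exact: (measurableT_comp (@fine_measurable _ _ _)).
have g0 x : 0 <= g x by exact: powR_ge0.
have gp : (\int[mu]_x (g x `^ p)%:E < +oo)%E.
  apply: le_lt_trans Sfin; apply: ge0_le_integral => //.
  - by move=> x _; rewrite lee_fin powR_ge0.
  - by apply/measurable_EFinP; exact: (measurableT_comp (measurable_powR p)).
  move=> x _; rewrite /g -powRrM [q^-1 * p]mulrC.
  have := scale_integral_ge0 k a q x; case: (SI k a q x) => //= _.
  by rewrite gt_eqF ?divr_gt0// leey.
pose V x := 1 + 1 * g x.
have V1 x : 1 <= V x by rewrite /V mul1r lerDl.
have V0 x : 0 <= V x by rewrite (le_trans _ (V1 x)).
have mV : measurable_fun setT V by apply: measurable_funD => //; exact: measurable_funM.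
have Vp : (\int[mu]_x (V x `^ p)%:E < +oo)%E by apply: integral_powR_affine_lty => //; exact: ltW.
have [_ LV] := L1_powR (ltW p1) mV V0 Vp.
have SV : {ae mu, forall y, (SI k a q y <= (V y `^ q)%:E)%E}.
  move: Soo; apply: filterS => x Sx.
  have Sf : SI k a q x \is a fin_num by rewrite ge0_fin_numE ?scale_integral_ge0.
  rewrite -(fineK Sf) lee_fin.
  have F0 : 0 <= fine (SI k a q x) by rewrite fine_ge0 ?scale_integral_ge0.
  have -> : fine (SI k a q x) = g x `^ q by rewrite /g -powRrM mulVf ?gt_eqF// powRr1.
  by rewrite ge0_ler_powR ?nnegrE ?(ltW q0)// /V mul1r lerDr.
have [C C0 HC] := kernel_deriv_le_op HK intf k m.
have [M [mM M0 Mp HM]] := kernel_op_maximal HK p1 mV V0 Vp.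
pose c := C * (1 + 4 `^ ((k%:R - a) * q)).
have c0 : 0 <= c by rewrite mulr_ge0 ?addr_ge0 ?powR_ge0.
exists (fun x => 1 + c * M x); split.
- by apply: measurable_funD => //; exact: measurable_funM.
- by move=> x; rewrite lerDl mulr_ge0.
- by apply: integral_powR_affine_lty => //; exact: ltW.
move: HM; apply: filterS => x HM t t0.
apply: (le_trans (HC a q V t x t0 q1 ak LV V1 SV)).
rewrite -/c (@le_trans _ _ (c * M x))//; last by rewrite lerDr.
by rewrite ler_wpM2l// HM// divr_gt0.
Qed.

(** This is qualitative, B being allowed to depend on x and k: it supplies the vanishing at infinity
    from which [kernel_deriv_descent] integrates. *)
Lemma kernel_deriv_maximal p : 1 < p -> (\int[mu]_x (`|f x| `^ p)%:E < +oo)%E ->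
  {ae mu, forall x, forall k, exists B, forall t, 0 < t -> `|u k t x| <= B * t `^ (- k%:R)}.
Proof.
move=> p1 fp; have mf := L1_measurable intf.
have maf : measurable_fun setT (fun x => `|f x|) by exact: (measurableT_comp (@normr_measurable R setT)).
have [M [mM M0 Mp HM]] := kernel_op_maximal HK p1 maf (fun x => normr_ge0 (f x)) fp.
move: HM; apply: filterS => x HM k.
have [C C0 HC] := kernel_deriv_le HK intf k.
exists (C * M x) => t t0; apply: (le_trans (HC t x t0)).
rewrite powRN powR_mulrn ?(ltW t0)// -mulrA [_^-1 * _]mulrC mulrA ler_wpM2r ?invr_ge0 ?exprn_ge0 ?(ltW t0)//.
by rewrite ler_wpM2l// HM// divr_gt0.
Qed.

(** Each step down integrates once from infinity and divides by (j + i) - b, positive since b < j,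
    so c depends on neither x nor A. The condition 0 < j is there because the a priori bound t^(-j)
    gives no decay at order 0. *)
Lemma kernel_deriv_descent j n b : (0 < j)%N -> b < j%:R ->
  exists2 c, 0 < c & forall A x, 0 <= A ->
    (forall k, exists B, forall t, 0 < t -> `|u k t x| <= B * t `^ (- k%:R)) ->
    (forall t, 0 < t -> `|u (j + n) t x| <= A * t `^ (b - (j + n)%:R)) ->
    forall t, 0 < t -> `|u j t x| <= c * A * t `^ (b - j%:R).
Proof.
move=> j0 bj; elim: n => [|n [c c0 IH]].
  by exists 1 => // A x _ _; rewrite addn0 => h t t0; rewrite mul1r h.
have bjn : 0 < (j + n)%:R - b by rewrite subr_gt0 (lt_le_trans bj)// ler_nat leq_addr.
exists (c / ((j + n)%:R - b)); first by rewrite divr_gt0.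
move=> A x A0 HB HA t t0.
rewrite (_ : c / _ * A = c * (A / ((j + n)%:R - b))); last by rewrite mulrAC mulrA.
apply: IH => //.
  by rewrite divr_ge0// ltW.
have [B HBx] := HB (j + n)%N.
have jn0 : 0 < (j + n)%:R :> R by rewrite ltr0n addn_gt0 j0.
move=> s s0; rewrite -(opprB (j + n)%:R b).
apply: (@le_powR_of_derivative R (fun s => u (j + n) s x) (fun s => u (j + n).+1 s x) A _ B _ bjn A0 _ _ jn0 HBx s s0).
  move=> r r0; apply: DeriveDef; first exact: kernel_deriv_derivable.
  by rewrite kernel_derivS derive1E.
move=> r r0; rewrite -addnS (le_trans (HA r r0))//.
by rewrite addnS -[in leLHS]natr1 opprB opprD addrA.
Qed.

End maximal_bounds.

(** The numbers p (1 - theta) / p0 and p theta / p1 are the reciprocals of the conjugate exponents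
    in every use of Hoelder's inequality between L^(p0) and L^(p1). *)
Lemma interpolation_weight (R : realFieldType) (p p0 p1 theta : R) :
  0 < p0 -> 0 < p1 -> 0 < theta -> theta < 1 -> 1 / p = (1 - theta) / p0 + theta / p1 ->
  [/\ 0 < p, 0 < p * (1 - theta) / p0, p * (1 - theta) / p0 < 1 &
    1 - p * (1 - theta) / p0 = p * theta / p1].
Proof.
move=> p00 p10 t0 t1 pE; have t1' : 0 < 1 - theta by rewrite subr_gt0.
have p_gt0 : 0 < p.
  by rewrite -invr_gt0 -div1r pE addr_gt0 ?divr_gt0.
have h : p * (1 - theta) / p0 + p * theta / p1 = 1.
  by rewrite -!mulrA -mulrDr -pE div1r mulfV// gt_eqF.
have k1 : 0 < p * theta / p1 by rewrite divr_gt0 ?mulr_gt0.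
split => //; first by rewrite divr_gt0 ?mulr_gt0.
- by rewrite -[ltRHS]h ltrDl.
- by rewrite -[X in X - _]h addrAC subrr add0r.
Qed.

Lemma powR_scale_interpolate (R : realType) (t w0 w1 k a0 a1 q0 q1 q theta : R) :
  0 < t -> 0 <= w0 -> 0 <= w1 -> 0 < q0 -> 0 < q1 -> 0 < theta -> theta < 1 ->
  1 / q = (1 - theta) / q0 + theta / q1 ->
  (t `^ (k - (a0 * (1 - theta) + a1 * theta)) * (w0 `^ (1 - theta) * w1 `^ theta)) `^ q / t =
  ((t `^ (k - a0) * w0) `^ q0 / t) `^ (q * (1 - theta) / q0) *
  ((t `^ (k - a1) * w1) `^ q1 / t) `^ (q * theta / q1).
Proof.
move=> t_gt0 w00 w10 q00 q10 t0 t1 qE.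
have [q_gt0 l0 l1 lE] := interpolation_weight q00 q10 t0 t1 qE.
set l := q * (1 - theta) / q0 in l0 l1 lE *.
have tn : (t == 0) = false by rewrite gt_eqF.
have tI0 : 0 <= t^-1 by rewrite invr_ge0 ltW.
have splitE e w r m : 0 <= w -> ((t `^ e * w) `^ r / t) `^ m = t `^ (e * r * m) * w `^ (r * m) * t^-1 `^ m.
  move=> wge0; rewrite powRM ?powR_ge0// [(_ * w) `^ r]powRM ?powR_ge0//.
  by rewrite [(_ * _) `^ m]powRM ?powR_ge0// -!powRrM !mulrA.
have E0 : t^-1 `^ l * t^-1 `^ (1 - l) = t^-1.
  by rewrite -powRD ?invr_eq0 ?tn ?implybT// [l + _]addrC subrK powRr1.
rewrite (splitE (k - a0) w0 q0)// (splitE (k - a1) w1 q1)// -lE [RHS]mulrACA E0; congr (_ / _).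
rewrite [RHS]mulrACA lE powRM ?mulr_ge0 ?powR_ge0// (powRM q) ?powR_ge0// -!powRrM.
have E1 : q0 * l = q * (1 - theta) by rewrite /l; field; rewrite gt_eqF.
have E2 : q1 * (q * theta / q1) = q * theta by field; rewrite gt_eqF.
rewrite -!(mulrA (k - _)) E1 E2 -[t `^ _ * t `^ _]powRD ?tn ?implybT//.
rewrite [q * _]mulrC [q * theta]mulrC; congr (t `^ _ * _); ring.
Qed.

(** * Interpolation for abstract Poisson semigroups *)

Section triebel_lizorkin_interpolation.
Context {d} {X : measurableType d} {R : realType}.
Variables (mu : probability X R) (K : R -> X -> X -> R).
Hypothesis HK : poisson_kernel_spec mu K.
Implicit Types (s t : R) (x y : X).
Local Notation L1 f := (mu.-integrable setT (EFin \o f)).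

Variable f : X -> R.
Hypothesis intf : L1 f.
Local Notation u := (kernel_deriv mu K f).
Local Notation SI := (scale_integral mu K f).

Variables (p0 p1 q0 q1 a0 a1 theta a p q : R).
Hypotheses (p01 : 1 < p0) (p11 : 1 < p1) (q01 : 1 < q0) (q11 : 1 < q1).
Hypotheses (t0 : 0 < theta) (t1 : theta < 1).
Hypotheses (aE : a = a0 * (1 - theta) + a1 * theta).
Hypotheses (pE : 1 / p = (1 - theta) / p0 + theta / p1).
Hypotheses (qE : 1 / q = (1 - theta) / q0 + theta / q1).

Lemma scale_integral_hoelder k x :
  (SI k a q x <= SI k a0 q0 x `^ (q * (1 - theta) / q0) * SI k a1 q1 x `^ (q * theta / q1))%E.
Proof.
have [q_gt0 l0 l1 lE] := interpolation_weight (lt_trans ltr01 q01) (lt_trans ltr01 q11) t0 t1 qE.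
set lam := q * (1 - theta) / q0 in l0 l1 lE *.
pose G b r t := (t `^ (k%:R - b) * `|u k t x|) `^ r / t.
have D0 t : (`]0%R, +oo[%classic : set (measurableTypeR R)) t -> 0 < t by rewrite /= in_itv/= andbT.
have mG b r : measurable_fun (`]0%R, +oo[%classic : set (measurableTypeR R)) (G b r).
  by apply/measurable_EFinP; exact: (measurable_scale_integrand HK intf).
have G0 b r t : (`]0%R, +oo[%classic : set (measurableTypeR R)) t -> 0 <= G b r t.
  by move=> /D0 s0; rewrite divr_ge0 ?powR_ge0// ltW.
have mD : measurable (`]0%R, +oo[%classic : set (measurableTypeR R)) by exact: measurable_itv.
have := integral_powR_interpolate lebesgue_measure mD (mG a0 q0) (mG a1 q1)
  (G0 a0 q0) (G0 a1 q1) l0 l1.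
rewrite lE; apply: le_trans; rewrite le_eqVlt; apply/orP; left; apply/eqP.
apply: eq_integral => t; rewrite inE => /D0 s0; congr (_%:E).
rewrite /G -powR_scale_interpolate//; [|exact: lt_trans q01..|exact: lt_trans q11].
by rewrite -aE -powRD ?subrK ?powRr1// oner_eq0.
Qed.

Lemma triebel_lizorkin_interpolation_eq k :
  (\int[mu]_x (SI k a0 q0 x `^ (p0 / q0)) < +oo)%E ->
  (\int[mu]_x (SI k a1 q1 x `^ (p1 / q1)) < +oo)%E ->
  (\int[mu]_x (SI k a q x `^ (p / q)) < +oo)%E.
Proof.
move=> h0 h1.
have q00 : 0 < q0 by exact: lt_trans q01.
have q10 : 0 < q1 by exact: lt_trans q11.
have p00 : 0 < p0 by exact: lt_trans p01.
have p10 : 0 < p1 by exact: lt_trans p11.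
have [q_gt0 _ _ _] := interpolation_weight q00 q10 t0 t1 qE.
have [p_gt0 k0 k1 kE] := interpolation_weight p00 p10 t0 t1 pE.
have mS b r e : measurable_fun setT (fun x => SI k b r x `^ e)%E.
  by apply: (measurableT_comp (measurable_poweR _)); exact: measurable_scale_integral.
(* In x the product of powers is bounded by the sum of the two integrable functions, finiteness
   being all that is required. *)
apply: (@le_lt_trans _ _ (\int[mu]_x (SI k a0 q0 x `^ (p0 / q0) + SI k a1 q1 x `^ (p1 / q1)))%E); last first.
  rewrite ge0_integralD//; first exact: lte_add_pinfty.
  - by move=> x _; exact: poweR_ge0.
  - by move=> x _; exact: poweR_ge0.
apply: ge0_le_integral => //.
- by move=> x _; exact: poweR_ge0.
- exact: emeasurable_funD.
move=> x _.
have pq0 : 0 <= p / q by rewrite divr_ge0 ?ltW.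
apply: (@le_trans _ _ ((SI k a0 q0 x `^ (q * (1 - theta) / q0) * SI k a1 q1 x `^ (q * theta / q1)) `^ (p / q))%E).
  by apply: gt0_ler_poweR => //; rewrite ?in_itv/= ?leey ?andbT ?mule_ge0 ?poweR_ge0 ?scale_integral_ge0 ?scale_integral_hoelder.
rewrite poweRM ?poweR_ge0// -!poweRrM.
have -> : q * (1 - theta) / q0 * (p / q) = (p0 / q0) * (p * (1 - theta) / p0).
  by field; rewrite !gt_eqF.
have -> : q * theta / q1 * (p / q) = (p1 / q1) * (1 - p * (1 - theta) / p0).
  by rewrite kE; field; rewrite !gt_eqF.
by apply: lee_poweR_weighted k0 k1; exact: scale_integral_ge0.
Qed.

(* Interpolating at theta + eta and theta - eta gives two powers of t around
   the critical one, so the integral over the scales converges at both ends. *)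
Lemma triebel_lizorkin_interpolation_lt k0 k1 k : (k0 < k1)%N -> (k <= k1)%N -> (0 < k)%N ->
  a0 <= k0%:R -> a1 <= k1%:R -> a0 < a1 -> a < k%:R ->
  (\int[mu]_x (`|f x| `^ p0)%:E < +oo)%E ->
  (\int[mu]_x (SI k0 a0 q0 x `^ (p0 / q0)) < +oo)%E ->
  (\int[mu]_x (SI k1 a1 q1 x `^ (p1 / q1)) < +oo)%E ->
  (\int[mu]_x (SI k a q x `^ (p / q)) < +oo)%E.
Proof.
move=> k01 kk1 k_gt0 ak0 ak1 a01 ak fp h0 h1.
have q00 : 0 < q0 by exact: lt_trans q01.
have q10 : 0 < q1 by exact: lt_trans q11.
have p00 : 0 < p0 by exact: lt_trans p01.
have p10 : 0 < p1 by exact: lt_trans p11.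
have [q_gt0 _ _ _] := interpolation_weight q00 q10 t0 t1 qE.
have [p_gt0 kap0 kap1 kapE] := interpolation_weight p00 p10 t0 t1 pE.
have [M0 [mM0 M01 M0p HM0]] := scale_integral_maximal HK intf (k1 - k0) ak0 p01 (ltW q01) h0.
have [M1 [mM1 M11 M1p HM1]] := scale_integral_maximal HK intf 0 ak1 p11 (ltW q11) h1.
have HB := kernel_deriv_maximal HK intf p01 fp.
rewrite subnKC ?(ltnW k01)// in HM0; rewrite addn0 in HM1.
(* The halved minimum makes theta - eta and theta + eta interior to ]0, 1[ and keeps a + eta (a1 -
   a0) strictly below k, as the descent to order k demands. *)
pose eta := Num.min (Num.min theta (1 - theta)) ((k%:R - a) / (a1 - a0)) / 2.
have t1' : 0 < 1 - theta by rewrite subr_gt0.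
have da : 0 < a1 - a0 by rewrite subr_gt0.
have dk : 0 < k%:R - a by rewrite subr_gt0.
have etam : 0 < Num.min (Num.min theta (1 - theta)) ((k%:R - a) / (a1 - a0)).
  by rewrite !lt_min t0 t1' divr_gt0.
have eta0 : 0 < eta by rewrite divr_gt0.
have etalt : eta < Num.min (Num.min theta (1 - theta)) ((k%:R - a) / (a1 - a0)).
  by rewrite ltr_pdivrMr// ltr_pMr// ltr1n.
have [eta1 eta2 eta3] : [/\ eta < theta, eta < 1 - theta & eta < (k%:R - a) / (a1 - a0)].
  by move: etalt; rewrite !lt_min => /andP[/andP[-> ->] ->].
pose eps := eta * (a1 - a0).
have eps0 : 0 < eps by rewrite mulr_gt0.
have epsk : a + eps < k%:R by rewrite -ltrBrDl /eps -ltr_pdivlMr.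
have epsk' : a - eps < k%:R by rewrite (lt_trans _ epsk)// ltrD2l gtrN.
(* The descent is made separately for the two powers a + eps and a - eps, before they are combined
   in the integral over t. *)
have [cA cA0 HA] := kernel_deriv_descent HK intf (k1 - k) k_gt0 epsk.
have [cB cB0 HBd] := kernel_deriv_descent HK intf (k1 - k) k_gt0 epsk'.
rewrite subnKC// in HA; rewrite subnKC// in HBd.
have [C C0 HC] := ge0_integral_min_powR eps0 q_gt0.
pose N x := M0 x `^ (1 - theta) * M1 x `^ theta.
pose c := C * (cA * cB) `^ (q / 2).
have M00 x : 0 < M0 x by exact: lt_le_trans (M01 x).
have M10 x : 0 < M1 x by exact: lt_le_trans (M11 x).
have key : {ae mu, forall x, (SI k a q x <= (c * N x `^ q)%:E)%E}.
  move: HM0 HM1 HB; apply: filterS3 => x HM0 HM1 HB.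
  (* Splitting |u| as |u|^(1-th) |u|^th and bounding the factors by M0 and M1 gives a power bound at
     any intermediate th. *)
  have inter th t : 0 < th -> th < 1 -> 0 < t -> `|u k1 t x| <=
      M0 x `^ (1 - th) * M1 x `^ th * t `^ (a0 * (1 - th) + a1 * th - k1%:R).
    move=> th0 th1 s0.
    have b0 : `|u k1 t x| <= M0 x * t `^ (a0 - k1%:R).
      by rewrite -opprB powRN ler_pdivlMr ?powR_gt0// mulrC HM0.
    have b1 : `|u k1 t x| <= M1 x * t `^ (a1 - k1%:R).
      by rewrite -opprB powRN ler_pdivlMr ?powR_gt0// mulrC HM1.
    have th1' : 0 < 1 - th by rewrite subr_gt0.
    have -> : `|u k1 t x| = `|u k1 t x| `^ (1 - th) * `|u k1 t x| `^ th.
      have [->|n0] := eqVneq (`|u k1 t x|) 0; first by rewrite !powR0 ?mul0r// gt_eqF.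
      by rewrite -powRD ?n0 ?implybT// subrK powRr1.
    apply: (@le_trans _ _ ((M0 x * t `^ (a0 - k1%:R)) `^ (1 - th) * (M1 x * t `^ (a1 - k1%:R)) `^ th)).
      by rewrite ler_pM ?powR_ge0// ge0_ler_powR ?nnegrE ?mulr_ge0 ?powR_ge0 ?(ltW (M00 x)) ?(ltW (M10 x)) ?(ltW th0) ?(ltW th1').
    rewrite !powRM ?powR_ge0 ?(ltW (M00 x)) ?(ltW (M10 x))// mulrACA -!powRrM.
    rewrite -[X in _ * X <= _]powRD ?(gt_eqF s0) ?implybT//.
    by rewrite le_eqVlt; apply/orP; left; apply/eqP; congr (_ * _ `^ _); ring.
  pose A := cA * (M0 x `^ (1 - (theta + eta)) * M1 x `^ (theta + eta)).
  pose B := cB * (M0 x `^ (1 - (theta - eta)) * M1 x `^ (theta - eta)).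
  have A0 : 0 < A by rewrite !mulr_gt0 ?powR_gt0.
  have B0 : 0 < B by rewrite !mulr_gt0 ?powR_gt0.
  have uA t : 0 < t -> `|u k t x| <= A * t `^ (a + eps - k%:R).
    apply: HA => //; first by rewrite mulr_ge0 ?powR_ge0.
    move=> s s0; have := inter (theta + eta) s (addr_gt0 t0 eta0) _ s0.
    rewrite -ltrBrDl => /(_ eta2).
    by rewrite (_ : a0 * _ + _ = a + eps)// aE /eps; ring.
  have uB t : 0 < t -> `|u k t x| <= B * t `^ (a - eps - k%:R).
    apply: HBd => //; first by rewrite mulr_ge0 ?powR_ge0.
    move=> s s0; have := inter (theta - eta) s _ _ s0.
    rewrite subr_gt0 ltrBlDr => /(_ eta1 (lt_trans t1 _)) => /(_ _)/wrap[]; first by rewrite ltrDl.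
    by rewrite (_ : a0 * _ + _ = a - eps)// aE /eps; ring.
  (* The shifts by eta cancel in the product, so (A B)^(q/2) is a constant times N^q: the integral
     sees only the interpolation at theta. *)
  have AB : A * B = cA * cB * N x ^+ 2.
    rewrite /A /B mulrACA; congr (_ * _); rewrite mulrACA /N exprMn.
    by rewrite -!powRD ?(gt_eqF (M00 x)) ?(gt_eqF (M10 x)) ?implybT// -!powR_mulrn ?powR_ge0// -!powRrM;
      congr (_ `^ _ * _ `^ _); ring.
  have := HC A B (fun t => t `^ (k%:R - a) * `|u k t x|) A0 B0 _ _ _ _.
  rewrite AB powRM ?mulr_ge0 ?exprn_ge0 ?powR_ge0 ?(ltW cA0) ?(ltW cB0)//.
  rewrite mulrA -/c -[N x ^+ 2]powR_mulrn ?mulr_ge0 ?powR_ge0// -powRrM.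
  rewrite [2%:R * _]mulrC divfK ?pnatr_eq0//; apply.
  - apply: measurable_funM; first exact: measurable_funTS.
    by apply: (measurableT_comp (@normr_measurable R setT)); exact: (measurable_kernel_deriv_time HK intf).
  - by move=> t _; rewrite mulr_ge0 ?powR_ge0.
  - move=> t s0; rewrite mulrC -ler_pdivlMr ?powR_gt0// -powRN opprB.
    rewrite (le_trans (uA t s0))// -[leRHS]mulrA -powRD ?(gt_eqF s0) ?implybT//.
    by rewrite (_ : eps + _ = a + eps - k%:R)//; ring.
  - move=> t s0; rewrite mulrC -ler_pdivlMr ?powR_gt0// -powRN opprB.
    rewrite (le_trans (uB t s0))// -[leRHS]mulrA -powRD ?(gt_eqF s0) ?implybT//.
    by rewrite (_ : - eps + _ = a - eps - k%:R)//; ring.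
have c0 : 0 <= c by rewrite mulr_ge0 ?powR_ge0.
have mMp b (M : X -> R) : measurable_fun setT M -> measurable_fun setT (fun x => (M x `^ b)%:E).
  by move=> mM; apply/measurable_EFinP; exact: (measurableT_comp (measurable_powR _)).
apply: (@le_lt_trans _ _ (\int[mu]_x ((c `^ (p / q))%:E * ((M0 x `^ p0)%:E + (M1 x `^ p1)%:E)))%E); last first.
  rewrite ge0_integralZl//.
  - rewrite lte_mul_pinfty ?lee_fin ?powR_ge0// ge0_integralD//.
    + exact: lte_add_pinfty.
    + by move=> x _; rewrite lee_fin powR_ge0.
    + exact: mMp.
    + by move=> x _; rewrite lee_fin powR_ge0.
    + exact: mMp.
  - by apply: emeasurable_funD; exact: mMp.
  - by move=> x _; rewrite adde_ge0// lee_fin powR_ge0.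
  - by rewrite lee_fin powR_ge0.
apply: ae_ge0_le_integral => //.
- by move=> x _; exact: poweR_ge0.
- by apply: (measurableT_comp (measurable_poweR _)); exact: measurable_scale_integral.
- by move=> x _; rewrite mule_ge0 ?adde_ge0// lee_fin powR_ge0.
- apply: measurable_funeM; by apply: emeasurable_funD; exact: mMp.
move: key; apply: filterS => x Sx _.
have pq0 : 0 <= p / q by rewrite divr_ge0 ?ltW.
apply: (@le_trans _ _ ((c * N x `^ q)%:E `^ (p / q))%E).
  by apply: gt0_ler_poweR => //; rewrite ?in_itv/= ?leey ?andbT ?lee_fin ?mulr_ge0 ?powR_ge0 ?scale_integral_ge0.
rewrite poweR_EFin -EFinD -EFinM lee_fin powRM ?powR_ge0// ler_wpM2l ?powR_ge0//.
rewrite -powRrM mulrC divfK ?gt_eqF// /N powRM ?powR_ge0// -!powRrM.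
have -> : (1 - theta) * p = p0 * (p * (1 - theta) / p0) by field; rewrite gt_eqF.
have -> : theta * p = p1 * (1 - p * (1 - theta) / p0) by rewrite kapE; field; rewrite gt_eqF.
by rewrite (powRrM _ p0) (powRrM _ p1) le_powR_mulD ?powR_ge0.
Qed.

End triebel_lizorkin_interpolation.

(** * Hardy-type inequality by absorption *)

Lemma powR_absorb (R : realType) (q rho : R) : 1 <= q -> 0 <= rho -> rho < 1 ->
  exists2 C, 0 <= C & forall x h : R, 0 <= x -> 0 <= h ->
    (rho * x + h) `^ q <= (1 + rho) / 2 * x `^ q + C * h `^ q.
Proof.
(* Take the midpoint s of rho and 1. If h <= (s - rho) x, then rho x + h <= s x and s^q <= s;
   otherwise x < h / (s - rho) and h alone dominates. *)
move=> q1 r0 r1; pose s := (1 + rho) / 2; have q0 : 0 <= q by exact: le_trans q1.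
have [s0 rs s1] : [/\ 0 < s, rho < s & s <= 1] by rewrite /s; split; lra.
have sr : 0 < s - rho by rewrite subr_gt0.
pose C := (rho / (s - rho) + 1) `^ q; exists C; first exact: powR_ge0.
move=> x h x0 h0; rewrite -/s; have [hx|xh] := leP h ((s - rho) * x).
  apply: (@le_trans _ _ ((s * x) `^ q)).
    rewrite ge0_ler_powR ?nnegrE ?addr_ge0 ?(mulr_ge0 r0) ?(mulr_ge0 (ltW s0))//.
    by rewrite -lerBrDl -mulrBl.
  rewrite powRM ?(ltW s0)// (@le_trans _ _ (s * x `^ q))//.
    by rewrite ler_wpM2r ?powR_ge0// -[leRHS](powRr1 (ltW s0)) ger_powR// s0.
  by rewrite lerDl mulr_ge0 ?powR_ge0.
apply: (@le_trans _ _ (((rho / (s - rho) + 1) * h) `^ q)).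
  rewrite ge0_ler_powR ?nnegrE ?addr_ge0 ?mulr_ge0 ?addr_ge0 ?divr_ge0 ?(ltW sr)//.
  rewrite [leRHS]mulrDl mul1r lerD2r -mulrA ler_wpM2l// mulrC ler_pdivlMr// mulrC.
  exact: ltW.
rewrite powRM ?addr_ge0 ?divr_ge0 ?(ltW sr)// lerDr mulr_ge0 ?powR_ge0// ltW//.
Qed.

Section absorption.
Context {R : realType}.
Local Notation D := (`]0%R, +oo[%classic : set (measurableTypeR R)).
Implicit Types (phi h : measurableTypeR R -> R).

Let mD : measurable D. Proof. exact: measurable_itv. Qed.

Let D0 t : D t -> 0 < t. Proof. by rewrite /= in_itv/= andbT. Qed.

Lemma measurable_powR_div q phi : measurable_fun D phi ->
  measurable_fun D (fun t => (phi t `^ q / t)%:E).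
Proof.
move=> mphi; apply/measurable_EFinP; apply: measurable_funM.
  exact: (measurableT_comp (measurable_powR q)).
apply: open_continuous_measurable_fun; first exact: interval_open.
by move=> s; rewrite inE => /D0 s0; apply: inv_continuous; rewrite gt_eqF.
Qed.

Lemma measurable_dilation (c : R) phi : 0 < c -> measurable_fun D phi ->
  measurable_fun D (fun t => phi (c * t)).
Proof.
move=> c0 mphi; have maff : measurable_fun D (affine_map c 0).
  by apply: measurable_funTS; exact: measurable_affine_map.
have := @measurable_comp _ _ _ _ _ _ D phi D (affine_map c 0) mD _ mphi maff.
move=> /(_ _)/wrap[].
  by move=> _ [t /D0 t0 <-]; rewrite /affine_map addr0 /= in_itv/= andbT mulr_gt0.
by apply: eq_measurable_fun => t _; rewrite /= /affine_map addr0.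
Qed.

Lemma integral_powR_dilation (c q : R) phi : 0 < c -> measurable_fun D phi ->
  (\int[lebesgue_measure]_(t in D) (phi (c * t) `^ q / t)%:E =
   \int[lebesgue_measure]_(t in D) (phi t `^ q / t)%:E)%E.
Proof.
move=> c0 mphi; under eq_integral do rewrite EFinM.
have mphiq : measurable_fun D (fun t => (phi t `^ q)%:E).
  by apply/measurable_EFinP; exact: (measurableT_comp (measurable_powR q)).
rewrite (ge0_integral_dilation c0 mphiq)//.
by move=> t t0; rewrite lee_fin powR_ge0.
Qed.

(* The bound by t^-a only serves to know that the truncated integrals are
   finite, so that they may be absorbed. *)
Lemma integral_dilation_absorb (q rho a B : R) phi h : 1 <= q -> 0 <= rho -> rho < 1 -> 0 < a ->
  measurable_fun D phi -> measurable_fun D h ->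
  (forall t, 0 < t -> 0 <= phi t) -> (forall t, 0 < t -> 0 <= h t) ->
  (forall t, 0 < t -> phi t <= rho * phi (2 * t) + h t) ->
  (forall t, 0 < t -> phi t <= B * t `^ (- a)) ->
  (\int[lebesgue_measure]_(t in D) (h t `^ q / t)%:E < +oo)%E ->
  (\int[lebesgue_measure]_(t in D) (phi t `^ q / t)%:E < +oo)%E.
Proof.
move=> q1 r0 r1 a0 mphi mh phi0 h0 phih phiB hfin.
have q_gt0 : 0 < q by exact: lt_le_trans q1.
have [C C0 HC] := powR_absorb q1 r0 r1.
set H := (\int[lebesgue_measure]_(t in D) (h t `^ q / t)%:E)%E in hfin.
have B0 : 0 < `|B| + 1 by rewrite ltr_wpDl.
(* Cutting off small t preserves the inequality between t and 2t, since 2t is kept whenever t is. A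
   cut at large t would not preserve it, which is why decay at infinity has to be assumed. *)
pose psi n (t : measurableTypeR R) : R := phi t * (n.+1%:R^-1 <= t)%R%:R.
have mpsi n : measurable_fun D (psi n).
  apply: measurable_funM => //; apply: measurable_funTS.
  by apply: measurable_bool_natr; exact: measurable_fun_ler.
have psi0 n t : 0 < t -> 0 <= psi n t by move=> t0; rewrite mulr_ge0// phi0.
have psi_le n t : 0 < t -> psi n t <= phi t.
  by move=> t0; rewrite ler_piMr ?phi0// lern1 leq_b1.
pose I n := (\int[lebesgue_measure]_(t in D) (psi n t `^ q / t)%:E)%E.
(* Where t >= 1 / (n+1), t^(-a) <= (n+1)^(2a) t^a, so the decay bound also yields a growing power
   and [ge0_integral_min_powR] applies. *)
have Iy n : (I n < +oo)%E.
  have [c c0 Hc] := ge0_integral_min_powR a0 q_gt0.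
  pose A : R := (`|B| + 1) * n.+1%:R `^ (2 * a).
  have A0 : 0 < A by rewrite mulr_gt0// powR_gt0.
  have b1 t : 0 < t -> psi n t <= (`|B| + 1) * t `^ (- a).
    move=> t0; rewrite (le_trans (psi_le n t t0))// (le_trans (phiB t t0))//.
    by rewrite ler_wpM2r ?powR_ge0// (le_trans (ler_norm B))// lerDl.
  apply: (@le_lt_trans _ _ (c * (A * (`|B| + 1)) `^ (q / 2))%:E); last exact: ltry.
  apply: Hc => // [t t0|t t0]; first exact: psi0.
  have [nt|tn] := leP (n.+1%:R^-1) t; last first.
    by rewrite /psi (leNgt _ t) tn mulr0 mulr_ge0 ?powR_ge0// ltW.
  apply: (le_trans (b1 t t0)); rewrite /A -mulrA ler_wpM2l ?(ltW B0)//.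
  have -> : t `^ (- a) = t `^ (- (2 * a)) * t `^ a.
    by rewrite -powRD ?(gt_eqF t0) ?implybT//; congr (_ `^ _); ring.
  rewrite ler_wpM2r ?powR_ge0// powRN -div1r ler_pdivrMr ?powR_gt0// -powRM ?ler0n ?(ltW t0)//.
  rewrite -[leLHS](congr1 (fun g => g (2 * a)) (@powR1 R)).
  rewrite ge0_ler_powR ?nnegrE ?mulr_ge0 ?(ltW a0) ?(ltW t0)//.
  by rewrite mulrC -ler_pdivrMr// div1r.
have I0 n : (0 <= I n)%E.
  by apply: integral_ge0 => t /D0 t0; rewrite lee_fin divr_ge0 ?powR_ge0// ltW.
have absorb n : (I n <= ((1 + rho) / 2)%:E * I n + C%:E * H)%E.
  have e : (((1 + rho) / 2)%:E * I n + C%:E * H =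
    \int[lebesgue_measure]_(t in D) (((1 + rho) / 2) * (psi n (2 * t) `^ q / t) + C * (h t `^ q / t))%:E)%E.
    (* Invariance of dt / t turns the integral of psi(2t)^q back into I n; being finite and
       multiplied by (1 + rho) / 2 < 1, it can be subtracted. *)
    rewrite /I -(integral_powR_dilation q (ltr0Sn R 1) (mpsi n)) /H.
    have m2 : measurable_fun D (fun t => psi n (2 * t)) by apply: measurable_dilation.
    rewrite -!ge0_integralZl//; first last.
    - by rewrite lee_fin divr_ge0// addr_ge0.
    - by move=> t /D0 t0; rewrite lee_fin divr_ge0 ?powR_ge0// ltW.
    - exact: (measurable_powR_div q m2).
    - by move=> t /D0 t0; rewrite lee_fin divr_ge0 ?powR_ge0// ltW.
    - exact: measurable_powR_div.
    rewrite -ge0_integralD//.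
    - by move=> t /D0 t0; rewrite mule_ge0// lee_fin divr_ge0 ?powR_ge0 ?addr_ge0// ltW.
    - by apply: measurable_funeM; exact: (measurable_powR_div q m2).
    - by move=> t /D0 t0; rewrite mule_ge0// lee_fin divr_ge0 ?powR_ge0 ?addr_ge0// ltW.
    - by apply: measurable_funeM; exact: measurable_powR_div.
  rewrite e; apply: ge0_le_integral => //.
  - by move=> t /D0 t0; rewrite lee_fin divr_ge0 ?powR_ge0// ltW.
  - exact: measurable_powR_div.
  - apply/measurable_EFinP; apply: measurable_funD; apply: measurable_funM => //; apply/measurable_EFinP.
      by apply: measurable_powR_div; apply: measurable_dilation.
    exact: measurable_powR_div.
  move=> t /D0 t0; rewrite lee_fin !mulrA -[leRHS]mulrDl ler_wpM2r ?invr_ge0 ?(ltW t0)//.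
  have t20 : 0 < 2 * t by rewrite mulr_gt0.
  have P1 := psi0 n t t0; have P2 := psi0 n _ t20; have P3 := h0 t t0.
  apply: (le_trans _ (HC _ _ P2 P3)).
  apply: ge0_ler_powR; rewrite ?nnegrE//; first exact: ltW.
    by rewrite addr_ge0// mulr_ge0.
  have [nt|tn] := leP (n.+1%:R^-1) t; last first.
    have -> : psi n t = 0 by rewrite /psi leNgt tn mulr0.
    by rewrite addr_ge0// mulr_ge0.
  have n2 : n.+1%:R^-1 <= 2 * t by rewrite (le_trans nt)// ler_peMl ?(ltW t0)// ler1n.
  by rewrite /psi nt n2 !mulr1 phih.
pose c := 1 - (1 + rho) / 2.
have c0 : 0 < c by rewrite /c; lra.
have Ile n : (I n <= (C / c)%:E * H)%E.
  have In : I n \is a fin_num by rewrite ge0_fin_numE.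
  have H0 : (0 <= H)%E.
    by apply: integral_ge0 => t /D0 t0; rewrite lee_fin divr_ge0 ?powR_ge0// ltW.
  have Hn : H \is a fin_num by rewrite ge0_fin_numE.
  move: (absorb n); rewrite -(fineK In) -(fineK Hn) -!EFinM -EFinD !lee_fin => ab.
  by rewrite mulrAC ler_pdivlMr// /c mulrBr mulr1 [fine (I n) * _]mulrC lerBlDl.
have cv : (I n @[n --> \oo] --> \int[lebesgue_measure]_(t in D) (phi t `^ q / t)%:E)%E.
  have -> : (\int[lebesgue_measure]_(t in D) (phi t `^ q / t)%:E =
     \int[lebesgue_measure]_(t in D) (limn (fun n => (psi n t `^ q / t)%:E)))%E.
    apply: eq_integral => t; rewrite inE => /D0 t0.
    apply/esym/cvg_lim => //; apply: cvg_near_cst.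
    exists (Num.truncn t^-1) => // n /= nt; rewrite /psi (_ : (_ <= t)%R) ?mulr1//.
    rewrite invf_ple ?posrE// ltW// (lt_le_trans (truncnS_gt _))// ler_nat ltnS//.
  apply: cvg_monotone_convergence => //.
  - by move=> n; exact: measurable_powR_div.
  - by move=> n t /D0 t0; rewrite lee_fin divr_ge0 ?powR_ge0// ltW.
  - move=> t /D0 t0 m n mn; rewrite lee_fin ler_wpM2r ?invr_ge0 ?(ltW t0)//.
    rewrite ge0_ler_powR ?nnegrE ?psi0 ?(ltW q_gt0)// ler_wpM2l ?phi0// ler_nat.
    case: (leP m.+1%:R^-1 t) => //= mt; rewrite (le_trans _ mt)// lef_pV2 ?posrE//.
    by rewrite ler_nat.
apply: (@le_lt_trans _ _ ((C / c)%:E * H)%E); last first.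
  by rewrite lte_mul_pinfty ?lee_fin ?divr_ge0// ltW.
by apply: (cvge_le _ cv); exact: nearW.
Qed.

End absorption.

Section weighted_integral.
Context {R : realType}.
Implicit Types (g : measurableTypeR R -> R) (b q : R).
Local Notation D := (`]0%R, +oo[%classic : set (measurableTypeR R)).

Definition weighted_integral b q g : \bar R :=
  (\int[lebesgue_measure]_(t in `]0%R, +oo[) ((t `^ b * g t) `^ q / t)%:E)%E.

Let mD : measurable D. Proof. exact: measurable_itv. Qed.

Let D0 t : D t -> 0 < t. Proof. by rewrite /= in_itv/= andbT. Qed.

Let mweight b g : measurable_fun D g -> measurable_fun D (fun t => t `^ b * g t).
Proof. by move=> mg; apply: measurable_funM => //; exact: measurable_funTS. Qed.

Let ge0 (phi : measurableTypeR R -> R) q t : D t -> (0 <= ((phi t) `^ q / t)%:E)%E.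
Proof. by move=> /D0 s0; rewrite lee_fin divr_ge0 ?powR_ge0// ltW. Qed.

Variables (g g' : measurableTypeR R -> R).
Hypotheses (mg : measurable_fun D g) (mg' : measurable_fun D g').
Hypotheses (g0 : forall t, 0 <= g t) (g'0 : forall t, 0 <= g' t).

Lemma weighted_integral_le b b' q c C : 0 < q -> 0 < c -> 0 <= C ->
  (forall t, 0 < t -> t `^ b * g t <= C * ((c * t) `^ b' * g' (c * t))) ->
  (weighted_integral b' q g' < +oo)%E -> (weighted_integral b q g < +oo)%E.
Proof.
move=> q0 c0 C0 le by_.
apply: (@le_lt_trans _ _ ((C `^ q)%:E * weighted_integral b' q g')%E); last first.
  by rewrite lte_mul_pinfty ?lee_fin ?powR_ge0.
rewrite /weighted_integral -(integral_powR_dilation q c0 (mweight b' mg')).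
have md := measurable_dilation c0 (mweight b' mg').
rewrite -ge0_integralZl//; first last.
- by rewrite lee_fin powR_ge0.
- by move=> t; exact: (ge0 (fun t => (c * t) `^ b' * g' (c * t))).
- exact: (measurable_powR_div q md).
apply: ge0_le_integral => //.
- by move=> t; exact: (ge0 (fun t => t `^ b * g t)).
- exact: (measurable_powR_div q (mweight b mg)).
- by apply: measurable_funeM; exact: (measurable_powR_div q md).
move=> t /D0 t0; rewrite lee_fin mulrA ler_wpM2r ?invr_ge0 ?(ltW t0)// -powRM//; last first.
  by rewrite mulr_ge0 ?powR_ge0.
by rewrite ge0_ler_powR ?nnegrE ?(ltW q0) ?mulr_ge0 ?powR_ge0 ?le.
Qed.

Lemma weighted_integral_up b (m : R) q C : 0 < q -> 0 <= C ->
  (forall t, 0 < t -> g t <= C * t `^ (- m) * g' (2^-1 * t)) ->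
  (weighted_integral b q g' < +oo)%E -> (weighted_integral (b + m) q g < +oo)%E.
Proof.
move=> q0 C0 HC; apply: (@weighted_integral_le _ _ _ 2^-1 (C * 2 `^ b)) => //.
  by rewrite mulr_ge0 ?powR_ge0.
move=> t t0; have tn := gt_eqF t0.
rewrite (le_trans (ler_wpM2l (powR_ge0 _ _) (HC t t0)))//.
rewrite le_eqVlt; apply/orP; left; apply/eqP.
rewrite (powRM _ _ (ltW t0))// mulrA [RHS]mulrA; congr (_ * _).
have -> : C * 2 `^ b * (2^-1 `^ b * t `^ b) = C * (2 `^ b * 2^-1 `^ b) * t `^ b by ring.
rewrite -powRM// mulfV ?pnatr_eq0// powR1 mulr1 mulrCA -powRD ?tn ?implybT//.
by rewrite addrK.
Qed.

(** Multiplied by t^b, the value g(2t) acquires the factor 2^(-b), less than 1 because b > 0, and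
    absorption applies to t^b g(t). The bound by t^(-(b+a)) gives this product the decay t^(-a)
    needed there. *)
Lemma weighted_integral_down b q a B : 1 <= q -> 0 < a -> 0 < b ->
  (forall t, 0 < t -> g t <= g (2 * t) + 3 * t * g' (2^-1 * t)) ->
  (forall t, 0 < t -> g t <= B * t `^ (- (b + a))) ->
  (weighted_integral (b + 1) q g' < +oo)%E -> (weighted_integral b q g < +oo)%E.
Proof.
move=> q1 a0 b0 gd gB by_; have q0 : 0 < q by exact: lt_le_trans q1.
pose rho : R := 2 `^ (- b).
have r1 : rho < 1.
  rewrite /rho powRN invf_lt1 ?powR_gt0//.
  have := @gt0_ltr_powR _ _ b0 1 2; rewrite !nnegrE ler01 ler0n ltr1n powR1.
  by apply.
pose c : R := 3 * 2 `^ (b + 1).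
have c0 : 0 <= c by rewrite mulr_ge0 ?powR_ge0.
have h0 : 0 < (2^-1 : R) by rewrite invr_gt0.
have md := measurable_dilation h0 (mweight (b + 1) mg').
have G0 (t : measurableTypeR R) : 0 <= t `^ b * g t by rewrite mulr_ge0 ?powR_ge0.
have G'0 (t : measurableTypeR R) : 0 <= (2^-1 * t) `^ (b + 1) * g' (2^-1 * t).
  by rewrite mulr_ge0 ?powR_ge0.
have Hfin : (\int[lebesgue_measure]_(t in D)
    ((c * ((2^-1 * t) `^ (b + 1) * g' (2^-1 * t))) `^ q / t)%:E < +oo)%E.
  under eq_integral => t _ do rewrite (powRM _ c0 (G'0 t)) -[_ / t]mulrA EFinM.
  rewrite ge0_integralZl//; last by rewrite lee_fin powR_ge0.
  + by rewrite lte_mul_pinfty ?lee_fin ?powR_ge0// (integral_powR_dilation q h0 (mweight (b + 1) mg')).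
  + exact: (measurable_powR_div q md).
  + by move=> t; exact: (ge0 (fun t => (2^-1 * t) `^ (b + 1) * g' (2^-1 * t))).
have mh : measurable_fun D (fun t => c * ((2^-1 * t) `^ (b + 1) * g' (2^-1 * t))).
  by apply: measurable_funM.
apply: (integral_dilation_absorb q1 (powR_ge0 _ _ : 0 <= rho) r1 a0 (mweight b mg) mh
  (fun t _ => G0 t) (fun t _ => mulr_ge0 c0 (G'0 t)) _ _ Hfin).
- move=> t t0; have tn := gt_eqF t0.
  rewrite (le_trans (ler_wpM2l (powR_ge0 _ _) (gd t t0)))//.
  rewrite mulrDr; rewrite le_eqVlt; apply/orP; left; apply/eqP; congr (_ + _).
    rewrite (powRM _ _ (ltW t0))// !mulrA; congr (_ * _).
    by rewrite /rho -powRD ?addNr ?powRr0 ?mul1r// pnatr_eq0 implybT.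
  rewrite (powRM _ _ (ltW t0))// !mulrA; congr (_ * _).
  have -> : c * 2^-1 `^ (b + 1) = 3.
    by rewrite /c -mulrA -powRM// mulfV ?pnatr_eq0// powR1 mulr1.
  rewrite -mulrA mulrCA; congr (_ * _); rewrite -{2}(powRr1 (ltW t0)) -powRD ?tn ?implybT//.
- move=> t t0; have tn := gt_eqF t0.
  rewrite (le_trans (ler_wpM2l (powR_ge0 _ _) (gB t t0)))//.
  rewrite mulrCA -powRD ?tn ?implybT// (_ : _ + _ = - a)//; ring.
Qed.

Lemma weighted_integral_hoelder (h : measurableTypeR R -> R) q0 q1 a0 a1 theta q k :
  1 < q0 -> 1 < q1 -> 0 < theta -> theta < 1 -> 1 / q = (1 - theta) / q0 + theta / q1 ->
  measurable_fun D h -> (forall t, 0 <= h t) ->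
  (forall t, 0 < t -> h t <= g t `^ (1 - theta) * g' t `^ theta) ->
  (weighted_integral (k - a0) q0 g < +oo)%E -> (weighted_integral (k - a1) q1 g' < +oo)%E ->
  (weighted_integral (k - (a0 * (1 - theta) + a1 * theta)) q h < +oo)%E.
Proof.
move=> q01 q11 t0 t1 qE mh h0 hg b0 b1.
have [q00 q10] : 0 < q0 /\ 0 < q1 by rewrite (lt_trans _ q01)// (lt_trans _ q11).
have [q_gt0 l0 l1 lE] := interpolation_weight q00 q10 t0 t1 qE.
apply: (@le_lt_trans _ _ (weighted_integral (k - a0) q0 g + weighted_integral (k - a1) q1 g')%E); last first.
  exact: lte_add_pinfty.
have G0 b r t : D t -> (0 <= ((t `^ b * g t) `^ r / t)%:E)%E by exact: (ge0 (fun t => t `^ b * g t)).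
have G'0 b r t : D t -> (0 <= ((t `^ b * g' t) `^ r / t)%:E)%E by exact: (ge0 (fun t => t `^ b * g' t)).
have mG b r := measurable_powR_div r (mweight b mg).
have mG' b r := measurable_powR_div r (mweight b mg').
rewrite /weighted_integral -ge0_integralD//; first last.
- by move=> t; exact: G'0.
- by move=> t; exact: G0.
apply: ge0_le_integral => //.
- by move=> t; exact: (ge0 (fun t => t `^ _ * h t)).
- exact: (measurable_powR_div q (mweight _ mh)).
- by apply: emeasurable_funD; [exact: mG|exact: mG'].
move=> t /D0 s0; rewrite -EFinD lee_fin.
apply: (@le_trans _ _ ((t `^ (k - (a0 * (1 - theta) + a1 * theta)) *
   (g t `^ (1 - theta) * g' t `^ theta)) `^ q / t)).
  rewrite ler_wpM2r ?invr_ge0 ?(ltW s0)// ge0_ler_powR ?nnegrE ?(ltW q_gt0) ?mulr_ge0 ?powR_ge0//.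
  by rewrite ler_wpM2l ?powR_ge0 ?hg.
rewrite (powR_scale_interpolate _ _ _ s0 (g0 t) (g'0 t) q00 q10 t0 t1 qE) -lE.
by rewrite le_powR_mulD// divr_ge0 ?powR_ge0// ltW.
Qed.

End weighted_integral.

(** * Norms of L^p as real numbers *)

Section lp_norm.
Context {d} {X : measurableType d} {R : realType}.
Variables (mu : probability X R).
Implicit Types (g h : X -> R) (p : R).

Definition lp_mass p g : \bar R := (\int[mu]_x (`|g x| `^ p)%:E)%E.

(** An infinite mass gets the value 0 through [fine]; inequalities between these norms carry
    information only together with [lp_finite]. *)
Definition lp_norm p g : R := fine (lp_mass p g) `^ p^-1.

(* A record rather than a plain inequality: it keeps unification from comparing
   extended-real and real inequalities. *)
Record lp_finite p g : Prop := LpFinite { lp_finite_lty : (lp_mass p g < +oo)%E }.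

Lemma lp_mass_ge0 p g : (0 <= lp_mass p g)%E.
Proof. by apply: integral_ge0 => x _; rewrite lee_fin powR_ge0. Qed.

Lemma lp_norm_ge0 p g : 0 <= lp_norm p g. Proof. exact: powR_ge0. Qed.

Lemma measurable_powR_norm p g : measurable_fun setT g ->
  measurable_fun setT (fun x => (`|g x| `^ p)%:E).
Proof.
move=> mg; apply/measurable_EFinP; apply: (measurableT_comp (measurable_powR p)).
exact: (measurableT_comp (@normr_measurable R setT)).
Qed.

Lemma LnormEFin p g : 'N[mu]_p%:E[EFin \o g]%E = (lp_mass p g `^ p^-1)%E.
Proof. by rewrite unlock. Qed.

Lemma lp_norm_EFin p g : lp_finite p g -> 'N[mu]_p%:E[EFin \o g]%E = (lp_norm p g)%:E.
Proof.
move=> [gy]; rewrite LnormEFin -[lp_mass p g]fineK ?ge0_fin_numE ?lp_mass_ge0//.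
Qed.

Lemma lp_norm_le p c g h : 0 < p -> 0 <= c -> measurable_fun setT g -> measurable_fun setT h ->
  (forall x, `|g x| <= c * `|h x|) -> lp_finite p h ->
  lp_finite p g /\ lp_norm p g <= c * lp_norm p h.
Proof.
move=> p0 c0 mg mh gh [hy].
have le : (lp_mass p g <= (c `^ p)%:E * lp_mass p h)%E.
  rewrite -ge0_integralZl//; first last.
  - by rewrite lee_fin powR_ge0.
  - exact: measurable_powR_norm.
  apply: ge0_le_integral => //.
  - exact: measurable_powR_norm.
  - by apply: measurable_funeM; exact: measurable_powR_norm.
  move=> x _; rewrite lee_fin -powRM//.
  by rewrite ge0_ler_powR ?nnegrE ?mulr_ge0// ltW.
have gy : (lp_mass p g < +oo)%E.
  by rewrite (le_lt_trans le)// lte_mul_pinfty ?lee_fin ?powR_ge0.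
split; first exact: LpFinite.
rewrite /lp_norm -[c in leRHS](powRr1 c0) -(mulfV (lt0r_neq0 p0)) powRrM.
rewrite -powRM ?powR_ge0 ?fine_ge0 ?lp_mass_ge0//.
rewrite ge0_ler_powR ?nnegrE ?mulr_ge0 ?powR_ge0 ?invr_ge0 ?(ltW p0) ?fine_ge0 ?lp_mass_ge0//.
by rewrite -lee_fin EFinM !fineK ?ge0_fin_numE ?lp_mass_ge0.
Qed.

Lemma lp_norm_mass_le p g h : 0 < p -> (lp_mass p g <= lp_mass p h)%E -> lp_finite p h ->
  lp_finite p g /\ lp_norm p g <= lp_norm p h.
Proof.
move=> p0 gh [hy]; have gy := le_lt_trans gh hy; split; first exact: LpFinite.
have f0 := fine_ge0 (lp_mass_ge0 p g); have f1 := fine_ge0 (lp_mass_ge0 p h).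
have le : fine (lp_mass p g) <= fine (lp_mass p h).
  by rewrite fine_le ?ge0_fin_numE ?lp_mass_ge0.
by rewrite /lp_norm ge0_ler_powR ?nnegrE ?invr_ge0 ?(ltW p0).
Qed.

Lemma lp_massE p g : lp_mass p g = (\int[mu]_x (`|g x| `^ p)%:E)%E.
Proof. by []. Qed.

Lemma measurable_lp_norm d' (T : measurableType d') (D : set T) (F : T -> X -> R) p :
  measurable_fun D (fun t => lp_mass p (F t)) -> measurable_fun D (fun t => lp_norm p (F t)).
Proof.
move=> mF; apply: (measurableT_comp (measurable_powR _)).
exact: (measurableT_comp (@fine_measurable _ _ _)).
Qed.

Lemma lp_normD p g h : 1 <= p -> measurable_fun setT g -> measurable_fun setT h ->
  lp_finite p g -> lp_finite p h ->
  lp_finite p (g \+ h)%R /\ lp_norm p (g \+ h)%R <= lp_norm p g + lp_norm p h.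
Proof.
move=> p1 mg mh gy hy; have := minkowski_EFin mu mg mh p1.
rewrite (lp_norm_EFin gy) (lp_norm_EFin hy) -EFinD => M.
have ghy : lp_finite p (g \+ h)%R.
  constructor; have := le_lt_trans M (ltry _); rewrite LnormEFin.
  have := lp_mass_ge0 p (g \+ h)%R; case: (lp_mass p _) => [r||]//= _; first by rewrite !ltry.
  by rewrite invr_eq0 gt_eqF// (lt_le_trans ltr01 p1).
by split; [exact: ghy|move: M; rewrite (lp_norm_EFin ghy) lee_fin].
Qed.

(** Lyapunov's inequality: |g|^p is the product of the powers k and 1 - k of |g|^(p0) and |g|^(p1),
    to which Hoelder applies. *)
Lemma lp_norm_interpolate p0 p1 p theta g : 0 < p0 -> 0 < p1 -> 0 < theta -> theta < 1 ->
  1 / p = (1 - theta) / p0 + theta / p1 -> measurable_fun setT g ->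
  lp_finite p0 g -> lp_finite p1 g ->
  lp_finite p g /\ lp_norm p g <= lp_norm p0 g `^ (1 - theta) * lp_norm p1 g `^ theta.
Proof.
move=> p00 p10 t0 t1 pE mg [g0] [g1].
have [p_gt0 k0 k1 kE] := interpolation_weight p00 p10 t0 t1 pE.
set k := p * (1 - theta) / p0 in k0 k1 kE *.
have p0k : p0 * k = p * (1 - theta) by rewrite /k; field; rewrite gt_eqF.
have p1k : p1 * (1 - k) = p * theta by rewrite kE; field; rewrite gt_eqF.
have mn e : measurable_fun setT (fun x => `|g x| `^ e).
  by apply/measurable_EFinP; exact: measurable_powR_norm.
have le : (lp_mass p g <= lp_mass p0 g `^ k * lp_mass p1 g `^ (1 - k))%E.
  have := integral_powR_interpolate mu (@measurableT _ X) (mn p0) (mn p1)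
    (fun x _ => powR_ge0 _ _) (fun x _ => powR_ge0 _ _) k0 k1.
  apply: le_trans; rewrite le_eqVlt; apply/orP; left; apply/eqP.
  apply: eq_integral => x _; congr (_%:E); rewrite -!powRrM p0k p1k -powRD.
    by rewrite -mulrDr subrK mulr1.
  by rewrite -mulrDr subrK mulr1 (gt_eqF p_gt0).
have f0 : lp_mass p0 g \is a fin_num by rewrite ge0_fin_numE ?lp_mass_ge0.
have f1 : lp_mass p1 g \is a fin_num by rewrite ge0_fin_numE ?lp_mass_ge0.
rewrite -(fineK f0) -(fineK f1) in le.
rewrite !poweR_EFin -EFinM in le.
have gy : (lp_mass p g < +oo)%E by rewrite (le_lt_trans le)// ltry.
split; first exact: LpFinite.
rewrite /lp_norm.
have E0 : p0^-1 * (1 - theta) = k * p^-1 by rewrite /k; field; rewrite !gt_eqF.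
have E1 : p1^-1 * theta = (1 - k) * p^-1 by rewrite kE; field; rewrite !gt_eqF.
have {}le : fine (lp_mass p g) <= fine (lp_mass p0 g) `^ k * fine (lp_mass p1 g) `^ (1 - k).
  by rewrite -lee_fin fineK ?ge0_fin_numE ?lp_mass_ge0.
have := fine_ge0 (lp_mass_ge0 p g).
move: (fine (lp_mass p g)) (fine (lp_mass p0 g)) (fine (lp_mass p1 g)) le => x y z le x0.
rewrite -(powRrM y) -(powRrM z) E0 E1 (powRrM y) (powRrM z) -powRM ?powR_ge0//.
by rewrite ge0_ler_powR ?nnegrE ?mulr_ge0 ?powR_ge0 ?invr_ge0 ?(ltW p_gt0).
Qed.

End lp_norm.

(** * The Besov scale *)

Section besov_interpolation.
Context {d} {X : measurableType d} {R : realType}.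
Variables (mu : probability X R) (K : R -> X -> X -> R).
Hypothesis HK : poisson_kernel_spec mu K.
Implicit Types (s t : R) (x y : X) (p q : R).
Local Notation op := (kernel_op mu K).
Local Notation L1 f := (mu.-integrable setT (EFin \o f)).
Local Notation mass := (lp_mass mu).
Local Notation fin := (lp_finite mu).
Local Notation D := (`]0%R, +oo[%classic : set (measurableTypeR R)).

Lemma L1_lp_mass p g : 1 <= p -> measurable_fun setT g -> fin p g -> L1 g.
Proof.
move=> p1 mg [gy].
have mag : measurable_fun setT (fun x => `|g x|) by exact: (measurableT_comp (@normr_measurable R setT)).
have [_ Lg] := L1_powR p1 mag (fun x => normr_ge0 (g x)) gy.
by apply: (L1_le mg _ Lg) => x /=.
Qed.

Lemma lp_norm_kernel_op t p g : 0 < t -> 1 < p -> measurable_fun setT g -> fin p g ->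
  let h := op t (fun y => `|g y|) in
  [/\ measurable_fun setT h, fin p h & lp_norm mu p h <= lp_norm mu p g].
Proof.
move=> t0 p1 mg gy h.
have mag : measurable_fun setT (fun x => `|g x|) by exact: (measurableT_comp (@normr_measurable R setT)).
have Lg : L1 (fun y => `|g y|).
  by case: gy => gy; have [] := L1_powR (ltW p1) mag (fun x => normr_ge0 (g x)) gy.
have mh : measurable_fun setT h by exact: (kernel_op_measurable HK).
have le : (mass p h <= mass p g)%E.
  rewrite !lp_massE; under eq_integral do rewrite ger0_norm ?(kernel_op_ge0 HK)//.
  exact: (integral_kernel_op_powR_le HK).
by have [hy hle] := lp_norm_mass_le (lt_trans ltr01 p1) le gy.
Qed.

Variable f : X -> R.
Hypothesis intf : L1 f.
Local Notation u := (kernel_deriv mu K f).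
Local Notation G p k t := (lp_norm mu p (u k t)).

Let mu_ k t : 0 < t -> measurable_fun setT (u k t).
Proof. exact: (kernel_deriv_measurable HK intf). Qed.

Lemma lp_norm_kernel_deriv p k : 1 < p -> fin p f ->
  exists2 B, 0 <= B & forall t, 0 < t -> fin p (u k t) /\ G p k t <= B * t `^ (- k%:R).
Proof.
move=> p1 fy; have [C C0 HC] := kernel_deriv_le HK intf k.
have p0 : 0 < p by exact: lt_trans p1.
exists (C * lp_norm mu p f); first by rewrite mulr_ge0 ?lp_norm_ge0.
move=> t t0; have t20 : 0 < t / 2 by rewrite divr_gt0.
have [mh hy hle] := lp_norm_kernel_op t20 p1 (L1_measurable intf) fy.
have c0 : 0 <= C / t ^+ k by rewrite divr_ge0 ?exprn_ge0 ?(ltW t0).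
have [x|uy ule] := lp_norm_le p0 c0 (mu_ k t0) mh _ hy.
  by rewrite (le_trans (HC t x t0))// ler_wpM2l// ler_norm.
split; first exact: uy.
move: hle ule; move: (lp_norm mu p (op _ _)) (G p k t) (lp_norm mu p f) => z w v zv wz.
rewrite powRN powR_mulrn ?(ltW t0)// mulrAC (le_trans wz)//.
by rewrite ler_wpM2l.
Qed.

Lemma lp_norm_kernel_deriv_up p k m : 1 < p -> fin p f ->
  exists2 C, 0 <= C & forall t, 0 < t -> G p (k + m) t <= C * t `^ (- m%:R) * G p k (2^-1 * t).
Proof.
move=> p1 fy; have [C C0 HC] := kernel_deriv_le_window HK intf m.
have p0 : 0 < p by exact: lt_trans p1.
exists C => // t t0; have t20 : 0 < 2^-1 * t by rewrite mulr_gt0.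
have t40 : 0 < t / 4 by rewrite divr_gt0.
have [B B0 HB] := lp_norm_kernel_deriv k p1 fy; have [uy _] := HB _ t20.
have [mh hy hle] := lp_norm_kernel_op t40 p1 (mu_ k t20) uy.
have c0 : 0 <= C / t ^+ m by rewrite divr_ge0 ?exprn_ge0 ?(ltW t0).
have [x|_ ule] := lp_norm_le p0 c0 (mu_ (k + m) t0) mh _ hy.
  have := HC k (2^-1 * t) t x t0; rewrite [_ * t]mulrC => /(_ _ (lexx _)) H.
  rewrite (le_trans (H _))//; first by rewrite ler_pM2l// lef_pV2 ?posrE// ler_nat.
  by rewrite ler_wpM2l// mulrC ler_norm.
move: hle ule; move: (lp_norm mu p (op _ _)) (G p (k + m) t) (G p k _) => z w v zv wz.
rewrite powRN powR_mulrn ?(ltW t0)// (le_trans wz)//.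
by rewrite ler_wpM2l.
Qed.

Let measurable_normu k t : 0 < t -> measurable_fun setT (fun x => `|u k t x|).
Proof. by move=> t0; apply: (measurableT_comp (@normr_measurable R setT)); exact: mu_. Qed.

(** The mean value theorem between t and 2t produces a time z that depends on x, so norms cannot be
    taken yet. Writing u_(j+1)(z) as [op (z - t / 2)] of u_(j+1)(t / 2) and applying
    [kernel_op_mono] replaces z by a fixed operator; the ratio of z - t / 2 < 3t / 2 to t / 2 gives
    the 3. *)
Lemma kernel_deriv_le_dilation j t x : 0 < t ->
  `|u j t x| <= `|u j (2 * t) x| + 3 * t * op (2^-1 * t) (fun y => `|u j.+1 (2^-1 * t) y|) x.
Proof.
move=> t0.
have h0 : 0 < 2^-1 * t by rewrite mulr_gt0.
have t2t : t < 2 * t by rewrite ltr_pMl// ltr1n.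
have c2 : 2 * t = 3 * (2^-1 * t) + 2^-1 * t by field.
have Lu : L1 (fun y => `|u j.+1 (2^-1 * t) y|).
  have Lu' := kernel_deriv_L1 HK intf j.+1 h0.
  apply: (L1_le _ _ (integrable_norm Lu')) => [|y]; last by rewrite normr_id.
  exact: measurable_normu.
have [|y|z zt] := @MVT _ (fun s => u j s x) (fun s => u j.+1 s x) t (2 * t) t2t.
- move=> y; rewrite in_itv/= => /andP[ty _]; apply: DeriveDef.
    by apply: (kernel_deriv_derivable HK intf); exact: lt_trans ty.
  by rewrite ?kernel_derivS derive1E.
- apply: derivable_within_continuous => {}y; rewrite in_itv/= => /andP[ty _].
  by apply: (kernel_deriv_derivable HK intf); exact: lt_le_trans ty.
move: zt; rewrite in_itv/= => /andP[tz z2t] MV.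
have uE : u j t x = u j (2 * t) x - u j.+1 z x * t.
  have -> : u j.+1 z x * t = u j (2 * t) x - u j t x; last by rewrite subKr.
  by rewrite MV kernel_derivS (_ : 2 * t - t = t)//; ring.
rewrite uE (le_trans (ler_normB _ _))// lerD2l normrM (ger0_norm (ltW t0)) mulrC [3 * t]mulrC -mulrA ler_pM2l//.
have r0 : 0 < z - 2^-1 * t by rewrite subr_gt0 (lt_trans _ tz)// gtr_pMl// invf_lt1// ltr1n.
have hr : 2^-1 * t <= z - 2^-1 * t.
  by rewrite lerBrDr (le_trans _ (ltW tz))// -mulrDl -{1}[2^-1]mulr1 -{2}[2^-1]mulr1 -mulrDr mulVf ?mul1r// pnatr_eq0.
have -> : u j.+1 z x = op (z - 2^-1 * t) (u j.+1 (2^-1 * t)) x.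
  by rewrite -(kernel_deriv_semigroup HK intf)// addrC subrK.
apply: (le_trans (kernel_op_norm_le HK _ r0 (kernel_deriv_L1 HK intf _ h0))).
apply: (le_trans (kernel_op_mono HK x h0 hr Lu (fun y => normr_ge0 _))).
have c3 : (z - 2^-1 * t) / (2^-1 * t) <= 3.
  by rewrite ler_pdivrMr// lerBlDr -c2 ltW.
by rewrite ler_wpM2r// (kernel_op_ge0 HK).
Qed.

Lemma lp_norm_kernel_deriv_down p j : 1 < p -> fin p f -> forall t, 0 < t ->
  G p j t <= G p j (2 * t) + 3 * t * G p j.+1 (2^-1 * t).
Proof.
move=> p1 fy t t0; have p0 : 0 < p by exact: lt_trans p1.
have t20 : 0 < 2 * t by rewrite mulr_gt0.
have h0 : 0 < 2^-1 * t by rewrite mulr_gt0.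
have [B _ HB] := lp_norm_kernel_deriv j p1 fy; have [u2y _] := HB _ t20.
have [B' _ HB'] := lp_norm_kernel_deriv j.+1 p1 fy; have [u1y _] := HB' _ h0.
have [mh hy hle] := lp_norm_kernel_op h0 p1 (mu_ j.+1 h0) u1y.
have my := measurable_funM (@measurable_cst _ _ _ _ (setT : set X) (3 * t)) mh.
have c1 : 0 <= 3 * t by rewrite mulr_ge0// ltW.
have [x|Hy Hle] := lp_norm_le p0 c1 my mh _ hy.
  by rewrite normrM (ger0_norm c1).
have mau := measurable_normu j t20.
have [x|auy aule] := lp_norm_le p0 ler01 mau (mu_ j t20) _ u2y.
  by rewrite mul1r normr_id.
have [sy sle] := lp_normD (ltW p1) mau my auy Hy.
have [x|_ ule] := lp_norm_le p0 ler01 (mu_ j t0) (measurable_funD mau my) _ sy.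
  rewrite mul1r [leRHS]ger0_norm; first exact: kernel_deriv_le_dilation.
  by rewrite addr_ge0// mulr_ge0// (kernel_op_ge0 HK).
rewrite mul1r in ule; rewrite mul1r in aule.
apply: (le_trans ule); apply: (le_trans sle); apply: (lerD aule).
apply: (le_trans Hle); exact: (ler_wpM2l c1 hle).
Qed.

Lemma measurable_lp_norm_kernel_deriv p k : measurable_fun D (fun t => G p k t).
Proof.
have mw : measurable_fun setT (fun z : measurableTypeR R * X =>
    (`|u k z.1 z.2 * (0 < z.1)%R%:R| `^ p)%:E).
  apply/measurable_EFinP; apply: (measurableT_comp (measurable_powR p)).
  by apply: (measurableT_comp (@normr_measurable R setT)); exact: (measurable_kernel_deriv HK intf).
have := @measurable_fun_fubini_tonelli_F _ _ (measurableTypeR R) X R mu _ mw.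
move=> /(_ _)/wrap[]; first by move=> z; rewrite lee_fin powR_ge0.
move=> mF; apply: measurable_lp_norm.
have := @measurable_funTS _ _ _ _ D _ mF.
apply: eq_measurable_fun => t.
rewrite inE/= in_itv/= andbT => t0; rewrite lp_massE; apply: eq_integral => x _.
by rewrite t0 mulr1.
Qed.

Definition besov_integral p k (a q : R) : \bar R :=
  weighted_integral (k%:R - a) q (fun t => G p k t).

Let mG p k := measurable_lp_norm_kernel_deriv p k.

Let G0 p k t : 0 <= G p k t. Proof. exact: lp_norm_ge0. Qed.

Lemma besov_integral_up p k m a q : 1 < p -> 0 < q -> fin p f ->
  (besov_integral p k a q < +oo)%E -> (besov_integral p (k + m) a q < +oo)%E.
Proof.
move=> p1 q0 fy; have [C C0 HC] := lp_norm_kernel_deriv_up k m p1 fy.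
rewrite /besov_integral natrD addrAC.
exact: (weighted_integral_up (mG p (k + m)) (mG p k) (G0 p (k + m)) (G0 p k) q0 C0 HC).
Qed.

(** The a priori decay t^(-j) beats the weight t^(j-a) by the exponent a, which is why a must be
    positive; the factor of absorption is 2^(-(j-a)), whence a < j. *)
Lemma besov_integral_down p j a q : 1 < p -> 1 <= q -> 0 < a -> a < j%:R -> fin p f ->
  (besov_integral p j.+1 a q < +oo)%E -> (besov_integral p j a q < +oo)%E.
Proof.
move=> p1 q1 a0 aj fy; have [B B0 HB] := lp_norm_kernel_deriv j p1 fy.
rewrite /besov_integral -natr1 addrAC; rewrite -subr_gt0 in aj.
apply: (weighted_integral_down (mG p j) (mG p j.+1) (G0 p j) (G0 p j.+1) q1 a0 aj).
  exact: lp_norm_kernel_deriv_down.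
by move=> t t0; rewrite subrK; exact: (HB t t0).2.
Qed.

Lemma besov_integral_descend p j n a q : 1 < p -> 1 <= q -> 0 < a -> a < j%:R -> fin p f ->
  (besov_integral p (j + n) a q < +oo)%E -> (besov_integral p j a q < +oo)%E.
Proof.
move=> p1 q1 a0 aj fy; elim: n => [|n IH]; first by rewrite addn0.
rewrite addnS => h; apply/IH/besov_integral_down; [exact: p1|exact: q1|exact: a0| |exact: fy|exact: h].
by rewrite (lt_le_trans aj)// ler_nat leq_addr.
Qed.

Lemma besov_integral_hoelder p0 p1 q0 q1 a0 a1 theta p q k :
  1 < p0 -> 1 < p1 -> 1 < q0 -> 1 < q1 -> 0 < theta -> theta < 1 ->
  1 / p = (1 - theta) / p0 + theta / p1 -> 1 / q = (1 - theta) / q0 + theta / q1 ->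
  fin p0 f -> fin p1 f ->
  (besov_integral p0 k a0 q0 < +oo)%E -> (besov_integral p1 k a1 q1 < +oo)%E ->
  (besov_integral p k (a0 * (1 - theta) + a1 * theta) q < +oo)%E.
Proof.
move=> p01 p11 q01 q11 t0 t1 pE qE f0 f1.
have [p00 p10] : 0 < p0 /\ 0 < p1 by rewrite (lt_trans _ p01)// (lt_trans _ p11).
have [B0 _ HB0] := lp_norm_kernel_deriv k p01 f0.
have [B1 _ HB1] := lp_norm_kernel_deriv k p11 f1.
apply: (weighted_integral_hoelder (mG p0 k) (mG p1 k) (G0 p0 k) (G0 p1 k) q01 q11 t0 t1 qE
  (mG p k) (G0 p k)).
move=> t s0; have [u0y _] := HB0 t s0; have [u1y _] := HB1 t s0.
exact: (lp_norm_interpolate p00 p10 t0 t1 pE (mu_ k s0) u0y u1y).2.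
Qed.

(** Interpolation takes place at the common order k1, by Hoelder. A positive a is asked for only
    when k < k1, that is, when the order has to be lowered afterwards. *)
Lemma besov_interpolation p0 p1 q0 q1 a0 a1 theta a p q k0 k1 k :
  1 < p0 -> 1 < p1 -> 1 < p -> 1 < q0 -> 1 < q1 -> 1 <= q -> 0 < theta -> theta < 1 ->
  a = a0 * (1 - theta) + a1 * theta ->
  1 / p = (1 - theta) / p0 + theta / p1 -> 1 / q = (1 - theta) / q0 + theta / q1 ->
  fin p0 f -> fin p1 f -> (k0 <= k1)%N -> (k <= k1)%N ->
  a < k%:R -> ((k < k1)%N -> 0 < a) ->
  (besov_integral p0 k0 a0 q0 < +oo)%E -> (besov_integral p1 k1 a1 q1 < +oo)%E ->
  (besov_integral p k a q < +oo)%E.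
Proof.
move=> p01 p11 p1_ q01 q11 q1_ t0 t1 aE pE qE f0 f1 k01 kk1 ak a0_ b0 b1.
have [p00 p10] : 0 < p0 /\ 0 < p1 by rewrite (lt_trans _ p01)// (lt_trans _ p11).
have [fy _] := lp_norm_interpolate p00 p10 t0 t1 pE (L1_measurable intf) f0 f1.
have b0' : (besov_integral p0 k1 a0 q0 < +oo)%E.
  by rewrite -(subnKC k01); apply: (besov_integral_up _ p01 (lt_trans ltr01 q01) f0 b0).
have := besov_integral_hoelder p01 p11 q01 q11 t0 t1 pE qE f0 f1 b0' b1.
rewrite -aE; move: kk1; rewrite leq_eqVlt => /predU1P[->//|kk1].
rewrite -{1}(subnKC (ltnW kk1)); exact: (besov_integral_descend p1_ q1_ (a0_ kk1) ak fy).
Qed.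

End besov_interpolation.

(** * The one-sided stable law of index 1/2 and subordination *)

Section gauss_cdf.
Context {R : realType}.
Implicit Types x : R.

(* The normal law of variance 2: in these terms [stable_density t] is the
   derivative of [a |-> - 2 gauss_cdf (t / sqrt a)]. *)
Definition gauss_pdf x : R := expR (- (x ^+ 2 / 4)) / (2 * Num.sqrt pi).

Definition gauss_cdf x : R :=
  \int[lebesgue_measure]_(t in [set` Interval -oo%O (BRight x)]) gauss_pdf t.

Let s2 : Num.sqrt 2 != 0 :> R. Proof. by rewrite gt_eqF// sqrtr_gt0. Qed.

Let pdfE : gauss_pdf = normal_pdf 0 (Num.sqrt 2).
Proof.
apply/funext => x; rewrite normal_pdfE// /gauss_pdf /normal_peak /normal_fun mulrC subr0.
rewrite sqr_sqrtr//; have -> : 2 * pi *+ 2 = 2 ^+ 2 * pi :> R by ring.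
rewrite sqrtrM ?exprn_ge0// sqrtr_sqr ger0_norm// mulNr.
by have -> : 2 *+ 2 = 4 :> R by ring.
Qed.

(** As a random variable under the normal law, the identity has [gauss_cdf] as distribution
    function; the limits at both infinities are then those of any distribution function. *)
Let X : measurableTypeR R -> R := idfun.

HB.instance Definition _ :=
  @isMeasurableFun.Build _ _ _ _ X (@measurable_id _ _ setT).

Let P := normal_prob (0 : R) (Num.sqrt 2).

Let gauss_cdfE x : cdf (X : {RV P >-> R}) x = (gauss_cdf x)%:E.
Proof.
rewrite /cdf /distribution /pushforward /= /P /normal_prob /gauss_cdf /Rintegral fineK.
  by rewrite pdfE.
rewrite pdfE; apply: (@integrable_fin_num _ _ _ lebesgue_measure).
  exact: measurable_itv.
apply: (@integrableS _ _ _ lebesgue_measure setT) => //.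
exact: integrable_normal_pdf.
Qed.

Lemma cvg_gauss_cdf_pinfty : gauss_cdf x @[x --> +oo] --> (1 : R).
Proof.
have : cdf (X : {RV P >-> R}) x @[x --> +oo] --> 1%E by exact: cvg_cdfy1.
by rewrite (_ : cdf _ = EFin \o gauss_cdf) => [/fine_cvgP[]//|]; apply/funext => x; exact: gauss_cdfE.
Qed.

Lemma cvg_gauss_cdf_ninfty : gauss_cdf x @[x --> -oo] --> (0 : R).
Proof.
have : cdf (X : {RV P >-> R}) x @[x --> -oo] --> 0%E by exact: cvg_cdfNy0.
by rewrite (_ : cdf _ = EFin \o gauss_cdf) => [/fine_cvgP[]//|]; apply/funext => x; exact: gauss_cdfE.
Qed.

Lemma continuous_gauss_pdf : continuous gauss_pdf.
Proof. by rewrite pdfE; exact: continuous_normal_pdf. Qed.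

Lemma is_derive_gauss_cdf x : is_derive x (1 : R) gauss_cdf (gauss_pdf x).
Proof.
have xu : x < x + 1 by rewrite ltrDl.
have intf : lebesgue_measure.-integrable [set` Interval -oo%O (BRight (x + 1))] (EFin \o gauss_pdf).
  apply: (@integrableS _ _ _ lebesgue_measure setT) => //.
  by rewrite pdfE; exact: integrable_normal_pdf.
have cx : {for x, continuous gauss_pdf} by exact: continuous_gauss_pdf.
have [dF F'] : derivable gauss_cdf x 1 /\ derive1 gauss_cdf x = gauss_pdf x.
  apply: (@continuous_FTC1 R gauss_pdf -oo%O x (x + 1) xu intf _ cx).
  by rewrite /= ltNyr.
by apply: DeriveDef => //; rewrite -derive1E.
Qed.

Lemma continuous_gauss_cdf : continuous gauss_cdf.
Proof.
move=> x; apply/differentiable_continuous/derivable1_diffP.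
by have [] := is_derive_gauss_cdf x.
Qed.

(** The density is even, so Phi(x) + Phi(-x) has zero derivative; its constant value is the limit 1
    at infinity. *)
Lemma gauss_cdf0 : gauss_cdf 0 = 2^-1.
Proof.
pose F x := gauss_cdf x + gauss_cdf (- x).
have dF x : is_derive x (1 : R) F 0.
  have d1 := is_derive_gauss_cdf x; have d2 := is_derive_gauss_cdf (- x).
  have dN : is_derive x (1 : R) (-%R : R -> R) (-1) by exact: is_deriveNid.
  have := is_deriveD d1 (@is_derive1_comp _ gauss_cdf (-%R) x _ _ d2 dN).
  by rewrite /gauss_pdf sqrrN mulrN1 subrr.
have Fc x : F x = F 0 by exact: is_derive_0_is_cst.
have : F x @[x --> +oo] --> (1 + 0 : R).
  apply: cvgD; first exact: cvg_gauss_cdf_pinfty.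
  by have := cvg_gauss_cdf_ninfty; rewrite cvgNy_compNP.
have -> : F = cst (F 0) by apply/funext.
rewrite addr0 => /(cvg_unique _ (cvg_cst _)) => /(_ (@Rhausdorff R)) F0.
have : gauss_cdf 0 *+ 2 = 1 by rewrite mulr2n -F0 /F oppr0.
by rewrite -[_ *+ 2]mulr_natr => h; apply: (mulIf (_ : 2 != 0 :> R)); rewrite ?h ?mulVf// pnatr_eq0.
Qed.

End gauss_cdf.

Section stable_density.
Context {R : realType}.
Implicit Types s t a : R.
Local Notation D := (`]0%R, +oo[%classic : set (measurableTypeR R)).

Lemma stable_densityE t s : 0 < s ->
  stable_density t s = t * gauss_pdf (t / Num.sqrt s) / (s * Num.sqrt s).
Proof.
move=> s0; have ss : 0 < Num.sqrt s by rewrite sqrtr_gt0.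
have p0 : 0 < Num.sqrt pi :> R by rewrite sqrtr_gt0 pi_gt0.
rewrite /stable_density /gauss_pdf expr_div_n sqr_sqrtr ?(ltW s0)//.
have -> : s `^ (3 / 2) = s * Num.sqrt s.
  rewrite -powR12_sqrt ?(ltW s0)// -{2}(powRr1 (ltW s0)) -powRD ?(gt_eqF s0) ?implybT//.
  by congr (_ `^ _); field.
have -> : t ^+ 2 / s / 4 = t ^+ 2 / (4 * s) by field; rewrite gt_eqF.
by field; rewrite !gt_eqF.
Qed.

Lemma stable_density_ge0 t s : 0 <= t -> 0 <= stable_density t s.
Proof.
by move=> t0; rewrite mulr_ge0 ?divr_ge0 ?mulr_ge0 ?expR_ge0 ?powR_ge0 ?sqrtr_ge0.
Qed.

Lemma continuous_stable_density t s : 0 < s -> {for s, continuous (stable_density t)}.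
Proof.
move=> s0; have sn : s != 0 by rewrite gt_eqF.
have cp (b : R) : {for s, continuous (fun s : R => s `^ b)}.
  apply/differentiable_continuous/derivable1_diffP.
  by have [] := is_derive_powR b s0.
apply: cvgM; first exact: cvg_cst.
apply: cvgM; last by apply: cvgV; [rewrite gt_eqF// powR_gt0|exact: cp].
apply: (@cvg_comp _ _ _ (fun s : R => - (t ^+ 2 / (4 * s))) expR _ (nbhs (- (t ^+ 2 / (4 * s))))).
  apply: cvgN; apply: cvgM; first exact: cvg_cst.
  apply: cvgV; first by rewrite mulf_neq0.
  by apply: cvgM; [exact: cvg_cst|exact: cvg_id].
exact: continuous_expR.
Qed.

Lemma measurable_stable_density t : measurable_fun D (stable_density t).
Proof.
apply: open_continuous_measurable_fun; first exact: interval_open.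
by move=> s; rewrite inE/= in_itv/= andbT => s0; exact: continuous_stable_density.
Qed.

Lemma integral_stable_density t : 0 < t ->
  (\int[lebesgue_measure]_(s in `]0%R, +oo[) (stable_density t s)%:E = 1)%E.
Proof.
move=> t0.
(* Here -1 and -2 are the limits of the primitive -2 Phi(t / sqrt s) at infinity and at 0. *)
have -> : (1 = (-1 - (-2))%:E :> \bar R)%E by congr (_%:E); ring.
apply: (@ge0_FTC_itv0y _ _ (fun s => -2 * gauss_cdf (t / Num.sqrt s))).
- by move=> s s0; rewrite stable_density_ge0// ltW.
- by move=> s; exact: continuous_stable_density.
- move=> s s0; have ss : 0 < Num.sqrt s by rewrite sqrtr_gt0.
  have sn : Num.sqrt s != 0 by rewrite gt_eqF.
  have d1 := is_derive1_sqrt s0.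
  have d2 := @is_deriveV R (fun s => Num.sqrt s) s _ (1 : R) sn d1.
  have d3 := @is_derive1_comp _ (gauss_cdf) (fun s : R => t * (Num.sqrt s)^-1) s _ _
    (is_derive_gauss_cdf _) (is_deriveZ t d2).
  apply: (is_derive_eq (is_deriveZ (-2) d3)); rewrite stable_densityE// /GRing.scale/=.
  rewrite (_ : s * Num.sqrt s = Num.sqrt s ^+ 3); first by field.
  by rewrite exprSr sqr_sqrtr// ltW.
- have -> : -1 = -2 * gauss_cdf 0 :> R by rewrite gauss_cdf0 mulNr mulfV ?pnatr_eq0.
  apply: cvgM; first exact: cvg_cst.
  apply: (@cvg_comp _ _ _ (fun s : R => t / Num.sqrt s) gauss_cdf _ (nbhs (0 : R))); last exact: continuous_gauss_cdf.
  have -> : nbhs (0 : R) = nbhs (t * 0 : R) by rewrite mulr0.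
  apply: cvgM; first exact: cvg_cst.
  have : s `^ (- 2^-1) @[s --> +oo%R] --> (0 : R) by apply: cvg_powR_pinfty.
  apply: cvg_trans; apply: near_eq_cvg; near=> s.
  have s0 : 0 < s by near: s; exact: nbhs_pinfty_gt.
  by rewrite powRN powR12_sqrt// ltW.
- rewrite -[X in _ --> X]mulr1; apply: cvgM; first exact: cvg_cst.
  apply: (@cvg_comp _ _ _ (fun s : R => t / Num.sqrt s) gauss_cdf _ (pinfty_nbhs R)); last exact: cvg_gauss_cdf_pinfty.
  apply/cvgryPge => A; near=> s.
  have s0 : 0 < s by near: s; exact: nbhs_right_gt.
  have A0 : 0 < `|A| + 1 by rewrite ltr_wpDl.
  apply: (@le_trans _ _ (`|A| + 1)); first by rewrite (le_trans (ler_norm A))// lerDl.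
  rewrite ler_pdivlMr ?sqrtr_gt0// mulrC -ler_pdivlMr//.
  have c0 : 0 < t / (`|A| + 1) by rewrite divr_gt0.
  rewrite -[leRHS]ger0_norm ?(ltW c0)// -sqrtr_sqr ler_wsqrtr//.
  by near: s; apply: nbhs_right_le; rewrite exprn_gt0// divr_gt0// ltr_wpDl.
Unshelve. all: by end_near. Qed.

End stable_density.

(** * The stable densities form a convolution semigroup *)

Section stable_convolution.
Context {R : realType}.
Variables s t sigma : R.
Hypotheses (s0 : 0 < s) (t0 : 0 < t) (sigma0 : 0 < sigma).
Implicit Types a : R.

Let S := Num.sqrt sigma.

Let S0 : 0 < S. Proof. by rewrite sqrtr_gt0. Qed.

Let w a := Num.sqrt ((sigma - a) / a).

(* The exponents of h_s(a) and h_t(sigma - a) add up to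
   - (s + t)^2 / (4 sigma) - z(a)^2 / 4, and y^2 = z^2 + 4 s t / sigma. *)
Let z a := (s * w a - t / w a) / S.

Let y a := (s * w a + t / w a) / S.

(** A primitive of h_s(a) h_t(sigma - a). The factor exp(st / sigma) gives the derivatives of Phi(z)
    and Phi(y) the same Gaussian factor. With A = sqrt a and B = sqrt (sigma - a), their rational
    parts are proportional to s B^2 + t A^2 and s B^2 - t A^2, and the coefficients -(s + t) and s -
    t combine these into the constant 2 s t sigma. *)
Let prim a := gauss_pdf ((s + t) / S) / S ^+ 3 *
  (- (s + t) * gauss_cdf (z a) + (s - t) * expR (s * t / sigma) * gauss_cdf (y a)).

Let cvg_lin (c d : R) : 0 < c ->
  (c * Num.sqrt n.+2%:R + d / Num.sqrt n.+2%:R) / S @[n --> \oo] --> +oo.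
Proof.
move=> c0; apply/cvgryPge => A; near=> n.
pose r : R := Num.sqrt n.+2%:R.
have r1 : 1 <= r by rewrite -[leLHS]sqrtr1 ler_wsqrtr// ler1n.
have r0 : 0 < r by exact: lt_le_trans r1.
have n1 : 0 <= (`|A| * S + `|d|) / c by rewrite divr_ge0 ?addr_ge0 ?mulr_ge0 ?(ltW S0) ?(ltW c0).
have nr : (`|A| * S + `|d|) / c <= r.
  rewrite -[leLHS]ger0_norm// -sqrtr_sqr ler_wsqrtr//.
  apply: (@le_trans _ _ n%:R); last by rewrite ler_nat leqW.
  by near: n; exact: nbhs_infty_ger.
rewrite ler_pdivlMr// (@le_trans _ _ (`|A| * S))//; first by rewrite ler_wpM2r ?ler_norm// ltW.
rewrite ler_pdivrMr// in nr; rewrite [c * _]mulrC -lerBlDr (le_trans _ nr)// lerD2l.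
rewrite (le_trans (ler_norm _))// normrN normrM normfV -/r (ger0_norm (ltW r0)).
by rewrite ler_pdivrMr// ler_peMr.
Unshelve. all: by end_near. Qed.

Let sqrt_w a A B : 0 < A -> 0 < B -> a = A ^+ 2 -> sigma - a = B ^+ 2 -> w a = B / A.
Proof.
move=> A0 B0 aE bE; rewrite /w bE aE -expr_div_n sqrtr_sqr ger0_norm// divr_ge0 ?(ltW A0) ?(ltW B0)//.
Qed.

Let prim_derive a : 0 < a -> a < sigma ->
  is_derive a (1 : R) prim (stable_density s a * stable_density t (sigma - a)).
Proof.
move=> a0 asig; have b0 : 0 < sigma - a by rewrite subr_gt0.
pose A := Num.sqrt a; pose B := Num.sqrt (sigma - a).
have A0 : 0 < A by rewrite sqrtr_gt0.
have B0 : 0 < B by rewrite sqrtr_gt0.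
have aE : a = A ^+ 2 by rewrite sqr_sqrtr// ltW.
have bE : sigma - a = B ^+ 2 by rewrite sqr_sqrtr// ltW.
have sE : sigma = S ^+ 2 by rewrite sqr_sqrtr// ltW.
have SE : S ^+ 2 = A ^+ 2 + B ^+ 2 by rewrite -aE -bE -sE addrC subrK.
have wE : w a = B / A by exact: sqrt_w.
have w0 : w a != 0 by rewrite wE gt_eqF ?divr_gt0.
have an : a != 0 by rewrite gt_eqF.
pose dw : R := - S ^+ 2 / (2 * A ^+ 3 * B).
have Dw : is_derive a (1 : R) w dw.
  have i0 : is_derive a (1 : R) (fun a => a) 1 by exact: is_derive_id.
  have i1 := @is_deriveV R (fun a => a) a _ (1 : R) an i0.
  have i2 : is_derive a (1 : R) (fun a => sigma - a) (0 - 1).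
    by apply: is_deriveB.
  have q0 : 0 < (sigma - a) / a by rewrite divr_gt0.
  have := @is_derive1_comp _ Num.sqrt (fun a => (sigma - a) / a) a _ _ (is_derive1_sqrt q0) (is_deriveM i2 i1).
  move=> h; apply: (is_derive_eq h); rewrite -/(w a) wE /GRing.scale/= /dw.
  rewrite bE aE SE; field; by rewrite !gt_eqF.
pose dv : R := - (w a) ^- 2 * dw.
have Dv : is_derive a (1 : R) (fun a => (w a)^-1) dv.
  by have := @is_deriveV R w a _ (1 : R) w0 Dw.
have Dz : is_derive a (1 : R) z ((s * dw - t * dv) / S).
  have h : is_derive a (1 : R) (fun a => S^-1 * (s * w a - t * (w a)^-1)) (S^-1 * (s * dw - t * dv)).
    exact: (is_deriveZ _ (is_deriveB (is_deriveZ s Dw) (is_deriveZ t Dv))).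
  rewrite [_ / S]mulrC; rewrite (_ : z = fun a => S^-1 * (s * w a - t * (w a)^-1))//.
  by apply/funext => x; rewrite /z mulrC.
have Dy : is_derive a (1 : R) y ((s * dw + t * dv) / S).
  have h : is_derive a (1 : R) (fun a => S^-1 * (s * w a + t * (w a)^-1)) (S^-1 * (s * dw + t * dv)).
    exact: (is_deriveZ _ (is_deriveD (is_deriveZ s Dw) (is_deriveZ t Dv))).
  rewrite [_ / S]mulrC; rewrite (_ : y = fun a => S^-1 * (s * w a + t * (w a)^-1))//.
  by apply/funext => x; rewrite /y mulrC.
have D1 := is_derive1_comp (is_derive_gauss_cdf (z a)) Dz.
have D2 := is_derive1_comp (is_derive_gauss_cdf (y a)) Dy.
have D := is_deriveZ (gauss_pdf ((s + t) / S) / S ^+ 3)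
  (is_deriveD (is_deriveZ (- (s + t)) D1) (is_deriveZ ((s - t) * expR (s * t / sigma)) D2)).
apply: (is_derive_eq D); rewrite /GRing.scale/=.
have p0 : 0 < Num.sqrt pi :> R by rewrite sqrtr_gt0 pi_gt0.
have gy : expR (s * t / sigma) * gauss_pdf (y a) = gauss_pdf (z a).
  rewrite /gauss_pdf mulrA -expRD; congr (expR _ / _).
  rewrite /y /z wE sE; field; by rewrite !gt_eqF.
have gz : gauss_pdf ((s + t) / S) * gauss_pdf (z a) = gauss_pdf (s / A) * gauss_pdf (t / B).
  rewrite /gauss_pdf mulrACA [RHS]mulrACA -!expRD; congr (expR _ * _).
  have Sn : S ^+ 2 != 0 by rewrite gt_eqF// exprn_gt0.
  have -> : - (((s + t) / S) ^+ 2 / 4) - (z a ^+ 2 / 4) =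
    - ((s + t) ^+ 2 + (s * (B / A) - t / (B / A)) ^+ 2) / (4 * S ^+ 2).
    rewrite /z wE; field; by rewrite !gt_eqF.
  rewrite SE in Sn *; field; by rewrite !gt_eqF ?addr_gt0 ?exprn_gt0.
have Es : stable_density s a = s * gauss_pdf (s / A) / (A ^+ 2 * A).
  by rewrite stable_densityE// -/A -aE.
have Et : stable_density t (sigma - a) = t * gauss_pdf (t / B) / (B ^+ 2 * B).
  by rewrite stable_densityE// -/B -bE.
have -> : stable_density s a * stable_density t (sigma - a) =
  gauss_pdf (s / A) * gauss_pdf (t / B) * (s * t / (A ^+ 3 * B ^+ 3)).
  rewrite Es Et; field; by rewrite !gt_eqF.
rewrite -gz -gy.
have -> : dv = - (A / B) ^+ 2 * dw by rewrite /dv wE; field; rewrite !gt_eqF.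
rewrite /dw.
set E := expR _; set G := gauss_pdf (y a); set G' := gauss_pdf _.
have key : (s + t) * (s * B ^+ 2 + t * A ^+ 2) - (s - t) * (s * B ^+ 2 - t * A ^+ 2) =
  2 * s * t * S ^+ 2 by rewrite SE; ring.
have -> : G' * (E * G) * (s * t / (A ^+ 3 * B ^+ 3)) =
  G' * E * G * (2 * s * t * S ^+ 2) / (2 * A ^+ 3 * B ^+ 3 * S ^+ 2).
  by field; rewrite !gt_eqF.
rewrite -key; field; by rewrite !gt_eqF.
Qed.

(** The end points sigma / (n+3) and sigma - sigma / (n+3) are chosen so that (sigma - a) / a is n+2
    at the first and its inverse at the second; z and y then reduce to the form treated by
    [cvg_lin]. *)
Let w_x n : w (sigma / n.+3%:R) = Num.sqrt n.+2%:R.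
Proof.
rewrite /w; congr (Num.sqrt _).
have : n.+2%:R + 1 != 0 :> R by rewrite natr1 pnatr_eq0.
rewrite -[n.+3%:R]natr1; move: (n.+2%:R : R) => N N1; field.
by rewrite N1 gt_eqF.
Qed.

Let w_y n : w (sigma - sigma / n.+3%:R) = (Num.sqrt n.+2%:R)^-1.
Proof.
rewrite /w -sqrtrV//; congr (Num.sqrt _); rewrite subKr.
have : n.+2%:R + 1 != 0 :> R by rewrite natr1 pnatr_eq0.
have : n.+2%:R != 0 :> R by rewrite pnatr_eq0.
rewrite -[n.+3%:R]natr1; move: (n.+2%:R : R) => N N0 N1; field.
by rewrite N1 N0 mulrDr mulr1 addrK mulf_neq0// gt_eqF.
Qed.

Let itv0_bigcup : `]0, sigma[%classic =
  \bigcup_n `[(sigma / n.+3%:R : R), sigma - sigma / n.+3%:R]%classic.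
Proof.
apply/seteqP; split => a; rewrite /= in_itv/=.
  move=> /andP[a0 asig]; have b0 : 0 < sigma - a by rewrite subr_gt0.
  exists (maxn (Num.truncn (sigma / a)) (Num.truncn (sigma / (sigma - a)))) => //=; rewrite in_itv/=.
  set N := maxn _ _.
  have le c : 0 < c -> (Num.truncn (sigma / c) <= N)%N -> sigma / N.+3%:R <= c.
    move=> c0 cN; rewrite ler_pdivrMr// mulrC -ler_pdivrMr//.
    by rewrite ltW// (lt_le_trans (truncnS_gt _))// ler_nat ltnS (leq_trans cN)// leqW// leqW.
  by rewrite le ?leq_maxl//= lerBrDr -lerBrDl le// leq_maxr.
move=> [n _] /=; rewrite !in_itv/= => /andP[na an].
have n0 : 0 < sigma / n.+3%:R by rewrite divr_gt0.
by rewrite (lt_le_trans n0 na) (le_lt_trans an)// ltrBlDr ltrDl.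
Qed.

Lemma stable_density_convolution :
  (\int[lebesgue_measure]_(a in `]0%R, sigma[) (stable_density s a * stable_density t (sigma - a))%:E =
   (stable_density (s + t) sigma)%:E)%E.
Proof.
pose c : R := gauss_pdf ((s + t) / S) / S ^+ 3; pose E := expR (s * t / sigma).
(* As a tends to sigma, z tends to minus infinity and y to plus infinity; as a tends to 0, both tend
   to plus infinity. The terms in Phi(y) cancel and leave c (s + t). *)
have lE : stable_density (s + t) sigma = c * (- (s + t) * 0 + (s - t) * E * 1) - c * (- (s + t) * 1 + (s - t) * E * 1).
  rewrite stable_densityE// -/S /c.
  have -> : sigma * S = S ^+ 3 by rewrite exprSr sqr_sqrtr// ltW.
  by field; rewrite gt_eqF.
rewrite lE; set l := c * (_ + _ * 1); set m := c * _.
have x_lt (n : nat) : sigma / n.+3%:R < sigma - sigma / n.+3%:R.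
  rewrite ltrBrDr -mulrDl ltr_pdivrMr// -mulr2n -[ltLHS]mulr_natr ltr_pM2l//.
  by rewrite ltr_nat.
have x_le (n : nat) : sigma / n.+4%:R <= sigma / n.+3%:R.
  by rewrite ler_pM2l// lef_pV2 ?posrE// ler_nat.
have r0 (n : nat) : 0 < Num.sqrt n.+2%:R :> R by rewrite sqrtr_gt0.
apply: (@ge0_FTC_bigcup R (fun a => stable_density s a * stable_density t (sigma - a)) prim
  (fun n => sigma / n.+3%:R) (fun n => sigma - sigma / n.+3%:R) l m _ itv0_bigcup).
- exact: x_le.
- by move=> n; rewrite lerD2l lerN2 x_le.
- exact: x_lt.
- by move=> a; rewrite /= in_itv/= => /andP[a0 asig]; rewrite mulr_ge0 ?stable_density_ge0 ?(ltW s0) ?(ltW t0).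
- move=> a; rewrite /= in_itv/= => /andP[a0 asig]; apply: cvgM.
    exact: continuous_stable_density.
  apply: (@cvg_comp _ _ _ (fun a => sigma - a) (stable_density t) _ (nbhs (sigma - a))).
    by apply: cvgB; [exact: cvg_cst|exact: cvg_id].
  by apply: continuous_stable_density; rewrite subr_gt0.
- by move=> a; rewrite /= in_itv/= => /andP[a0 asig]; exact: prim_derive.
- apply: cvgM; first exact: cvg_cst.
  apply: cvgD; (apply: cvgM; first exact: cvg_cst).
    apply: (@cvg_comp _ _ _ (fun n : nat => z (sigma - sigma / n.+3%:R)) gauss_cdf _ (ninfty_nbhs R)); last exact: cvg_gauss_cdf_ninfty.
    have -> : (fun n : nat => z (sigma - sigma / n.+3%:R)) =
      (fun n : nat => - ((t * Num.sqrt n.+2%:R + (- s) / Num.sqrt n.+2%:R) / S)).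
      apply/funext => n; rewrite /z w_y invrK; field; by rewrite !gt_eqF.
    by have /cvgNrNy := cvg_lin (- s) t0; apply.
  apply: (@cvg_comp _ _ _ (fun n : nat => y (sigma - sigma / n.+3%:R)) gauss_cdf _ (pinfty_nbhs R)); last exact: cvg_gauss_cdf_pinfty.
  have -> : (fun n : nat => y (sigma - sigma / n.+3%:R)) =
    (fun n : nat => (t * Num.sqrt n.+2%:R + s / Num.sqrt n.+2%:R) / S).
    apply/funext => n; rewrite /y w_y invrK; field; by rewrite !gt_eqF.
  exact: cvg_lin.
- apply: cvgM; first exact: cvg_cst.
  apply: cvgD; (apply: cvgM; first exact: cvg_cst).
    apply: (@cvg_comp _ _ _ (fun n : nat => z (sigma / n.+3%:R)) gauss_cdf _ (pinfty_nbhs R)); last exact: cvg_gauss_cdf_pinfty.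
    have -> : (fun n : nat => z (sigma / n.+3%:R)) =
      (fun n : nat => (s * Num.sqrt n.+2%:R + (- t) / Num.sqrt n.+2%:R) / S).
      by apply/funext => n; rewrite /z w_x mulNr.
    exact: cvg_lin.
  apply: (@cvg_comp _ _ _ (fun n : nat => y (sigma / n.+3%:R)) gauss_cdf _ (pinfty_nbhs R)); last exact: cvg_gauss_cdf_pinfty.
  have -> : (fun n : nat => y (sigma / n.+3%:R)) =
    (fun n : nat => (s * Num.sqrt n.+2%:R + t / Num.sqrt n.+2%:R) / S).
    by apply/funext => n; rewrite /y w_x.
  exact: cvg_lin.
Qed.

End stable_convolution.

(** * Dependence of the stable density on time *)

Section stable_pdf.
Context {R : realType}.
Implicit Types s t a : R.
Local Notation D := (`]0%R, +oo[%classic : set (measurableTypeR R)).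

(* stable_density itself is not zero at negative times. *)
Definition stable_pdf t : measurableTypeR R -> R :=
  fun a => if 0 < a then stable_density t a else 0.

Lemma stable_pdf_ge0 t a : 0 <= t -> 0 <= stable_pdf t a.
Proof. by rewrite /stable_pdf; case: ifP => // _ /stable_density_ge0. Qed.

Let mD : measurable D. Proof. exact: measurable_itv. Qed.

Lemma stable_pdf_patch t : stable_pdf t = (stable_density t : measurableTypeR R -> R) \_ D.
Proof.
apply/funext => a; rewrite patchE /stable_pdf.
have -> : (a \in D) = (0 < a) by apply/idP/idP; rewrite inE/= in_itv/= andbT.
by [].
Qed.

Lemma measurable_stable_pdf t : measurable_fun setT (stable_pdf t).
Proof.
by rewrite stable_pdf_patch; apply/(measurable_restrictT _ mD); exact: measurable_stable_density.
Qed.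

Lemma integral_stable_pdf_mul t (g : measurableTypeR R -> R) :
  (\int[lebesgue_measure]_a (g a * stable_pdf t a)%:E =
   \int[lebesgue_measure]_(a in `]0%R, +oo[) (g a * stable_density t a)%:E)%E.
Proof.
rewrite [RHS]integral_mkcond; apply: eq_integral => a _; rewrite patchE /stable_pdf.
have -> : (a \in D) = (0 < a) by apply/idP/idP; rewrite inE/= in_itv/= andbT.
by case: ifP; rewrite // mulr0.
Qed.

Lemma integral_stable_pdf t : 0 < t -> (\int[lebesgue_measure]_a (stable_pdf t a)%:E = 1)%E.
Proof.
move=> t0; rewrite -(integral_stable_density t0).
under eq_integral do rewrite -[stable_pdf t _]mul1r.
by rewrite (integral_stable_pdf_mul t (cst 1)); under eq_integral do rewrite mul1r.
Qed.

Lemma integral_stable_pdf_shift s t sigma : 0 < s -> 0 < t ->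
  (\int[lebesgue_measure]_a (stable_pdf s a * stable_pdf t (sigma - a))%:E =
   (stable_pdf (s + t) sigma)%:E)%E.
Proof.
move=> s0 t0; rewrite {3}/stable_pdf; case: ifPn => [sig0|].
  rewrite -(stable_density_convolution s0 t0 sig0) [RHS]integral_mkcond.
  apply: eq_integral => a _; rewrite patchE /stable_pdf subr_gt0.
  have -> : (a \in (`]0%R, sigma[%classic : set (measurableTypeR R))) = (0 < a) && (a < sigma).
    by apply/idP/idP; rewrite inE/= in_itv.
  by case: (0 < a) => /=; case: (a < sigma); rewrite ?mul0r ?mulr0.
rewrite -leNgt => sig0; apply: integral0_eq => a _.
rewrite /stable_pdf subr_gt0; case: ifPn => [a0|]; last by rewrite mul0r.
by rewrite ltNge (le_trans sig0 (ltW a0))/= mulr0.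
Qed.

(** For fixed a the translation a + b -> b isolates G, and Tonelli leaves the convolution of the
    densities as inner integral. *)
Lemma stable_convolution s t (G : measurableTypeR R -> R) : 0 < s -> 0 < t ->
  measurable_fun setT G -> (forall a, 0 <= G a) ->
  (\int[lebesgue_measure]_a \int[lebesgue_measure]_b
     (G (a + b)%R * (stable_pdf s a * stable_pdf t b))%:E =
   \int[lebesgue_measure]_a (G a * stable_pdf (s + t) a)%:E)%E.
Proof.
move=> s0 t0 mG G0.
have h0 a := stable_pdf_ge0 a (ltW s0); have h1 a := stable_pdf_ge0 a (ltW t0).
have mh u := measurable_stable_pdf u.
pose F (z : measurableTypeR R * measurableTypeR R) : R :=
  G z.2 * (stable_pdf s z.1 * stable_pdf t (z.2 - z.1)).
have mF : measurable_fun setT (EFin \o F).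
  apply/measurable_EFinP; apply: measurable_funM.
    exact: (measurableT_comp mG).
  apply: measurable_funM; first exact: (measurableT_comp (mh s)).
  apply: (measurableT_comp (mh t)).
  by apply: measurable_funB.
have F0 z : (0 <= (EFin \o F) z)%E by rewrite lee_fin !mulr_ge0.
transitivity (\int[lebesgue_measure]_a \int[lebesgue_measure]_b (F (a, b))%:E)%E.
  apply: eq_integral => a _.
  have mFa : measurable_fun setT (fun b => (F (a, b))%:E).
    exact: (measurableT_comp mF (pair1_measurable a)).
  rewrite [RHS](@ge0_integral_affine R 1 a ltr01 setT (fun b => (F (a, b))%:E))//; last first.
    by move=> b _; exact: (F0 (a, b)).
  rewrite preimage_setT mul1e; apply: eq_integral => b _.
  by rewrite /F /affine_map /= mul1r addrK [b + a]addrC.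
rewrite (@fubini_tonelli _ _ (measurableTypeR R) (measurableTypeR R) R lebesgue_measure lebesgue_measure _ mF F0).
apply: eq_integral => b _; rewrite /F /=; under eq_integral do rewrite EFinM.
rewrite ge0_integralZl//.
- by rewrite integral_stable_pdf_shift// -EFinM.
- apply/measurable_EFinP; apply: measurable_funM => //.
  by apply: (measurableT_comp (mh t)); exact: measurable_funB.
- by move=> x _; rewrite lee_fin mulr_ge0.
- by rewrite lee_fin.
Qed.

Definition stable_amplitude a : R := (2 * Num.sqrt pi)^-1 / a `^ (3 / 2).

Let amp_ge0 a : 0 <= stable_amplitude a.
Proof. by rewrite divr_ge0 ?powR_ge0// invr_ge0 mulr_ge0 ?sqrtr_ge0. Qed.

Let stable_pdfE t a : 0 < a -> stable_pdf t a = t * expR (- (t ^+ 2 / (4 * a))) * stable_amplitude a.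
Proof. by move=> a0; rewrite /stable_pdf a0 /stable_density /stable_amplitude mulrACA -!mulrA; congr (_ * _); rewrite mulrCA. Qed.

(** Divided by t, the density depends on t only through exp(-t^2 / (4a)), which decreases in t. This
    is the origin of [K_mono]. *)
Lemma stable_pdf_mono s t a : 0 < s -> s <= t -> s * stable_pdf t a <= t * stable_pdf s a.
Proof.
move=> s0 st; have t0 := lt_le_trans s0 st.
have [a0|a0] := ltP 0 a; last by rewrite /stable_pdf ltNge a0 !mulr0.
rewrite !stable_pdfE//; set e1 := expR _; set e2 := expR _.
have -> : s * (t * e1 * stable_amplitude a) = s * t * stable_amplitude a * e1 by ring.
have -> : t * (s * e2 * stable_amplitude a) = s * t * stable_amplitude a * e2 by ring.
apply: ler_wpM2l; first by apply: mulr_ge0 => //; rewrite ltW// mulr_gt0.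
rewrite ler_expR lerN2 ler_wpM2r ?invr_ge0 ?mulr_ge0 ?(ltW a0)//.
by rewrite lerXn2r ?nnegrE ?(ltW s0) ?(ltW t0).
Qed.

Definition stable_pdf_deriv t a : R := (t^-1 - t / (2 * a)) * stable_pdf t a.

Lemma is_derive_stable_pdf t a : 0 < t ->
  is_derive t (1 : R) (fun t => stable_pdf t a) (stable_pdf_deriv t a).
Proof.
move=> t0; have [a0|a0] := ltP 0 a; last first.
  have -> : (fun t => stable_pdf t a) = cst 0.
    by apply/funext => u; rewrite /stable_pdf ltNge a0.
  rewrite /stable_pdf_deriv /stable_pdf ltNge a0/= mulr0; exact: is_derive_cst.
have -> : (fun t => stable_pdf t a) = (fun t => stable_amplitude a * (t * expR (- (4 * a)^-1 * t ^+ 2))).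
  by apply/funext => u; rewrite stable_pdfE// mulrC mulNr [_^-1 * _]mulrC.
have i0 : is_derive t (1 : R) (fun t : R => t) 1 by exact: is_derive_id.
have i1 : is_derive t (1 : R) (fun t : R => t ^+ 2) (2 * t).
  have h := is_deriveX 2 i0; apply: (is_derive_eq h).
  by rewrite /GRing.scale/= mulr1 expr1.
have i2 := @is_derive1_comp _ expR (fun t : R => - (4 * a)^-1 * t ^+ 2) t _ _
  (is_derive_expR _) (is_deriveZ (- (4 * a)^-1) i1).
have h := is_deriveZ (stable_amplitude a) (is_deriveM i0 i2).
apply: (is_derive_eq h); rewrite /stable_pdf_deriv stable_pdfE// /GRing.scale/=.
have -> : - (t ^+ 2 / (4 * a)) = - (4 * a)^-1 * t ^+ 2 by rewrite mulNr mulrC.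
by field; rewrite !gt_eqF.
Qed.

(** With x = t^2 / (4a) the derivative is (1 - 2x) exp(-x) times the amplitude, and |1 - 2x| <= 3 (1
    + 3x/4) <= 3 exp(3x/4). What remains, exp(-x/4), is at most the exponential in the density at
    time s / 2 because s <= t; the factor s / 2 of that density turns 3 into 6 / s. *)
Lemma stable_pdf_deriv_le s t a : 0 < s -> s <= t ->
  `|stable_pdf_deriv t a| <= 6 / s * stable_pdf (s / 2) a.
Proof.
move=> s0 st; have t0 := lt_le_trans s0 st.
have [a0|a0] := ltP 0 a; last first.
  by rewrite /stable_pdf_deriv /stable_pdf ltNge a0/= !mulr0 normr0.
pose x := t ^+ 2 / (4 * a).
have x0 : 0 <= x by rewrite divr_ge0 ?exprn_ge0 ?mulr_ge0 ?(ltW t0) ?(ltW a0).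
have -> : stable_pdf_deriv t a = (1 - 2 * x) * expR (- x) * stable_amplitude a.
  by rewrite /stable_pdf_deriv stable_pdfE// -/x {2}/x; field; rewrite !gt_eqF.
have -> : 6 / s * stable_pdf (s / 2) a = 3 * expR (- ((s / 2) ^+ 2 / (4 * a))) * stable_amplitude a.
  by rewrite stable_pdfE//; field; rewrite gt_eqF.
rewrite normrM (ger0_norm (amp_ge0 a)) ler_wpM2r ?amp_ge0// normrM (ger0_norm (expR_ge0 _)).
have sx : (s / 2) ^+ 2 / (4 * a) <= x / 4.
  rewrite /x [t ^+ 2 / _ / 4]mulrAC ler_wpM2r ?invr_ge0 ?mulr_ge0 ?(ltW a0)//.
  rewrite expr_div_n (_ : 2 ^+ 2 = 4 :> R); last by rewrite -natrX.
  by rewrite ler_wpM2r ?invr_ge0// lerXn2r ?nnegrE ?(ltW s0) ?(ltW t0).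
apply: (@le_trans _ _ (3 * expR (- (x / 4)))); last first.
  by rewrite ler_wpM2l// ler_expR lerN2.
have e1 := expR_ge1Dx (3 / 4 * x).
have -> : expR (- x) = expR (- (x / 4)) / expR (3 / 4 * x).
  by rewrite -expRN -expRD; congr expR; field.
rewrite mulrA ler_pdivrMr ?expR_gt0// [leLHS]mulrC [leRHS]mulrAC [leRHS]mulrC ler_wpM2l ?expR_ge0//.
rewrite (@le_trans _ _ (1 + 2 * x))//; first by rewrite ler_norml; apply/andP; split; lra.
rewrite (@le_trans _ _ (3 * (1 + 3 / 4 * x)))//; last by rewrite ler_wpM2l.
by lra.
Qed.

Lemma stable_pdf_lip s t a : 0 < s -> s <= t ->
  `|stable_pdf t a - stable_pdf s a| <= 6 * ((t - s) / s) * stable_pdf (s / 2) a.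
Proof.
move=> s0; rewrite le_eqVlt => /predU1P[->|st].
  by rewrite !subrr normr0 mul0r mulr0 mul0r.
have [|y|z zt ->] := @MVT _ (fun t => stable_pdf t a) (fun t => stable_pdf_deriv t a) s t st.
- by move=> y; rewrite in_itv/= => /andP[sy _]; apply: is_derive_stable_pdf; exact: lt_trans sy.
- apply: derivable_within_continuous => {}y; rewrite in_itv/= => /andP[sy _].
  by have [] := @is_derive_stable_pdf y a (lt_le_trans s0 sy).
move: zt; rewrite in_itv/= => /andP[sz _].
have ts : 0 < t - s by rewrite subr_gt0.
rewrite normrM (ger0_norm (ltW ts)) (_ : 6 * _ * _ = 6 / s * stable_pdf (s / 2) a * (t - s)); last by ring.
by rewrite ler_wpM2r ?(ltW ts)// stable_pdf_deriv_le// ltW.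
Qed.

(** Passing from t to t / 2 frees exp(-k / a) with k = t^2/4 - t^2/16 = 3 t^2 / 16, which absorbs
    any power of 1 / a. It is shared among d+1 factors, never zero in number: 1 + 1/a <= (1 + 1/e)(1
    + e/a) <= c exp(e / a). This compensates the blow-up of a heat kernel at small times. *)
Lemma stable_pdf_pole_le d t : 0 < t -> exists2 C, 0 <= C & forall a,
  (1 + a^-1) ^+ d * stable_pdf t a <= C * stable_pdf (t / 2) a.
Proof.
move=> t0; pose k := 3 * t ^+ 2 / 16; have k0 : 0 < k by rewrite divr_gt0// mulr_gt0// exprn_gt0.
pose e := k / d.+1%:R; have e0 : 0 < e by rewrite divr_gt0.
pose c := 1 + e^-1; have c0 : 0 < c by rewrite addr_gt0// invr_gt0.
exists (2 * c ^+ d.+1); first by rewrite mulr_ge0// exprn_ge0// ltW.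
move=> a; have [a0|a0] := ltP 0 a; last by rewrite /stable_pdf ltNge a0/= !mulr0.
have ai : 0 < a^-1 by rewrite invr_gt0.
rewrite !stable_pdfE//.
have -> : expR (- (t ^+ 2 / (4 * a))) = expR (- ((t / 2) ^+ 2 / (4 * a))) / expR (k / a).
  by rewrite -expRN -expRD; congr expR; rewrite /k; field; rewrite gt_eqF.
have le : (1 + a^-1) ^+ d <= c ^+ d.+1 * expR (k / a).
  apply: (@le_trans _ _ ((1 + a^-1) ^+ d.+1)).
    by rewrite exprS ler_peMl ?exprn_ge0 ?addr_ge0 ?(ltW ai)// lerDl ltW.
  have -> : expR (k / a) = expR (e / a) ^+ d.+1.
    rewrite -expRM_natl; congr expR; rewrite /e mulrA [_ * (k / _)]mulrC divfK//.
  rewrite -exprMn lerXn2r ?nnegrE ?addr_ge0 ?mulr_ge0 ?expR_ge0 ?(ltW ai) ?(ltW c0)//.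
  apply: (@le_trans _ _ (c * (1 + e / a))); last by rewrite ler_wpM2l ?expR_ge1Dx ?(ltW c0).
  have -> : c * (1 + e / a) = 1 + a^-1 + (e^-1 + e / a) by rewrite /c; field; rewrite !gt_eqF.
  by rewrite lerDl addr_ge0 ?(ltW (divr_gt0 e0 a0))// invr_ge0 ltW.
set E := expR (- _); move: (amp_ge0 a); move: (stable_amplitude a) => A A0.
have -> : (1 + a^-1) ^+ d * (t * (E / expR (k / a)) * A) =
  (t * E * A) * ((1 + a^-1) ^+ d / expR (k / a)) by ring.
have -> : 2 * c ^+ d.+1 * (t / 2 * E * A) = (t * E * A) * c ^+ d.+1 by field.
apply: ler_wpM2l; last by rewrite ler_pdivrMr ?expR_gt0.
by rewrite mulr_ge0// mulr_ge0 ?expR_ge0// ltW.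
Qed.

End stable_pdf.

(** [M_bound] is uniform in y but leaves an arbitrary weight in x: the Mehler kernel is unbounded in
    x, and bounds at each fixed x are what subordination needs. [M_ge0] and [M_meas] concern all
    real times because the time integrals are taken over the whole line, with [stable_pdf] vanishing
    on the nonpositive part. *)
Record heat_kernel_spec {d} {X : measurableType d} {R : realType} (mu : probability X R)
    (M : R -> X -> X -> R) : Prop := HeatKernelSpec {
  M_ge0 : forall s x y, 0 <= M s x y ;
  M_meas : measurable_fun setT
    (fun z : measurableTypeR R * (X * X) => M z.1 z.2.1 z.2.2) ;
  M_sym : forall s x y, 0 < s -> M s x y = M s y x ;
  M_mass : forall s x, 0 < s -> (\int[mu]_y (M s x y)%:E = 1)%E ;
  M_comp : forall s t x y, 0 < s -> 0 < t ->
    (\int[mu]_z (M s x z * M t z y)%:E = (M (s + t) x y)%:E)%E ;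
  M_bound : exists n (W : X -> R), (forall x, 0 <= W x) /\
    forall s x y, 0 < s -> M s x y <= W x * (1 + s^-1) ^+ n }.

(** * Subordination of a heat kernel *)

Section subordination.
Context {d} {X : measurableType d} {R : realType}.
Variables (mu : probability X R) (M : R -> X -> X -> R).
Hypothesis HM : heat_kernel_spec mu M.
Implicit Types (s t a b : R) (x y : X).
Local Notation L1 f := (mu.-integrable setT (EFin \o f)).
Local Notation leb := (@lebesgue_measure R).

Definition subordinate t x y : R := \int[leb]_s (M s x y * stable_pdf t s).
Local Notation K := subordinate.

Let M0 s x y : 0 <= M s x y. Proof. exact: (M_ge0 HM). Qed.

Let h0 t s : 0 < t -> 0 <= stable_pdf t s.
Proof. by move=> t0; rewrite stable_pdf_ge0// ltW. Qed.

Let mh t : measurable_fun setT (stable_pdf t : measurableTypeR R -> R) := measurable_stable_pdf t.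

Let mMs x y : measurable_fun setT (fun s : measurableTypeR R => M s x y).
Proof. exact: (measurableT_comp (M_meas HM) (pair2_measurable (x, y))). Qed.

Let mMy s x : measurable_fun setT (M s x).
Proof.
apply: (measurableT_comp (M_meas HM) (g := fun y => (s : measurableTypeR R, (x, y)))).
by apply: measurable_fun_pair => //; exact: pair1_measurable.
Qed.

Let mMh t x y : measurable_fun setT (fun s : measurableTypeR R => (M s x y * stable_pdf t s)%:E).
Proof. by apply/measurable_EFinP; exact: measurable_funM. Qed.

Let mMsy x : measurable_fun setT (fun z : measurableTypeR R * X => M z.1 x z.2).
Proof.
apply: (measurableT_comp (M_meas HM) (g := fun z : measurableTypeR R * X => (z.1, (x, z.2)))).
by apply: measurable_fun_pair => //; apply: measurable_fun_pair.
Qed.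

Let weight_lty n t : 0 < t -> exists2 C, 0 <= C &
  forall (k : measurableTypeR R -> R), measurable_fun setT k -> (forall s, 0 <= k s) ->
  forall A, 0 <= A -> (forall s, 0 < s -> k s <= A * (1 + s^-1) ^+ n) ->
  (\int[leb]_s (k s * stable_pdf t s)%:E <= (A * C)%:E)%E.
Proof.
move=> t0; have [C C0 HC] := stable_pdf_pole_le n t0; exists C => // k mk k0 A A0 kA.
have t20 : 0 < t / 2 by rewrite divr_gt0.
apply: (@le_trans _ _ (\int[leb]_s ((A * C)%:E * (stable_pdf (t / 2) s)%:E))%E).
  apply: ge0_le_integral => //.
  - by move=> s _; rewrite lee_fin mulr_ge0 ?h0.
  - by apply/measurable_EFinP; exact: measurable_funM.
  - by apply: measurable_funeM; apply/measurable_EFinP.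
  move=> s _; rewrite lee_fin; have [s0|s0] := ltP 0 s; last first.
    by rewrite /stable_pdf ltNge s0/= !mulr0.
  apply: (@le_trans _ _ (A * (1 + s^-1) ^+ n * stable_pdf t s)).
    by rewrite ler_wpM2r ?h0 ?kA.
  by rewrite -!mulrA ler_wpM2l.
rewrite ge0_integralZl//; first by rewrite integral_stable_pdf// mule1.
- exact/measurable_EFinP.
- by move=> s _; rewrite lee_fin h0.
- by rewrite lee_fin mulr_ge0.
Qed.

Let int_le t x : 0 < t -> exists2 C, 0 <= C & forall y,
  (\int[leb]_s (M s x y * stable_pdf t s)%:E <= C%:E)%E.
Proof.
have [n [W [W0 HW]]] := M_bound HM => /(weight_lty n) [C C0 HC].
exists (W x * C); first by rewrite mulr_ge0.
by move=> y; apply: HC => // s s0; exact: HW.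
Qed.

Lemma subordinateE t x y : 0 < t ->
  (K t x y)%:E = (\int[leb]_s (M s x y * stable_pdf t s)%:E)%E.
Proof.
move=> t0; have [C _ HC] := int_le x t0.
rewrite /subordinate /Rintegral fineK// ge0_fin_numE ?(le_lt_trans (HC y)) ?ltry//.
by apply: integral_ge0 => s _; rewrite lee_fin mulr_ge0 ?h0.
Qed.

Lemma subordinate_ge0 t x y : 0 < t -> 0 <= K t x y.
Proof. by move=> t0; apply: Rintegral_ge0 => s _; rewrite mulr_ge0 ?h0. Qed.

Lemma measurable_subordinate t : 0 < t -> measurable_fun setT (fun z : X * X => K t z.1 z.2).
Proof.
move=> t0; have mF : measurable_fun setT (fun z : measurableTypeR R * (X * X) =>
    (M z.1 z.2.1 z.2.2 * stable_pdf t z.1)%:E).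
  apply/measurable_EFinP; apply: measurable_funM; first exact: (M_meas HM).
  exact: (measurableT_comp (mh t)).
have := @measurable_fun_fubini_tonelli_G _ _ (measurableTypeR R) (X * X)%type R leb _ mF.
move=> /(_ _)/wrap[]; first by move=> z; rewrite lee_fin mulr_ge0 ?h0.
by move=> mG; exact: (measurableT_comp (@fine_measurable _ _ _) mG).
Qed.

Lemma subordinate_mass t x : 0 < t -> (\int[mu]_y (K t x y)%:E = 1)%E.
Proof.
move=> t0; under eq_integral do rewrite subordinateE//.
have mF : measurable_fun setT (fun z : measurableTypeR R * X => (M z.1 x z.2 * stable_pdf t z.1)%:E).
  apply/measurable_EFinP; apply: measurable_funM => //.
  exact: (measurableT_comp (mh t)).
rewrite -(@fubini_tonelli _ _ (measurableTypeR R) X R leb mu _ mF)/=; last first.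
  by move=> z; rewrite lee_fin mulr_ge0 ?h0.
rewrite -(integral_stable_pdf t0); apply: eq_integral => s _.
under eq_integral do rewrite EFinM; rewrite ge0_integralZr//.
- rewrite /stable_pdf; case: ifPn => s0; last by rewrite mule0.
  by rewrite (M_mass HM)// mul1e.
- exact/measurable_EFinP.
- by move=> y _; rewrite lee_fin.
- by rewrite lee_fin h0.
Qed.

(** Two exchanges by Tonelli make z the innermost variable; [M_comp] then yields M at time a + b,
    and the two stable densities convolve. *)
Lemma subordinate_comp s t x y : 0 < s -> 0 < t ->
  (\int[mu]_z (K s x z * K t z y)%:E = (K (s + t) x y)%:E)%E.
Proof.
move=> s0 t0.
have mMz : measurable_fun setT (fun z : measurableTypeR R * X => M z.1 z.2 y).
  apply: (measurableT_comp (M_meas HM) (g := fun z : measurableTypeR R * X => (z.1, (z.2, y)))).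
  by apply: measurable_fun_pair => //; apply: measurable_fun_pair.
pose F a z b : R := M a x z * stable_pdf s a * (M b z y * stable_pdf t b).
have F0 a z b : 0 <= F a z b by rewrite /F !mulr_ge0 ?h0.
have KE z : (K t z y)%:E = (\int[leb]_b (M b z y * stable_pdf t b)%:E)%E by rewrite subordinateE.
transitivity (\int[mu]_z \int[leb]_a ((M a x z * stable_pdf s a)%:E * (K t z y)%:E))%E.
  apply: eq_integral => z _; rewrite ge0_integralZr//.
  - by rewrite -subordinateE// EFinM.
  - by move=> a _; rewrite lee_fin mulr_ge0 ?h0.
  - by rewrite lee_fin subordinate_ge0.
have mKz : measurable_fun setT (fun z => K t z y).
  by apply: (measurableT_comp (measurable_subordinate t0) (g := fun z => (z, y))); exact: pair2_measurable.
have mF1 : measurable_fun setT (fun z : measurableTypeR R * X =>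
    ((M z.1 x z.2 * stable_pdf s z.1)%:E * (K t z.2 y)%:E)%E).
  apply: emeasurable_funM; apply/measurable_EFinP.
    by apply: measurable_funM => //; exact: (measurableT_comp (mh s)).
  exact: (measurableT_comp mKz).
rewrite -(@fubini_tonelli _ _ (measurableTypeR R) X R leb mu _ mF1)/=; last first.
  by move=> z; rewrite mule_ge0// lee_fin ?mulr_ge0 ?h0 ?subordinate_ge0.
transitivity (\int[leb]_a \int[mu]_z \int[leb]_b (F a z b)%:E)%E.
  apply: eq_integral => a _; apply: eq_integral => z _; rewrite KE -ge0_integralZl//.
  - by move=> b _; rewrite lee_fin mulr_ge0 ?h0.
  - by rewrite lee_fin mulr_ge0 ?h0.
transitivity (\int[leb]_a \int[leb]_b \int[mu]_z (F a z b)%:E)%E.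
  apply: eq_integral => a _.
  have mF2 : measurable_fun setT (fun z : measurableTypeR R * X => (F a z.2 z.1)%:E).
    apply/measurable_EFinP; apply: measurable_funM.
      by apply: measurable_funM => //; exact: (measurableT_comp (mMy a x)).
    by apply: measurable_funM => //; exact: (measurableT_comp (mh t)).
  have := @fubini_tonelli _ _ (measurableTypeR R) X R leb mu _ mF2.
  by move=> /(_ _)/wrap[]; [move=> z; rewrite lee_fin|move=> h; exact: esym].
transitivity (\int[leb]_a \int[leb]_b (M (a + b)%R x y * (stable_pdf s a * stable_pdf t b))%:E)%E.
  apply: eq_integral => a _; apply: eq_integral => b _.
  have [a0|a0] := ltP 0 a; last first.
    have -> : stable_pdf s a = 0 by rewrite /stable_pdf ltNge a0.
    rewrite mul0r mulr0; apply: integral0_eq => z _.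
    by rewrite /F /stable_pdf (ltNge 0 a) a0/= mulr0 mul0r.
  have [b0|b0] := ltP 0 b; last first.
    have -> : stable_pdf t b = 0 by rewrite /stable_pdf ltNge b0.
    rewrite mulr0 mulr0; apply: integral0_eq => z _.
    by rewrite /F /stable_pdf (ltNge 0 b) b0/= mulr0 mulr0.
  under eq_integral do rewrite /F mulrACA EFinM.
  rewrite ge0_integralZr//.
  - by rewrite (M_comp HM)// -EFinM.
  - apply/measurable_EFinP; apply: measurable_funM => //.
    exact: (measurableT_comp mMz (pair1_measurable (b : measurableTypeR R))).
  - by move=> z _; rewrite lee_fin mulr_ge0.
  - by rewrite lee_fin mulr_ge0 ?h0.
rewrite (@stable_convolution R s t (fun a => M a x y) s0 t0)//.
by rewrite subordinateE// addr_gt0.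
Qed.

Let Kle c1 c2 t1 t2 x y : 0 < t1 -> 0 < t2 -> 0 <= c1 -> 0 <= c2 ->
  (forall a, c1 * stable_pdf t1 a <= c2 * stable_pdf t2 a) -> c1 * K t1 x y <= c2 * K t2 x y.
Proof.
move=> t10 t20 c10 c20 le; rewrite -lee_fin !EFinM !subordinateE//.
have E c t : 0 <= c -> 0 < t -> (c%:E * \int[leb]_s (M s x y * stable_pdf t s)%:E =
    \int[leb]_s (c * (M s x y * stable_pdf t s))%:E)%E.
  move=> c0 t0; rewrite -ge0_integralZl//; last by move=> s _; rewrite lee_fin mulr_ge0 ?h0.
rewrite !E//; apply: ge0_le_integral => //.
- by move=> s _; rewrite lee_fin !mulr_ge0 ?h0.
- by apply/measurable_EFinP; apply: measurable_funM => //; apply: measurable_funM.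
- by apply/measurable_EFinP; apply: measurable_funM => //; apply: measurable_funM.
by move=> s _; rewrite lee_fin mulrCA [leRHS]mulrCA ler_wpM2l.
Qed.

Lemma subordinate_lip s t x y : 0 < s -> s <= t ->
  `|K t x y - K s x y| <= 6 * ((t - s) / s) * K (s / 2) x y.
Proof.
move=> s0 st; have t0 := lt_le_trans s0 st; have s20 : 0 < s / 2 by rewrite divr_gt0.
have intK r : 0 < r -> leb.-integrable setT (fun a => (M a x y * stable_pdf r a)%:E).
  move=> r0; apply/integrableP; split => //.
  under eq_integral do rewrite gee0_abs ?lee_fin ?mulr_ge0 ?h0//.
  by rewrite -subordinateE// ltry.
rewrite -RintegralB//; [|exact: intK..].
have c0 : 0 <= 6 * ((t - s) / s).
  by rewrite mulr_ge0// divr_ge0 ?(ltW s0)// subr_ge0.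
have mD : measurable_fun setT (fun a : measurableTypeR R => M a x y * stable_pdf t a - M a x y * stable_pdf s a).
  by apply: measurable_funB; apply: measurable_funM.
apply: (@le_trans _ _ (\int[leb]_a `|M a x y * stable_pdf t a - M a x y * stable_pdf s a|)).
  apply: le_normr_Rintegral => //; exact: integrableB (intK _ t0) (intK _ s0).
rewrite /subordinate -RintegralZl//; last exact: intK.
apply: le_Rintegral => //.
- by apply: integrable_norm; exact: integrableB (intK _ t0) (intK _ s0).
- exact: integrableZl (intK _ s20).
move=> a _; rewrite -mulrBr normrM (ger0_norm (M0 _ _ _)) mulrCA ler_wpM2l//.
exact: stable_pdf_lip.
Qed.

Section operator.
Variables (f : X -> R) (x : X).
Hypothesis intf : L1 f.

Let F t (z : measurableTypeR R * X) : R := M z.1 x z.2 * f z.2 * stable_pdf t z.1.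

Let mF t : measurable_fun setT (F t).
Proof.
apply: measurable_funM; last exact: (measurableT_comp (mh t)).
by apply: measurable_funM => //; exact: (measurableT_comp (L1_measurable intf)).
Qed.

(** Integrated in y first, the modulus is at most W(x) (1 + 1/s)^n times the L^1 norm of f, and the
    stable density absorbs this pole. Integrability on the product permits both orders of
    integration and differentiation under a single integral. *)
Lemma subordinate_prod_integrable t : 0 < t ->
  (leb \x mu)%E.-integrable setT (EFin \o F t).
Proof.
move=> t0; apply/integrable12ltyP; first exact/measurable_EFinP.
have [n [W [W0 HW]]] := M_bound HM; have [C C0 HC] := weight_lty n t0.
have mf := L1_measurable intf.
have mnf : measurable_fun setT (fun y => `|f y|%:E).
  by apply/measurable_EFinP; exact: (measurableT_comp (@normr_measurable R setT)).
pose N := fine (\int[mu]_y `|f y|%:E).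
have NE : (\int[mu]_y `|f y|%:E = N%:E)%E.
  rewrite fineK// ge0_fin_numE; last by apply: integral_ge0 => y _; rewrite lee_fin.
  by case/integrableP: intf.
have N0 : 0 <= N by rewrite fine_ge0//; apply: integral_ge0 => y _; rewrite lee_fin.
pose k (s : measurableTypeR R) : \bar R := (\int[mu]_y (M s x y * `|f y|)%:E)%E.
have mMf : measurable_fun setT (fun z : measurableTypeR R * X => (M z.1 x z.2 * `|f z.2|)%:E).
  apply/measurable_EFinP; apply: measurable_funM => //.
  by apply: (measurableT_comp (@normr_measurable R setT)); exact: (measurableT_comp mf).
have mk : measurable_fun setT k.
  have := @measurable_fun_fubini_tonelli_F _ _ (measurableTypeR R) X R mu _ mMf.
  by apply; move=> z; rewrite lee_fin mulr_ge0.
have k0 s : (0 <= k s)%E by apply: integral_ge0 => y _; rewrite lee_fin mulr_ge0.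
have kle s : 0 < s -> (k s <= (W x * N * (1 + s^-1) ^+ n)%:E)%E.
  move=> s0; apply: (@le_trans _ _ (\int[mu]_y ((W x * (1 + s^-1) ^+ n)%:E * `|f y|%:E))%E).
    apply: ge0_le_integral => //.
    - by move=> y _; rewrite lee_fin mulr_ge0.
    - exact: (measurableT_comp mMf (pair1_measurable (s : measurableTypeR R))).
    - exact: measurable_funeM.
    by move=> y _; rewrite lee_fin ler_wpM2r ?HW.
  rewrite ge0_integralZl//; first by rewrite NE -EFinM mulrAC.
  by rewrite lee_fin mulr_ge0// exprn_ge0// addr_ge0// invr_ge0 ltW.
apply: (@le_lt_trans _ _ (\int[leb]_s (fine (k s) * stable_pdf t s)%:E)%E); last first.
  apply: le_lt_trans (ltry (W x * N * C)); apply: HC.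
  - exact: (measurableT_comp (@fine_measurable _ _ _)).
  - by move=> s; rewrite fine_ge0.
  - by rewrite mulr_ge0.
  move=> s s0; have ks : k s \is a fin_num by rewrite ge0_fin_numE// (le_lt_trans (kle s s0))// ltry.
  by rewrite -lee_fin fineK ?kle.
rewrite le_eqVlt; apply/orP; left; apply/eqP; apply: eq_integral => s _ /=.
have [s0|s0] := ltP 0 s; last first.
  rewrite [in RHS]/stable_pdf ltNge s0/= mulr0; apply: integral0_eq => y _.
  by rewrite /F /stable_pdf /= ltNge s0 mulr0 normr0.
have ks : k s \is a fin_num by rewrite ge0_fin_numE// (le_lt_trans (kle s s0))// ltry.
rewrite EFinM fineK// -ge0_integralZr//.
- apply: eq_integral => y _; rewrite /F/= !normrM (ger0_norm (M0 _ _ _)) (ger0_norm (h0 _ t0)).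
  by rewrite -EFinM.
- exact: (measurableT_comp mMf (pair1_measurable (s : measurableTypeR R))).
- by move=> y _; rewrite lee_fin mulr_ge0.
- by rewrite lee_fin h0.
Qed.

Lemma kernel_op_subordinateE t : 0 < t ->
  (kernel_op mu K t f x)%:E = (\int[leb \x mu]_z (F t z)%:E)%E.
Proof.
move=> t0; have intF := subordinate_prod_integrable t0.
have E y : (\int[leb]_s (F t (s, y))%:E = (K t x y * f y)%:E)%E.
  rewrite EFinM subordinateE// -integralZr//.
    by apply: eq_integral => s _; rewrite /F /= mulrAC EFinM.
  apply/integrableP; split => //.
  under eq_integral do rewrite gee0_abs ?lee_fin ?mulr_ge0 ?h0//.
  by rewrite -subordinateE// ltry.
rewrite -(integral21_prod_meas1 intF) /kernel_op /Rintegral.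
transitivity (\int[mu]_y (K t x y * f y)%:E)%E; last first.
  by apply: eq_integral => y _; rewrite -E.
rewrite fineK//; apply: integrable_fin_num => //.
have [C _ HC] := int_le x t0.
apply: (@L1_le _ _ _ _ _ (fun y => C * `|f y|)).
- apply: measurable_funM; last exact: (L1_measurable intf).
  by apply: (measurableT_comp (measurable_subordinate t0) (g := pair x)); exact: pair1_measurable.
- move=> y; rewrite normrM ler_wpM2r// ger0_norm ?subordinate_ge0//.
  by rewrite -lee_fin subordinateE.
- by apply: L1Z; exact: integrable_norm.
Qed.

Lemma kernel_op_subordinate12 t : 0 < t ->
  (kernel_op mu K t f x)%:E =
  (\int[leb]_s \int[mu]_y (M s x y * f y * stable_pdf t s)%:E)%E.
Proof.
by move=> t0; rewrite kernel_op_subordinateE// -(integral12_prod_meas1 (subordinate_prod_integrable t0)).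
Qed.

(** Differentiation takes place under the product integral, for times between t / 2 and 2t. There
    [stable_pdf_deriv_le] based at t / 2 gives a majorant free of the time, a multiple of the
    integrand at time t / 4. *)
Lemma kernel_op_subordinate_derivable t : 0 < t -> derivable (fun u => kernel_op mu K u f x) t 1.
Proof.
move=> t0; pose G (z : measurableTypeR R * X) : R := `|6 / (t / 2) * F (t / 2 / 2) z|.
have t20 : 0 < t / 2 by rewrite divr_gt0.
have It : `]t / 2, 2 * t[%classic t by rewrite /= in_itv/=; apply/andP; split; lra.
have I0 s : `]t / 2, 2 * t[%classic s -> t / 2 < s by rewrite /= in_itv/= => /andP[].
have dF (u : R) z : 0 < u -> is_derive u (1 : R) (fun v : R => F v z) (M z.1 x z.2 * f z.2 * stable_pdf_deriv u z.1).
  by move=> u0; exact: (is_deriveZ _ (is_derive_stable_pdf z.1 u0)).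
have := @derivable_under_integral R _ _ (leb \x mu)%E (fun u z => F u z) setT measurableT t (t / 2) (2 * t) It _ _ G _ _ _.
move=> /(_ _)/wrap[]; first by move=> u /I0 u0; apply: subordinate_prod_integrable; exact: lt_trans u0.
move=> /(_ _)/wrap[].
  by move=> u z /I0 u0 _; have [] := dF u z (lt_trans t20 u0).
move=> /(_ _)/wrap[]; first by move=> z; rewrite /G.
move=> /(_ _)/wrap[].
  apply: integrable_norm; apply: (integrableZl measurableT _ (subordinate_prod_integrable _)).
  by rewrite divr_gt0.
move=> /(_ _)/wrap[].
  move=> u z /I0 u0 _; have [_ dE] := dF u z (lt_trans t20 u0).
  have E : 6 / (t / 2) * F (t / 2 / 2) z =
    M z.1 x z.2 * f z.2 * (6 / (t / 2) * stable_pdf (t / 2 / 2) z.1) by rewrite /F; ring.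
  rewrite partial1of2E dE /G E normrM [leRHS]normrM ler_wpM2l//.
  by rewrite (le_trans (stable_pdf_deriv_le z.1 t20 (ltW u0)))// ler_norm.
apply: near_eq_derivable => //.
near=> u; have u0 : 0 < u by near: u; exact: lt_nbhsr.
by rewrite /Rintegral -kernel_op_subordinateE.
Unshelve. all: by end_near. Qed.

End operator.

Theorem subordinate_spec : poisson_kernel_spec mu K.
Proof.
split.
- by move=> t x y; exact: subordinate_ge0.
- exact: measurable_subordinate.
- move=> t x y t0; apply: EFin_inj; rewrite !subordinateE//; apply: eq_integral => s _.
  rewrite /stable_pdf; case: ifPn => s0; last by rewrite !mulr0.
  by rewrite (M_sym HM).
- exact: subordinate_mass.
- exact: subordinate_comp.
- move=> t x t0; have [C _ HC] := int_le x t0; exists C => y.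
  by rewrite -lee_fin subordinateE.
- move=> s t x y s0 st; have t0 := lt_le_trans s0 st.
  by apply: Kle => //; rewrite ?ltW// => a; exact: stable_pdf_mono.
- by exists 6 => s t x y s0 st _; exact: subordinate_lip.
- by move=> f x t intf t0; exact: kernel_op_subordinate_derivable.
Qed.

End subordination.

(** * The Mehler kernel and the Gaussian spaces *)

Section density.
Context {d} {X : measurableType d} {R : realType}.
Variables (mu nu : {measure set X -> \bar R}) (w : X -> R).
Hypotheses (mw : measurable_fun setT w) (w0 : forall x, 0 <= w x).
Hypothesis nuE : forall A, measurable A -> nu A = (\int[mu]_(x in A) (w x)%:E)%E.

Let density_indic (A : set X) : measurable A ->
  (\int[nu]_x (\1_A x)%:E = \int[mu]_x ((\1_A x)%:E * (w x)%:E))%E.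
Proof.
move=> mA; rewrite integral_indic// setIT nuE// integral_mkcond.
apply: eq_integral => x _; rewrite patchE indicE; case: ifPn => _; first by rewrite mul1e.
by rewrite mul0e.
Qed.

Import HBNNSimple.

Let density_nnsfun (f : {nnsfun X >-> R}) :
  (\int[nu]_x (f x)%:E = \int[mu]_x ((f x)%:E * (w x)%:E))%E.
Proof.
have w0E x : (0 <= (w x)%:E)%E by rewrite lee_fin.
have mwE : measurable_fun setT (EFin \o w) by exact/measurable_EFinP.
have mr r : measurable_fun setT (fun x => (r * \1_(f @^-1` [set r]) x)%:E).
  by apply/measurable_EFinP/measurableT_comp.
under [LHS]eq_integral do rewrite fimfunE -fsumEFin//.
rewrite [LHS]ge0_integral_fsum//; last first.
  by move=> n x _; rewrite EFinM nnfun_muleindic_ge0.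
under [RHS]eq_integral.
  move=> x xD; rewrite fimfunE -fsumEFin// muleC ge0_mule_fsumr; last first.
    by move=> r; rewrite EFinM nnfun_muleindic_ge0.
  over.
rewrite [RHS]ge0_integral_fsum//; last 2 first.
  - by move=> r; exact: emeasurable_funM.
  - by move=> n x _; rewrite mule_ge0// EFinM nnfun_muleindic_ge0.
apply: eq_fsbigr => r _.
have [r0|r0] := leP 0 r; last first.
  have -> : f @^-1` [set r] = set0.
    by apply/seteqP; split => // x /= fx; move: r0; rewrite -fx ltNge fun_ge0.
  by rewrite !integral0_eq// => x _; rewrite indic0 ?mulr0 ?mule0.
have mE : measurable (f @^-1` [set r]) by exact: measurable_funPTI.
under eq_integral do rewrite EFinM; rewrite ge0_integralZl//; first last.
- by apply/measurable_EFinP.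
rewrite density_indic// -ge0_integralZl//.
- by apply: eq_integral => x _; rewrite [RHS]muleC EFinM muleA.
- by apply: emeasurable_funM => //; exact/measurable_EFinP.
- by move=> x _; rewrite mule_ge0// lee_fin.
Qed.

Lemma ge0_integral_density (f : X -> \bar R) : measurable_fun setT f ->
  (forall x, (0 <= f x)%E) -> (\int[nu]_x f x = \int[mu]_x (f x * (w x)%:E))%E.
Proof.
move=> mf f0; pose f_ := nnsfun_approx measurableT mf.
have mwE : measurable_fun setT (EFin \o w) by exact/measurable_EFinP.
transitivity (lim (\int[nu]_x (f_ n x)%:E @[n --> \oo])%E).
  rewrite -monotone_convergence//=.
  - apply: eq_integral => ? /[!inE] xD; apply/esym/cvg_lim => //=.
    exact: cvg_nnsfun_approx.
  - by move=> n; exact/measurable_EFinP/measurable_funTS.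
  - by move=> n ? _; rewrite lee_fin.
  - by move=> ? _ ? ? mn; rewrite lee_fin; exact/lefP/nd_nnsfun_approx.
transitivity (lim (\int[mu]_x ((f_ n x)%:E * (w x)%:E) @[n --> \oo])%E).
  by apply: congr_lim; apply/funext => n; exact: density_nnsfun.
rewrite -monotone_convergence//=.
- apply: eq_integral => x _; apply/cvg_lim => //=.
  apply: cvgeZr => //; exact: cvg_nnsfun_approx.
- move=> n; apply: emeasurable_funM => //; exact/measurable_EFinP.
- by move=> n x _; rewrite mule_ge0// lee_fin.
- move=> x _ m n mn; rewrite lee_wpmul2r ?lee_fin//.
  exact/lefP/nd_nnsfun_approx.
Qed.

End density.

(** * Gaussian integrals and the Mehler kernel *)

Section gauss_integral.
Context {R : realType}.
Implicit Types n : nat.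

Lemma ge0_integral_gauss n (F : n.-tuple R -> \bar R) : measurable_fun setT F ->
  (forall x, (0 <= F x)%E) ->
  (\int[@gauss_measure R n]_x F x = \int[lebesgue_tuple n]_x (F x * (gauss_density x)%:E))%E.
Proof.
move=> mF F0; apply: ge0_integral_density => //.
- exact: measurable_gauss_density.
- exact: gauss_density_ge0.
Qed.

Definition gauss1 (a : R) : R := pi `^ (- 2^-1) * gauss_fun a.

Lemma gauss1_ge0 a : 0 <= gauss1 a.
Proof. by rewrite mulr_ge0 ?powR_ge0 ?gauss_fun_ge0. Qed.

Lemma measurable_gauss1 : measurable_fun [set: measurableTypeR R] gauss1.
Proof. by apply: measurable_funM => //; exact: measurable_gauss_fun. Qed.

Lemma ge0_integral_gauss_cons n (F : n.+1.-tuple R -> \bar R) : measurable_fun setT F ->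
  (forall x, (0 <= F x)%E) ->
  (\int[@gauss_measure R n.+1]_x F x =
   \int[lebesgue_measure]_a ((gauss1 a)%:E * \int[@gauss_measure R n]_x F (cons_pair (a, x))))%E.
Proof.
move=> mF F0.
have mg m : measurable_fun setT (fun x : m.-tuple R => (gauss_density x)%:E).
  by apply/measurable_EFinP; exact: measurable_gauss_density.
have g0 m (x : m.-tuple R) : (0 <= (gauss_density x)%:E)%E by rewrite lee_fin gauss_density_ge0.
have mFc : measurable_fun setT (fun z : measurableTypeR R * n.-tuple R => F (cons_pair z)).
  exact: (measurableT_comp mF (@measurable_cons_pair R n)).
rewrite ge0_integral_gauss//= /lebesgue_cons.
rewrite (@ge0_integral_pushforward _ _ _ _ _ _ (@measurable_cons_pair R n)
  (@lebesgue_measure R \x lebesgue_tuple n)%E setT)//=; first last.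
- by move=> x _; rewrite mule_ge0.
- exact: (emeasurable_funM mF (mg n.+1)).
rewrite fubini_tonelli1//=; first last.
- by move=> x; rewrite mule_ge0.
- apply: emeasurable_funM => //.
  exact: (measurableT_comp (mg _) (@measurable_cons_pair R n)).
apply: eq_integral => a _; rewrite /fubini_F/=.
have mFa : measurable_fun setT (fun x => F (cons_pair (a, x))).
  exact: (measurableT_comp mFc (pair1_measurable (a : measurableTypeR R))).
rewrite ge0_integral_gauss// -ge0_integralZl//.
- apply: eq_integral => x _; rewrite gauss_density_cons /= EFinM -/(gauss1 a).
  by rewrite muleA muleAC muleC muleA.
- exact: (emeasurable_funM mFa (mg n)).
- by move=> x _; rewrite mule_ge0.
- by rewrite lee_fin gauss1_ge0.
Qed.

Lemma integral_gauss_prod n (h : 'I_n -> R -> R) (c : 'I_n -> R) :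
  (forall i, measurable_fun [set: measurableTypeR R] (h i)) -> (forall i a, 0 <= h i a) ->
  (forall i, \int[lebesgue_measure]_a (gauss1 a * h i a)%:E = (c i)%:E)%E ->
  (\int[@gauss_measure R n]_x (\prod_(i < n) h i (tnth x i))%:E = (\prod_(i < n) c i)%:E)%E.
Proof.
elim: n h c => [|n IH] h c mh h0 hc.
  under eq_integral do rewrite big_ord0.
  by have := integral_cst (@gauss_measure R 0) measurableT 1 => /= ->; rewrite big_ord0 gauss_measure_setT mule1.
have mp (m : nat) (k : 'I_m -> R -> R) : (forall i, measurable_fun [set: measurableTypeR R] (k i)) ->
    measurable_fun setT (fun x : m.-tuple R => (\prod_(i < m) k i (tnth x i))%:E).
  move=> mk; apply/measurable_EFinP; apply: measurable_prod => i _.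
  exact: (measurableT_comp (mk i) (measurable_tnth i)).
have p0 (m : nat) (k : 'I_m -> R -> R) (x : m.-tuple R) : (forall i a, 0 <= k i a) ->
    (0 <= (\prod_(i < m) k i (tnth x i))%:E)%E.
  by move=> k0; rewrite lee_fin; apply: prodr_ge0.
rewrite ge0_integral_gauss_cons//; [|exact: mp|by move=> x; exact: p0].
pose h' i := h (lift ord0 i); pose c' i := c (lift ord0 i).
have E a : (\int[@gauss_measure R n]_x (\prod_(i < n.+1) h i (tnth (cons_pair (a, x)) i))%:E =
    (h ord0 a)%:E * (\prod_(i < n) c' i)%:E)%E.
  rewrite -(IH h' c') => [|i|i a0|i]; [|exact: mh|exact: h0|exact: hc].
  rewrite -ge0_integralZl//.
  - apply: eq_integral => x _; rewrite big_ord_recl EFinM; congr (_ * _)%E.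
    by congr (_%:E); apply: eq_bigr => i _; rewrite tnthS.
  - by apply: mp => i; exact: mh.
  - by move=> x _; apply: p0 => i b; exact: h0.
  - by rewrite lee_fin.
under eq_integral do rewrite E muleA.
rewrite ge0_integralZr//.
- by rewrite big_ord_recl EFinM -hc; congr (_ * _)%E; apply: eq_integral => a _; rewrite EFinM.
- apply: emeasurable_funM; apply/measurable_EFinP; [exact: measurable_gauss1|exact: mh].
- by move=> a _; rewrite mule_ge0// lee_fin ?gauss1_ge0.
- rewrite lee_fin; apply: prodr_ge0 => i _; rewrite -lee_fin -hc.
  by apply: integral_ge0 => a _; rewrite lee_fin mulr_ge0 ?gauss1_ge0.
Qed.

Lemma integral_gauss_shift (m A : R) : 0 < A ->
  (\int[lebesgue_measure]_z (pi `^ (- 2^-1) * A `^ (- 2^-1) * expR (- ((z - m) ^+ 2 / A)))%:E = 1)%E.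
Proof.
move=> A0; pose c := A `^ (- 2^-1); have c0 : 0 < c by rewrite powR_gt0.
have c2 : c ^+ 2 = A^-1.
  by rewrite -powR_mulrn ?powR_ge0// -powRrM mulNr mulVf ?pnatr_eq0// powR_inv1// ltW.
have mg : measurable_fun [set: measurableTypeR R] (fun z => (gauss_fun z)%:E).
  by apply/measurable_EFinP; exact: measurable_gauss_fun.
have g0 z : (0 <= (gauss_fun z : R)%:E)%E by rewrite lee_fin gauss_fun_ge0.
have := @ge0_integral_affine R c (- (m * c)) c0 setT _ measurableT mg (fun z _ => g0 z).
rewrite integralT_gauss preimage_setT => h.
have maff : measurable_fun setT (@affine_map R c (- (m * c))) by exact: measurable_affine_map.
have mga : measurable_fun setT (fun z => (gauss_fun (@affine_map R c (- (m * c)) z))%:E).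
  exact: (measurableT_comp mg maff).
transitivity ((pi `^ (- 2^-1))%:E * (c%:E * \int[lebesgue_measure]_z (gauss_fun (@affine_map R c (- (m * c)) z))%:E))%E.
  rewrite -!ge0_integralZl//.
  - apply: eq_integral => z _; rewrite -!EFinM !mulrA; congr (_ * expR (- _))%:E.
    by rewrite /affine_map [c * z]mulrC -mulrBl exprMn c2.
  - exact: measurable_funeM.
  - by move=> z _; rewrite mule_ge0// lee_fin ltW.
  - by rewrite lee_fin powR_ge0.
  - by rewrite lee_fin ltW.
rewrite -h -EFinM -powR12_sqrt ?pi_ge0// -powRD; last by rewrite (gt_eqF (pi_gt0 R)) implybT.
by rewrite addNr powRr0.
Qed.

(** Mehler's closed form of the sum of r^n H_n(a) H_n(b) / (2^n n!); at r = exp(-s) it is the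
    one-dimensional Ornstein-Uhlenbeck density relative to the Gaussian measure. *)
Definition mehler1 (r a b : R) : R :=
  (1 - r ^+ 2) `^ (- 2^-1) * expR ((2 * r * a * b - r ^+ 2 * (a ^+ 2 + b ^+ 2)) / (1 - r ^+ 2)).

Lemma mehler1_ge0 r a b : 0 <= mehler1 r a b.
Proof. by rewrite mulr_ge0 ?powR_ge0 ?expR_ge0. Qed.

Lemma mehler1C r a b : mehler1 r a b = mehler1 r b a.
Proof. by rewrite /mehler1 [a ^+ 2 + _]addrC (mulrAC (2 * r)). Qed.

Lemma measurable_mehler1 r a : measurable_fun [set: measurableTypeR R] (mehler1 r a).
Proof.
apply: measurable_funM => //; apply: (measurableT_comp (@measurable_expR R)).
apply: measurable_funM => //; apply: measurable_funB; apply: measurable_funM => //.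
by apply: measurable_funD => //; exact: measurable_funX.
Qed.

Lemma mehler1_mass r a : 0 <= r -> r < 1 ->
  (\int[lebesgue_measure]_z (gauss1 z * mehler1 r a z)%:E = 1)%E.
Proof.
move=> r0 r1; have v0 : 0 < 1 - r ^+ 2 by rewrite subr_gt0 expr_lt1.
rewrite -(integral_gauss_shift (r * a) v0); apply: eq_integral => z _; congr (_%:E).
rewrite /gauss1 /mehler1 /gauss_fun mulrACA -expRD; congr (_ * expR _).
by field; rewrite gt_eqF.
Qed.

Lemma mehler1_comp r t a b : 0 <= r -> r < 1 -> 0 <= t -> t < 1 ->
  (\int[lebesgue_measure]_z (gauss1 z * (mehler1 r a z * mehler1 t z b))%:E = (mehler1 (r * t) a b)%:E)%E.
Proof.
move=> r0 r1 t0 t1.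
have v0 : 0 < 1 - r ^+ 2 by rewrite subr_gt0 expr_lt1.
have w0 : 0 < 1 - t ^+ 2 by rewrite subr_gt0 expr_lt1.
have u0 : 0 < 1 - (r * t) ^+ 2 by rewrite subr_gt0 expr_lt1 ?mulr_ge0// mulr_ilt1.
(* In z the integrand is Gaussian: A and m are what completing the square gives, with 1 / A = 1 +
   r^2 / (1 - r^2) + t^2 / (1 - t^2) and m / A = r a / (1 - r^2) + t b / (1 - t^2). *)
pose A := (1 - r ^+ 2) * (1 - t ^+ 2) / (1 - (r * t) ^+ 2).
pose m := (r * a * (1 - t ^+ 2) + t * b * (1 - r ^+ 2)) / (1 - (r * t) ^+ 2).
have A0 : 0 < A by rewrite divr_gt0 ?mulr_gt0.
rewrite -[RHS]mule1 -(integral_gauss_shift m A0) -ge0_integralZl//.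
- apply: eq_integral => z _; rewrite -EFinM; congr (_%:E).
  rewrite /gauss1 /mehler1 /gauss_fun.
  have reorder (g e1 e2 e3 c1 c2 : R) :
    g * e1 * ((c1 * e2) * (c2 * e3)) = g * (c1 * c2) * (e1 * e2 * e3) by ring.
  have reorder' (g e1 e2 c1 c2 : R) : c1 * e1 * (g * c2 * e2) = g * (c1 * c2) * (e1 * e2) by ring.
  rewrite reorder [RHS]reorder' -!expRD.
  have -> : (1 - r ^+ 2) `^ (- 2^-1) * (1 - t ^+ 2) `^ (- 2^-1) =
      (1 - (r * t) ^+ 2) `^ (- 2^-1) * A `^ (- 2^-1).
    rewrite -!powRM ?(ltW v0) ?(ltW w0) ?(ltW u0) ?(ltW A0)//; congr (_ `^ _).
    by rewrite /A; field; rewrite gt_eqF.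
  congr (_ * expR _).
  rewrite /A /m; field; by rewrite (gt_eqF u0) (gt_eqF v0) (gt_eqF w0).
- apply/measurable_EFinP; apply: measurable_funM => //; apply: (measurableT_comp (@measurable_expR R)).
  apply: measurableT_comp => //; apply: measurable_funM => //.
  by apply: measurable_funX; apply: measurable_funB.
- by move=> z _; rewrite lee_fin !mulr_ge0 ?powR_ge0 ?expR_ge0.
- by rewrite lee_fin mehler1_ge0.
Qed.

(** The exponent equals a^2 - (a - r b)^2 / (1 - r^2). Dropping the square gives a bound uniform in
    b at the price of exp(a^2), which becomes the weight of [M_bound]. *)
Lemma mehler1_le r a b : 0 <= r -> r < 1 ->
  mehler1 r a b <= expR (a ^+ 2) * (1 - r ^+ 2)^-1.
Proof.
move=> r0 r1; have v0 : 0 < 1 - r ^+ 2 by rewrite subr_gt0 expr_lt1.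
rewrite mulrC /mehler1; apply: ler_pM; rewrite ?powR_ge0 ?expR_ge0//.
  rewrite powRN lef_pV2 ?posrE ?powR_gt0// -[leLHS](powRr1 (ltW v0)).
  apply: ger_powR; first by rewrite v0 lerBlDr lerDl exprn_ge0.
  by rewrite invf_le1 ?ler1n.
rewrite ler_expR ler_pdivrMr//.
have : 0 <= (a - r * b) ^+ 2 by rewrite sqr_ge0.
have -> : (a - r * b) ^+ 2 = a ^+ 2 * (1 - r ^+ 2) - (2 * r * a * b - r ^+ 2 * (a ^+ 2 + b ^+ 2)) by ring.
by rewrite subr_ge0.
Qed.

Variable d : nat.
Implicit Types (s t : R) (x y : d.-tuple R).

(* T_s f(x) is the integral of mehler s x y f(y) against the Gaussian measure. *)
Definition mehler s x y : R :=
  \prod_(i < d) mehler1 (expR (- s)) (tnth x i) (tnth y i) * (0 < s)%R%:R.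

Let mehlerE s x y : 0 < s ->
  mehler s x y = \prod_(i < d) mehler1 (expR (- s)) (tnth x i) (tnth y i).
Proof. by move=> s0; rewrite /mehler s0 mulr1. Qed.

Let r1 s : 0 < s -> expR (- s) < 1. Proof. by move=> s0; rewrite expR_lt1 oppr_lt0. Qed.

Let expR_inv_bound s : 0 < s -> (1 - expR (- s) ^+ 2)^-1 <= 1 + s^-1.
Proof.
move=> s0; have v0 : 0 < 1 - expR (- s) ^+ 2 by rewrite subr_gt0 expr_lt1 ?expR_ge0 ?r1.
have s1 : 0 < 1 + s by rewrite addr_gt0.
have e : expR (- s) ^+ 2 <= (1 + s)^-1.
  rewrite -expRM_natl mulrN expRN lef_pV2 ?posrE ?expR_gt0//.
  by rewrite (le_trans _ (expR_ge1Dx _))// lerD2l ler_peMl ?ler1n// ltW.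
have E : 1 + s^-1 = (1 - (1 + s)^-1)^-1.
  have -> : 1 - (1 + s)^-1 = s / (1 + s) by field; rewrite gt_eqF.
  by rewrite invf_div mulrDl mul1r divff ?gt_eqF// addrC.
have w0 : 0 < 1 - (1 + s)^-1 by rewrite subr_gt0 invf_lt1// ltrDl.
by rewrite E lef_pV2 ?posrE// lerB.
Qed.

Theorem mehler_spec : heat_kernel_spec (@gauss_measure R d) mehler.
Proof.
split.
- by move=> s x y; rewrite /mehler mulr_ge0//; apply: prodr_ge0 => i _; exact: mehler1_ge0.
(* The inverse is rewritten as a power of exponent -1, measurable everywhere; the two expressions
   agree at positive times and the indicator covers the others. *)
- rewrite (_ : (fun z => _) = fun z : measurableTypeR R * (d.-tuple R * d.-tuple R) =>
      \prod_(i < d) (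
        (1 - expR (- z.1) ^+ 2) `^ (- 2^-1) *
        expR ((2 * expR (- z.1) * tnth z.2.1 i * tnth z.2.2 i -
               expR (- z.1) ^+ 2 * (tnth z.2.1 i ^+ 2 + tnth z.2.2 i ^+ 2)) *
              (1 - expR (- z.1) ^+ 2) `^ (- 1))) * (0 < z.1)%R%:R); last first.
    apply/funext => z; rewrite /mehler; case: ltP => [s0|]; last by rewrite !mulr0.
    rewrite !mulr1; apply: eq_bigr => i _; rewrite powR_inv1//.
    by rewrite subr_ge0 ltW// expr_lt1 ?expR_ge0 ?r1.
  have mr : measurable_fun setT (fun z : measurableTypeR R * (d.-tuple R * d.-tuple R) => expR (- z.1)).
    apply: (measurableT_comp (@measurable_expR R)).
    by apply: measurable_funN; exact: measurable_fst.
  have mx i : measurable_fun setT (fun z : measurableTypeR R * (d.-tuple R * d.-tuple R) => tnth z.2.1 i).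
    apply: (measurableT_comp (measurable_tnth i)).
    exact: (measurableT_comp measurable_fst measurable_snd).
  have my i : measurable_fun setT (fun z : measurableTypeR R * (d.-tuple R * d.-tuple R) => tnth z.2.2 i).
    apply: (measurableT_comp (measurable_tnth i)).
    exact: (measurableT_comp measurable_snd measurable_snd).
  have mv c : measurable_fun setT (fun z : measurableTypeR R * (d.-tuple R * d.-tuple R) =>
      (1 - expR (- z.1) ^+ 2) `^ c).
    apply: (measurableT_comp (measurable_powR c)).
    by apply: measurable_funB => //; exact: measurable_funX.
  apply: measurable_funM; last by apply: measurable_bool_natr; exact: measurable_fun_ltr.
  apply: measurable_prod => i _; apply: measurable_funM => //.
  apply: (measurableT_comp (@measurable_expR R)); apply: measurable_funM => //.
  apply: measurable_funB.
    by apply: measurable_funM => //; apply: measurable_funM => //; exact: measurable_funM.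
  apply: measurable_funM; first exact: measurable_funX.
  by apply: measurable_funD; exact: measurable_funX.
- by move=> s x y s0; rewrite !mehlerE//; apply: eq_bigr => i _; exact: mehler1C.
- move=> s x s0; under eq_integral do rewrite mehlerE//.
  rewrite (@integral_gauss_prod d (fun i => mehler1 (expR (- s)) (tnth x i)) (fun=> 1)).
  + by rewrite big1_eq.
  + by move=> i; exact: measurable_mehler1.
  + by move=> i a; exact: mehler1_ge0.
  + by move=> i; apply: mehler1_mass; rewrite ?expR_ge0 ?r1.
- move=> s t x y s0 t0; rewrite mehlerE ?addr_gt0//.
  under eq_integral do rewrite !mehlerE// -big_split/=.
  rewrite (@integral_gauss_prod d
    (fun i z => mehler1 (expR (- s)) (tnth x i) z * mehler1 (expR (- t)) z (tnth y i))
    (fun i => mehler1 (expR (- (s + t))) (tnth x i) (tnth y i)))//.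
  + move=> i; apply: measurable_funM; first exact: measurable_mehler1.
    by under eq_fun do rewrite mehler1C; exact: measurable_mehler1.
  + by move=> i a; rewrite mulr_ge0 ?mehler1_ge0.
  + by move=> i; rewrite opprD expRD; apply: mehler1_comp; rewrite ?expR_ge0 ?r1.
(* Each coordinate contributes one factor exp(x_i^2) and one pole, since 1 / (1 - exp(-2s)) <= 1 +
   1/s; hence the exponent d. *)
- exists d, (fun x => expR (sqnorm x)); split; first by move=> x; exact: expR_ge0.
  move=> s x y s0; rewrite mehlerE// /sqnorm expR_sum -[X in (1 + _) ^+ X]card_ord -prodr_const.
  rewrite -big_split/=; apply: ler_prod => i _; rewrite mehler1_ge0/=.
  apply: (le_trans (mehler1_le _ _ (expR_ge0 _) (r1 s0))).
  by rewrite ler_wpM2l ?expR_ge0 ?expR_inv_bound.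
Qed.

Lemma ornstein_uhlenbeck_kernelE s x y : 0 < s ->
  pi `^ (- (d%:R / 2)) * (1 - expR (- (2 * s))) `^ (- (d%:R / 2)) *
    expR (- (sqnorm [tuple tnth y i - expR (- s) * tnth x i | i < d] / (1 - expR (- (2 * s))))) =
  mehler s x y * gauss_density y.
Proof.
move=> s0; have rE : expR (- (2 * s)) = expR (- s) ^+ 2 by rewrite -expRM_natl mulrN.
have v0 : 0 < 1 - expR (- s) ^+ 2 by rewrite subr_gt0 expr_lt1 ?expR_ge0 ?r1.
rewrite rE mehlerE// /mehler1 big_split/= prodr_const card_ord -expR_sum.
rewrite -[_ `^ _ ^+ d]powR_mulrn ?powR_ge0// -powRrM /gauss_density [RHS]mulrACA -expRD.
rewrite [X in _ = X * _]mulrC mulNr [2^-1 * _]mulrC; congr (_ * expR _).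
rewrite /sqnorm -sumrN -big_split/= mulr_suml -sumrN; apply: eq_bigr => i _.
by rewrite tnth_mktuple; field; rewrite gt_eqF.
Qed.

End gauss_integral.

Section signed_density.
Context {d} {X : measurableType d} {R : realType}.
Variables (mu nu : {measure set X -> \bar R}) (w : X -> R).
Hypotheses (mw : measurable_fun setT w) (w0 : forall x, 0 <= w x).
Hypothesis nuE : forall A, measurable A -> nu A = (\int[mu]_(x in A) (w x)%:E)%E.

Lemma integral_density (f : X -> R) : measurable_fun setT f ->
  (\int[nu]_x (f x)%:E = \int[mu]_x (f x * w x)%:E)%E.
Proof.
move=> mf; have mfE : measurable_fun setT (EFin \o f) by exact/measurable_EFinP.
have pos (g : X -> R) : ((fun x => (g x * w x)%:E)^\+ = fun x => ((EFin \o g)^\+ x * (w x)%:E))%E.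
  apply/funext => x; rewrite !funeposE /= -!EFin_max -EFinM; congr (_%:E).
  by rewrite maxr_pMl// mul0r.
have neg : ((fun x => (f x * w x)%:E)^\- = fun x => ((EFin \o f)^\- x * (w x)%:E))%E.
  rewrite -!funeposN -(pos (fun x => - f x)).
  by congr funepos; apply/funext => x; rewrite /= mulNr.
rewrite integralE [RHS]integralE pos neg; congr (_ - _)%E.
- exact: (ge0_integral_density mw w0 nuE (measurable_funepos mfE) (fun x => funepos_ge0 _ x)).
- exact: (ge0_integral_density mw w0 nuE (measurable_funeneg mfE) (fun x => funeneg_ge0 _ x)).
Qed.

Lemma integrable_density (f : X -> R) :
  nu.-integrable setT (EFin \o f) -> mu.-integrable setT (fun x => (f x * w x)%:E).
Proof.
move=> /integrableP[mfE fy]; have mf : measurable_fun setT f by exact/measurable_EFinP.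
apply/integrableP; split; first by apply/measurable_EFinP; exact: measurable_funM.
rewrite (ge0_integral_density mw w0 nuE) in fy => //; last exact: measurableT_comp.
apply: le_lt_trans fy; rewrite le_eqVlt; apply/orP; left; apply/eqP.
by apply: eq_integral => x _; rewrite /= normrM [`|w x|]ger0_norm// EFinM.
Qed.

End signed_density.

(** * The Poisson-Hermite semigroup as a kernel operator *)

Section gaussian_semigroups.
Context {R : realType} (d : nat).
Local Notation gam := (@gauss_measure R d).
Local Notation L1 f := (gam.-integrable setT (EFin \o f)).
Implicit Types (f : d.-tuple R -> R) (x y : d.-tuple R) (s t : R).

Lemma L1_mehler_mul f s x : 0 < s -> L1 f -> L1 (fun y => mehler s x y * f y).
Proof.
move=> s0 intf; have [n [W [W0 HW]]] := M_bound (@mehler_spec R d).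
have mM : measurable_fun setT (mehler s x).
  apply: (measurableT_comp (M_meas (@mehler_spec R d)) (g := fun y => (s : measurableTypeR R, (x, y)))).
  by apply: measurable_fun_pair => //; exact: pair1_measurable.
apply: (@L1_le _ _ _ _ _ (fun y => W x * (1 + s^-1) ^+ n * `|f y|)).
- by apply: measurable_funM => //; exact: (L1_measurable intf).
- by move=> y; rewrite normrM ger0_norm ?(M_ge0 (@mehler_spec R d))// ler_wpM2r// HW.
- apply: L1Z; exact: (integrable_norm intf).
Qed.

Lemma ornstein_uhlenbeckE f s x : 0 < s -> L1 f ->
  ornstein_uhlenbeck s f x = \int[gam]_y (mehler s x y * f y).
Proof.
move=> s0 intf; rewrite /ornstein_uhlenbeck s0.
have intMf := L1_mehler_mul x s0 intf.
have mg := @measurable_gauss_density R d; have g0 := @gauss_density_ge0 R d.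
pose c : R := pi `^ (- (d%:R / 2)) * (1 - expR (- (2 * s))) `^ (- (d%:R / 2)).
have c0 : 0 < c.
  by rewrite mulr_gt0 ?powR_gt0 ?pi_gt0// subr_gt0 expR_lt1 oppr_lt0 mulr_gt0.
have nuE (A : set (d.-tuple R)) : measurable A ->
  gam A = (\int[lebesgue_tuple d]_(y in A) (gauss_density y)%:E)%E by [].
rewrite -/c [RHS]/Rintegral (integral_density mg g0 nuE); last exact: (L1_measurable intMf).
have intd := integrable_density mg g0 nuE intMf.
rewrite -[RHS]/(\int[lebesgue_tuple d]_y (mehler s x y * f y * gauss_density y)).
transitivity (c * \int[lebesgue_tuple d]_y (c^-1 * (mehler s x y * f y * gauss_density y))); last first.
  by rewrite RintegralZl// mulVKf// gt_eqF.
congr (_ * _); apply: eq_Rintegral => y _; rewrite mulrAC -ornstein_uhlenbeck_kernelE// -/c.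
by rewrite -[c * _ * _]mulrA mulKf// gt_eqF.
Qed.

Definition poisson_hermite_kernel : R -> d.-tuple R -> d.-tuple R -> R :=
  subordinate (@mehler R d).

Lemma poisson_hermite_kernel_spec : poisson_kernel_spec gam poisson_hermite_kernel.
Proof. exact: subordinate_spec (@mehler_spec R d). Qed.

Lemma poisson_hermiteE f t x : 0 < t -> L1 f ->
  poisson_hermite t f x = kernel_op gam poisson_hermite_kernel t f x.
Proof.
move=> t0 intf; apply: EFin_inj; rewrite (kernel_op_subordinate12 (@mehler_spec R d) x intf t0).
rewrite /poisson_hermite t0 /Rintegral.
have E : (\int[lebesgue_measure]_(s in `]0%R, +oo[) (ornstein_uhlenbeck s f x * stable_density t s)%:E =
    \int[lebesgue_measure]_s \int[gam]_y (mehler s x y * f y * stable_pdf t s)%:E)%E.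
  rewrite integral_mkcond; apply: eq_integral => s _.
  rewrite patchE /= mem_setE in_itv/= andbT /stable_pdf; case: ifPn => s0; last first.
    by under eq_integral do rewrite mulr0; rewrite integral0.
  rewrite ornstein_uhlenbeckE// /Rintegral EFinM fineK; last first.
    by apply: integrable_fin_num => //; exact: L1_mehler_mul.
  by rewrite -integralZr//; exact: L1_mehler_mul.
by rewrite E -(kernel_op_subordinate12 (@mehler_spec R d) x intf t0)//.
Qed.

Lemma dt_poisson_hermiteE f k t x : 0 < t -> L1 f ->
  dt_poisson_hermite k f t x = kernel_deriv gam poisson_hermite_kernel f k t x.
Proof.
move=> t0 intf; rewrite /dt_poisson_hermite /kernel_deriv.
elim: k t t0 => [|k IH] t t0; first by rewrite !derive1n0 poisson_hermiteE.
(* The two sides are known to agree at positive times only, so the derivatives are compared through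
   equality near t. *)
rewrite [LHS]derive1E [RHS]derive1E; apply: near_eq_derive.
near=> u; apply: IH; near: u.
exact: lt_nbhsr.
Unshelve. all: by end_near. Qed.

End gaussian_semigroups.

Section function_spaces.
Context {R : realType} (d : nat).
Local Notation gam := (@gauss_measure R d).
Local Notation K := (@poisson_hermite_kernel R d).
Implicit Types (f : d.-tuple R -> R) (alpha p q : R).

Lemma smallest_gt_lt alpha : alpha < (smallest_gt alpha)%:R.
Proof. by rewrite /smallest_gt; case: ex_minnP. Qed.

Lemma smallest_gt_le alpha n : alpha < n%:R -> (smallest_gt alpha <= n)%N.
Proof. by rewrite /smallest_gt; case: ex_minnP => m _ h /h. Qed.

Lemma smallest_gt_gt0 alpha : 0 <= alpha -> (0 < smallest_gt alpha)%N.
Proof. by move=> a0; rewrite -(ltr_nat R) (le_lt_trans a0)// smallest_gt_lt. Qed.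

Lemma ltn_smallest_gt alpha n : (n < smallest_gt alpha)%N -> n%:R <= alpha.
Proof. by rewrite ltnNge leNgt; apply: contra; exact: smallest_gt_le. Qed.

Lemma poweR_lty_iff (x : \bar R) (r : R) : (0 <= x)%E -> 0 < r ->
  (x `^ r < +oo)%E <-> (x < +oo)%E.
Proof.
move=> x0 r0; split; last by move=> xy; exact: poweR_lty.
by case: x x0 => [x||]//= _; rewrite ?ltry// gt_eqF.
Qed.

Lemma in_LfunP f p : 0 < p ->
  (f \in Lfun gam p%:E) <-> measurable_fun setT f /\ lp_finite gam p f.
Proof.
move=> p0; have E : finite_norm gam p%:E f <-> lp_finite gam p f.
  rewrite /finite_norm LnormEFin; apply: (iff_trans (poweR_lty_iff (lp_mass_ge0 _ _ _) _)).
    by rewrite invr_gt0.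
  by split=> [|[]].
split=> [/andP[]|[mf ff]].
  by rewrite inE/= => mf; rewrite inE => /E.
by apply/andP; split; [rewrite inE|rewrite inE; apply/E].
Qed.

Lemma triebel_lizorkin_seminormP f alpha p q : 0 < p -> 0 < q ->
  gam.-integrable setT (EFin \o f) ->
  (triebel_lizorkin_seminorm alpha p q f < +oo)%E <->
  (\int[gam]_x (scale_integral gam K f (smallest_gt alpha) alpha q x `^ (p / q)) < +oo)%E.
Proof.
move=> p0 q0 intf; rewrite /triebel_lizorkin_seminorm unlock.
have SE x : (\int[lebesgue_measure]_(t in `]0%R, +oo[)
    (((t `^ ((smallest_gt alpha)%:R - alpha) * `|dt_poisson_hermite (smallest_gt alpha) f t x|) `^ q) / t)%:E =
    scale_integral gam K f (smallest_gt alpha) alpha q x)%E.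
  apply: eq_integral => t; rewrite inE /= in_itv/= andbT => t0.
  by rewrite dt_poisson_hermiteE.
set I := (X in (X `^ _)%E).
rewrite (_ : I = \int[gam]_x (scale_integral gam K f (smallest_gt alpha) alpha q x `^ (p / q)))%E.
  by apply: poweR_lty_iff; [apply: integral_ge0 => x _; exact: poweR_ge0|rewrite invr_gt0].
by apply: eq_integral => x _; rewrite SE gee0_abs ?poweR_ge0// -poweRrM [p / q]mulrC.
Qed.

Lemma besov_seminormP f alpha p q : 1 < p -> 0 < q ->
  gam.-integrable setT (EFin \o f) -> lp_finite gam p f ->
  (besov_seminorm alpha p%:E q f < +oo)%E <->
  (besov_integral gam K f p (smallest_gt alpha) alpha q < +oo)%E.
Proof.
move=> p1 q0 intf ff; rewrite /besov_seminorm.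
set I := (X in (X `^ _)%E).
rewrite (_ : I = besov_integral gam K f p (smallest_gt alpha) alpha q).
  apply: poweR_lty_iff; last by rewrite invr_gt0.
  apply: integral_ge0 => t; rewrite /= in_itv/= andbT => t0.
  by rewrite lee_fin divr_ge0 ?powR_ge0// ltW.
have [B _ HB] := lp_norm_kernel_deriv (poisson_hermite_kernel_spec d) intf (smallest_gt alpha) p1 ff.
apply: eq_integral => t; rewrite inE /= in_itv/= andbT => t0; have [uy _] := HB _ t0.
rewrite (_ : dt_poisson_hermite _ _ _ = kernel_deriv gam K f (smallest_gt alpha) t); last first.
  by apply/funext => x; exact: dt_poisson_hermiteE.
by rewrite (lp_norm_EFin uy) -[X in (X `^ q)%E]EFinM poweR_EFin -EFinM.
Qed.

End function_spaces.

(** * Orders attached to the exponents, and interpolation in the Gaussian spaces *)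

Section interpolation.
Context {R : realType} (d : nat).
Local Notation gam := (@gauss_measure R d).
Variables (p0 p1 q0 q1 alpha0 alpha1 theta alpha p q : R).
Hypotheses (p01 : 1 < p0) (p11 : 1 < p1) (q01 : 1 < q0) (q11 : 1 < q1).
Hypotheses (a00 : 0 <= alpha0) (a10 : 0 <= alpha1).
Hypotheses (t0 : 0 < theta) (t1 : theta < 1).
Hypotheses (aE : alpha = alpha0 * (1 - theta) + alpha1 * theta).
Hypotheses (pE : 1 / p = (1 - theta) / p0 + theta / p1).
Hypotheses (qE : 1 / q = (1 - theta) / q0 + theta / q1).
Variable f : d.-tuple R -> R.

Let t1' : 0 < 1 - theta. Proof. by rewrite subr_gt0. Qed.

Lemma interpolated_exponent_gt1 r0 r1 r : 1 < r0 -> 1 < r1 ->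
  1 / r = (1 - theta) / r0 + theta / r1 -> 1 < r.
Proof.
move=> r01 r11 rE; have [r00 r10] : 0 < r0 /\ 0 < r1 by split; exact: (lt_trans ltr01).
have [r_gt0 _ _ _] := interpolation_weight r00 r10 t0 t1 rE.
rewrite -invf_lt1// -[r^-1]div1r rE -[ltRHS](subrK theta) ltrD//.
  by rewrite ltr_pdivrMr// ltr_pMr.
by rewrite ltr_pdivrMr// ltr_pMr.
Qed.

Let p1' : 1 < p. Proof. exact: interpolated_exponent_gt1 pE. Qed.
Let q1' : 1 < q. Proof. exact: interpolated_exponent_gt1 qE. Qed.

Let k_le : (smallest_gt alpha0 <= smallest_gt alpha1)%N ->
  (smallest_gt alpha <= smallest_gt alpha1)%N.
Proof.
move=> k01; apply: smallest_gt_le; rewrite aE.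
rewrite (_ : (smallest_gt alpha1)%:R = (smallest_gt alpha1)%:R * (1 - theta) + (smallest_gt alpha1)%:R * theta); last by ring.
apply: ltrD.
  by rewrite ltr_pM2r// (lt_le_trans (smallest_gt_lt _))// ler_nat.
by rewrite ltr_pM2r// smallest_gt_lt.
Qed.

(** A drop of the order forces alpha1 to be at least the order attached to alpha, which is at least
    1; as theta > 0, alpha is then positive. This is the condition for the Besov descent. *)
Let alpha_gt0 : (smallest_gt alpha < smallest_gt alpha1)%N -> 0 < alpha.
Proof.
move=> kk1; have h : (smallest_gt alpha)%:R <= alpha1 by exact: ltn_smallest_gt.
have a1 : 0 < alpha1.
  by rewrite (lt_le_trans _ h)// ltr0n smallest_gt_gt0// aE addr_ge0// mulr_ge0// ltW.
by rewrite aE; apply: ltr_wpDl; [rewrite mulr_ge0// ltW|exact: mulr_gt0].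
Qed.

(** If the order of alpha were a smaller n, then n would be at most alpha0 and alpha1, hence at most
    their convex combination alpha, against the choice of n. *)
Let k_eq : smallest_gt alpha0 = smallest_gt alpha1 -> smallest_gt alpha = smallest_gt alpha1.
Proof.
move=> k01; apply/eqP; rewrite eqn_leq k_le ?k01//= leqNgt; apply/negP => kk1.
have h1 := ltn_smallest_gt kk1; have h0 : (smallest_gt alpha)%:R <= alpha0.
  by apply: ltn_smallest_gt; rewrite k01.
have := smallest_gt_lt alpha; rewrite ltNge => /negP; apply.
rewrite [leRHS]aE (_ : (smallest_gt alpha)%:R =
  (smallest_gt alpha)%:R * (1 - theta) + (smallest_gt alpha)%:R * theta); last by ring.
apply: lerD.
  by rewrite ler_wpM2r// ltW.
by rewrite ler_wpM2r// ltW.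
Qed.

Let lp_finite_interpolate : measurable_fun setT f -> lp_finite gam p0 f -> lp_finite gam p1 f ->
  lp_finite gam p f.
Proof.
move=> mf f0 f1.
by have [] := lp_norm_interpolate (lt_trans ltr01 p01) (lt_trans ltr01 p11) t0 t1 pE mf f0 f1.
Qed.

Let pos (r : R) : 1 < r -> 0 < r. Proof. exact: lt_trans. Qed.

Lemma gauss_besov_interpolation : (smallest_gt alpha0 <= smallest_gt alpha1)%N ->
  gauss_besov alpha0 p0%:E q0 f -> gauss_besov alpha1 p1%:E q1 f -> gauss_besov alpha p%:E q f.
Proof.
move=> k01 [/(in_LfunP _ (pos p01))[mf f0] b0] [/(in_LfunP _ (pos p11))[_ f1] b1].
have fy := lp_finite_interpolate mf f0 f1.
have intf : gam.-integrable setT (EFin \o f) := L1_lp_mass (ltW p01) mf f0.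
split; first by apply/in_LfunP => //; exact: pos.
apply/(besov_seminormP alpha p1' (pos q1') intf fy).
move/(besov_seminormP alpha0 p01 (pos q01) intf f0) : b0 => b0.
move/(besov_seminormP alpha1 p11 (pos q11) intf f1) : b1 => b1.
exact: (besov_interpolation (poisson_hermite_kernel_spec d) intf p01 p11 p1' q01 q11 (ltW q1')
  t0 t1 aE pE qE f0 f1 k01 (k_le k01) (smallest_gt_lt _) alpha_gt0 b0 b1).
Qed.

Lemma gauss_triebel_lizorkin_interpolation : (smallest_gt alpha0 <= smallest_gt alpha1)%N ->
  gauss_triebel_lizorkin alpha0 p0 q0 f -> gauss_triebel_lizorkin alpha1 p1 q1 f ->
  gauss_triebel_lizorkin alpha p q f.
Proof.
move=> k01 [/(in_LfunP _ (pos p01))[mf f0] b0] [/(in_LfunP _ (pos p11))[_ f1] b1].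
have fy := lp_finite_interpolate mf f0 f1.
have intf : gam.-integrable setT (EFin \o f) := L1_lp_mass (ltW p01) mf f0.
split; first by apply/in_LfunP => //; exact: pos.
apply/(triebel_lizorkin_seminormP alpha (pos p1') (pos q1') intf).
move/(triebel_lizorkin_seminormP alpha0 (pos p01) (pos q01) intf) : b0.
move/(triebel_lizorkin_seminormP alpha1 (pos p11) (pos q11) intf) : b1.
have HK := poisson_hermite_kernel_spec (R := R) d.
move: k01; rewrite leq_eqVlt => /orP[/eqP k01|k01].
  rewrite k01 (k_eq k01) => b1 b0.
  exact: (triebel_lizorkin_interpolation_eq HK intf p01 p11 q01 q11 t0 t1 aE pE qE b0 b1).
move=> b1 b0.
have a01 : alpha0 < alpha1.
  by rewrite (lt_le_trans (smallest_gt_lt _))// ltn_smallest_gt.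
apply: (triebel_lizorkin_interpolation_lt HK intf p01 p11 q01 q11 t0 t1 aE pE qE
  k01 (k_le (ltnW k01)) _ _ _ a01 (smallest_gt_lt _) (lp_finite_lty f0) b0 b1).
- by apply: smallest_gt_gt0; rewrite aE addr_ge0// mulr_ge0// ltW.
- exact: ltW (smallest_gt_lt _).
- exact: ltW (smallest_gt_lt _).
Qed.

End interpolation.

Theorem theorem2p2 (R : realType) (d : nat)
    (p0 p1 q0 q1 alpha0 alpha1 theta alpha p q : R) :
  1 < p0 -> 1 < p1 -> 1 < q0 -> 1 < q1 ->
  0 <= alpha0 -> 0 <= alpha1 ->
  0 < theta -> theta < 1 ->
  alpha = alpha0 * (1 - theta) + alpha1 * theta ->
  1 / p = (1 - theta) / p0 + theta / p1 ->
  1 / q = (1 - theta) / q0 + theta / q1 ->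
  (forall f : d.-tuple R -> R,
     gauss_besov alpha0 p0%:E q0 f -> gauss_besov alpha1 p1%:E q1 f ->
     gauss_besov alpha p%:E q f) /\
  (forall f : d.-tuple R -> R,
     gauss_triebel_lizorkin alpha0 p0 q0 f ->
     gauss_triebel_lizorkin alpha1 p1 q1 f ->
     gauss_triebel_lizorkin alpha p q f).
Proof.
move=> p01 p11 q01 q11 a00 a10 t0 t1 aE pE qE.
have t0' : 0 < 1 - theta by rewrite subr_gt0.
have t1' : 1 - theta < 1 by rewrite ltrBlDr ltrDl.
(* The hypotheses are symmetric under exchanging the two indices and replacing theta by 1 - theta,
   so the smaller order may be given the index 0. *)
have swap (x y z : R) : z = x * (1 - theta) + y * theta -> z = y * (1 - (1 - theta)) + x * (1 - theta).
  by rewrite subKr addrC.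
have swapV (x y z : R) : 1 / z = (1 - theta) / x + theta / y ->
    1 / z = (1 - (1 - theta)) / y + (1 - theta) / x.
  by rewrite subKr addrC.
split=> f f0 f1.
- have [k01|k10] := leqP (smallest_gt alpha0) (smallest_gt alpha1).
    exact: (gauss_besov_interpolation p01 p11 q01 q11 a00 a10 t0 t1 aE pE qE k01 f0 f1).
  exact: (gauss_besov_interpolation p11 p01 q11 q01 a10 a00 t0' t1' (swap _ _ _ aE) (swapV _ _ _ pE)
    (swapV _ _ _ qE) (ltnW k10) f1 f0).
- have [k01|k10] := leqP (smallest_gt alpha0) (smallest_gt alpha1).
    exact: (gauss_triebel_lizorkin_interpolation p01 p11 q01 q11 a00 a10 t0 t1 aE pE qE k01 f0 f1).
  exact: (gauss_triebel_lizorkin_interpolation p11 p01 q11 q01 a10 a00 t0' t1' (swap _ _ _ aE)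
    (swapV _ _ _ pE) (swapV _ _ _ qE) (ltnW k10) f1 f0).
Qed.
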